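(* Let $M_1<M$ be positive integers and $V>0$ real, and let $\mu_1=\inf\{n\ge0:N_n>M_1\}$, $\mu=\inf\{n\ge 0: N_n>M\}$, $\nu=\inf\{n\ge 0: W_n>V\}$, $\rho=\min\{\mu,\nu\}$. Let $u_0,u,\alpha_0,\alpha$ be complex numbers of modulus at most $1$ and $v_0,v,\beta_0,\beta,\theta_0,\theta,h_0,h$ complex numbers with nonnegative real parts. Then $$E\Big[u_0^{N_{\mu_1-1}}u^{N_{\mu_1}}\alpha_0^{N_{\rho-1}}\alpha^{N_\rho}e^{-v_0W_{\mu_1-1}-vW_{\mu_1}-\beta_0W_{\rho-1}-\beta W_\rho}e^{-\theta_0\tau_{\mu_1-1}-\theta\tau_{\mu_1}-h_0\tau_{\rho-1}-h\tau_\rho}\mathbf 1_{\{\mu_1<\rho\}}\Big]$$ $$=\mathrm D_{xyw}^{-1}\left(\left[\phi_0^1-\phi_0+\frac{\varphi_0}{1-\varphi}\left(\phi^1-\phi\right)\right]\frac{\xi^1-\chi}{1-\psi}\right)(M_1,M,V),$$ where, as functions of $(x,y,w)$ with $|x|<1$, $|y|<1$, $\mathrm{Re}(w)>0$, $\varphi=\gamma(u_0u\alpha_0\alpha xy,\,v_0+v+\beta_0+\beta+w,\,\theta_0+\theta+h_0+h)$, $\varphi_0=\gamma_0(u_0u\alpha_0\alpha xy,\,v_0+v+\beta_0+\beta+w,\,\theta_0+\theta+h_0+h)$, $\phi=\gamma(u\alpha_0\alpha xy,\,v+\beta_0+\beta+w,\,\theta+h_0+h)$, $\phi_0=\gamma_0(u\alpha_0\alpha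 xy,\,v+\beta_0+\beta+w,\,\theta+h_0+h)$, $\phi^1=\gamma(u\alpha_0\alpha y,\,v+\beta_0+\beta+w,\,\theta+h_0+h)$, $\phi_0^1=\gamma_0(u\alpha_0\alpha y,\,v+\beta_0+\beta+w,\,\theta+h_0+h)$, $\psi=\gamma(\alpha_0\alpha y,\,\beta_0+\beta+w,\,h_0+h)$, $\chi=\gamma(\alpha y,\beta+w,h)$, $\xi^1=\gamma(\alpha,\beta,h)$.
   Context: Attack process: attack times $t_1<t_2<\dots$ form a Poisson process of rate $\lambda>0$ on $\mathbb R_+$. At $t_k$, $n_k$ nodes are lost, with total weight $w_k=\sum_{j=1}^{n_k}w_{jk}$. The $n_k$ are iid with values in $\{1,2,\dots\}$ and PGF $g(z)=E[z^{n_1}]$; the $w_{jk}$ are iid nonnegative real with Laplace-Stieltjes transform $l(v)=E[e^{-vw_{11}}]$; attack times, $(n_k)$ and $(w_{jk})$ are independent. For Borel $T\subset\mathbb R_+$ put $\mathcal N(T)=\sum_{k:t_k\in T}n_k$, $\mathcal W(T)=\sum_{k:t_k\in T}w_k$. Observations: a delayed renewal process $\tau_0\le\tau_1\le\dots$ independent of the attack process; $\Delta_0=\tau_0\ge0$, and $\Delta_n=\tau_n-\tau_{n-1}$ ($n\ge1$) are iid nonnegative, not a.s. zero, independent of $\Delta_0$; $L_0(\theta)=E[e^{-\theta\Delta_0}]$, $L(\theta)=E[e^{-\theta\Delta_1}]$. Put $X_0=\mathcal N([0,\tau_0])$, $Y_0=\mathcal W([0,\tau_0])$, $X_n=\mathcal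 N((\tau_{n-1},\tau_n])$, $Y_n=\mathcal W((\tau_{n-1},\tau_n])$ for $n\ge1$, $N_n=\sum_{i=0}^nX_i$, $W_n=\sum_{i=0}^nY_i$. Conventions: $N_{-1}=W_{-1}=\tau_{-1}=0$, $0^0=1$, $\inf\emptyset=\infty$. Transforms of the increments, for $|z|\le1$, $\mathrm{Re}(v)\ge0$, $\mathrm{Re}(\theta)\ge0$: $\gamma_0(z,v,\theta)=L_0[\theta+\lambda-\lambda g(zl(v))]$ and $\gamma(z,v,\theta)=L[\theta+\lambda-\lambda g(zl(v))]$. Inverse operator: $\mathcal D_x^k(F)=\frac1{k!}\frac{\partial^k}{\partial x^k}\left[\frac{F(x)}{1-x}\right]_{x=0}$ for integers $k\ge0$; $\mathcal{LC}_w^{-1}(G)(s)=\mathcal L_w^{-1}\left(G(w)/w\right)(s)$, where $\mathcal L_w^{-1}$ is the inverse Laplace transform (the right-continuous function of $s\ge0$ whose Laplace transform is $G(w)/w$, $\mathrm{Re}(w)>0$); and $\mathrm D_{xyw}^{-1}(F)(p,q,s)=\mathcal{LC}_w^{-1}\left(\mathcal D_y^q\left(\mathcal D_x^p(F)\right)\right)(s)$. *)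

(* Defs.v *)
From HB Require Import structures.
From mathcomp Require Export all_boot all_order all_algebra.
From mathcomp Require Export finmap.
From mathcomp Require Export all_classical all_reals all_analysis.
From mathcomp Require Export measurable_realfun.
From mathcomp Require Export complex.
Set Implicit Arguments.
Unset Strict Implicit.
Unset Printing Implicit Defensive.
Export Order.TTheory GRing.Theory Num.Theory.
Export numFieldNormedType.Exports.
Local Open Scope classical_set_scope.
Local Open Scope complex_scope.
Local Open Scope ring_scope.

Section complex_integral.
Context {R : realType}.

Definition cexp (z : R[i]) : R[i] :=
  (expR (complex.Re z))%:C *
    (cos (complex.Im z) +i* sin (complex.Im z)).

Context d (T : measurableType d) (mu : {measure set T -> \bar R}).

Definition cintegrable (D : set T) (f : T -> R[i]) : Prop :=
  mu.-integrable D (EFin \o (fun x => complex.Re (f x))) /\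
  mu.-integrable D (EFin \o (fun x => complex.Im (f x))).

Definition cintegral (D : set T) (f : T -> R[i]) : R[i] :=
  (\int[mu]_(x in D) complex.Re (f x)) +i*
  (\int[mu]_(x in D) complex.Im (f x)).

End complex_integral.

Section probability.
Context d (Omega : measurableType d) (R : realType) (P : probability Omega R).

Definition cexpectation (Z : Omega -> R[i]) : R[i] := cintegral P setT Z.

(* E[z ^ X]; at z = 0 the convention 0 ^ 0 = 1 is that of (_ ^+ _). *)
Definition pgf (X : Omega -> nat) (z : R[i]) : R[i] :=
  cexpectation (fun omega => z ^+ X omega).

Definition laplace_stieltjes (X : Omega -> R) (v : R[i]) : R[i] :=
  cexpectation (fun omega => cexp (- (v * (X omega)%:C))).

Definition sigma_rv d' (T : measurableType d') (X : Omega -> T) :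
    set_system Omega :=
  preimage_set_system setT X measurable.

Definition sigma_family (I : Type) d' (T : measurableType d')
    (X : I -> Omega -> T) : set_system Omega :=
  <<s \bigcup_i sigma_rv (X i) >>.

Definition mutually_independent (I : choiceType) (F : I -> set_system Omega) :
    Prop :=
  forall (J : {fset I}) (A : I -> set Omega),
    (forall i, i \in J -> F i (A i)) ->
    P (\bigcap_(i in [set` J]) A i) = (\prod_(i <- J) P (A i))%E.

Definition identically_distributed d' (T : measurableType d')
    (X Y : Omega -> T) : Prop :=
  forall B, measurable B -> P (X @^-1` B) = P (Y @^-1` B).

Definition iid (I : choiceType) d' (T : measurableType d')
    (X : I -> Omega -> T) : Prop :=
  mutually_independent (fun i => sigma_rv (X i)) /\
  forall i j, identically_distributed (X i) (X j).

(* Extended-real valued, because (t_ k) might accumulate on a null set. *)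
Definition point_count (t_ : nat -> Omega -> R) (T : set R) (omega : Omega) :
    \bar R :=
  counting [set k | T (t_ k omega)].

(* Indices start at 0: t_ 0 is the first point of the process. *)
Definition poisson_process (lambda : R) (t_ : nat -> Omega -> R) : Prop :=
  [/\ forall omega, 0 <= t_ 0%N omega,
      forall k omega, t_ k omega < t_ k.+1 omega,
      {ae P, forall omega, point_count t_ [set 0] omega = 0%E},
      forall s : nat -> R, 0 <= s 0%N -> nondecreasing_seq s ->
        mutually_independent
          (fun i => sigma_rv (point_count t_ `]s i, s i.+1]))
    & forall a b : R, 0 <= a -> a < b -> forall j : nat,
        P [set omega | point_count t_ `]a, b] omega = j%:R%:E] =
        (poisson_pmf (lambda * (b - a)) j)%:E].

(* The sum of the marks m_ k over the points t_ k lying in T.  For a Poisson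
   process t_ and bounded T there are almost surely finitely many such k, so
   that the finitely supported sum is the actual sum. *)
Definition mark_sum (U : nmodType) (t_ : nat -> Omega -> R)
    (m_ : nat -> Omega -> U) (T : set R) (omega : Omega) : U :=
  \sum_(k \in [set k | T (t_ k omega)]) m_ k omega.

Definition renewal_increment (tau : nat -> Omega -> R) (n : nat)
    (omega : Omega) : R :=
  if n is m.+1 then tau m.+1 omega - tau m omega else tau 0%N omega.

Definition observation_interval (tau : nat -> Omega -> R) (n : nat)
    (omega : Omega) : set R :=
  if n is m.+1 then `]tau m omega, tau m.+1 omega] else `[0, tau 0%N omega].

Definition observed_total (U : nmodType) (t_ : nat -> Omega -> R)
    (m_ : nat -> Omega -> U) (tau : nat -> Omega -> R) (n : nat)
    (omega : Omega) : U :=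
  \sum_(i < n.+1) mark_sum t_ m_ (observation_interval tau i omega) omega.

Definition first_index (Q : nat -> Omega -> Prop) (omega : Omega) : \bar R :=
  ereal_inf [set n%:R%:E | n in [set n | Q n omega]].

(* S_r and S_(r-1), with S_(-1) = 0, at a random index r that is a finite
   natural number; at r = +oo the index is read as 0. *)
Definition at_index (U : nmodType) (S : nat -> Omega -> U)
    (r : Omega -> \bar R) (omega : Omega) : U :=
  S (Num.truncn (fine (r omega))) omega.

Definition before_index (U : nmodType) (S : nat -> Omega -> U)
    (r : Omega -> \bar R) (omega : Omega) : U :=
  if Num.truncn (fine (r omega)) is m.+1 then S m omega else 0.

End probability.
Arguments first_index {d Omega R}.

Section inverse_operators.
Context {R : realType}.

Definition Dinv (k : nat) (F : R[i] -> R[i]) : R[i] :=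
  (k`!%:R)^-1 *
  derive1n (V := R[i]^o) k (fun x : R[i] => F x / (1 - x)) 0.

(* Only the restriction of f to [0, +oo[ matters, and it is unique. *)
Definition is_inverse_laplace (H : R[i] -> R[i]) (f : R -> R[i]^o) : Prop :=
  (forall s, 0 <= s -> f x @[x --> s^'+] --> f s) /\
  forall w : R[i], 0 < complex.Re w ->
    let e := fun s : R => cexp (- (w * s%:C)) * f s in
    cintegrable lebesgue_measure `[0, +oo[ e /\
    cintegral lebesgue_measure `[0, +oo[ e = H w.

Definition inverse_laplace (H : R[i] -> R[i]) : R -> R[i] :=
  xget (fun=> 0) [set f | is_inverse_laplace H f].

Definition LCinv (G : R[i] -> R[i]) (s : R) : R[i] :=
  inverse_laplace (fun w => G w / w) s.

Definition Dxyw_inv (F : R[i] -> R[i] -> R[i] -> R[i]) (p q : nat) (s : R) :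
    R[i] :=
  LCinv (fun w => Dinv q (fun y => Dinv p (fun x => F x y w))) s.

End inverse_operators.

Section exit_transform.
Context {R : realType}.
Variables gamma0 gamma : R[i] -> R[i] -> R[i] -> R[i].
Variables u0 u alpha0 alpha v0 v beta0 beta theta0 theta h0 h : R[i].

(* The suffix _1 marks the value at x = 1 and, for xi, the value of chi at
   y = 1, w = 0. *)
Definition exit_transform (x y w : R[i]) : R[i] :=
  let varphi := gamma (u0 * u * alpha0 * alpha * x * y)
    (v0 + v + beta0 + beta + w) (theta0 + theta + h0 + h) in
  let varphi0 := gamma0 (u0 * u * alpha0 * alpha * x * y)
    (v0 + v + beta0 + beta + w) (theta0 + theta + h0 + h) in
  let phi := gamma (u * alpha0 * alpha * x * y)
    (v + beta0 + beta + w) (theta + h0 + h) in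
  let phi0 := gamma0 (u * alpha0 * alpha * x * y)
    (v + beta0 + beta + w) (theta + h0 + h) in
  let phi_1 := gamma (u * alpha0 * alpha * y)
    (v + beta0 + beta + w) (theta + h0 + h) in
  let phi0_1 := gamma0 (u * alpha0 * alpha * y)
    (v + beta0 + beta + w) (theta + h0 + h) in
  let psi := gamma (alpha0 * alpha * y) (beta0 + beta + w) (h0 + h) in
  let chi := gamma (alpha * y) (beta + w) h in
  let xi_1 := gamma alpha beta h in
  (phi0_1 - phi0 + varphi0 / (1 - varphi) * (phi_1 - phi)) *
    ((xi_1 - chi) / (1 - psi)).

End exit_transform.

(* Main.v *)
(* Conditionally on the observation times, the counts of the Poisson process in
   the successive observation intervals are independent Poisson variables, and
   the marks are independent of everything else. Summing over all possible
   counts shows that the increments (X_i, Y_i, Delta_i) have a joint transform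
   that factors as gamma_0 times a product of copies of gamma.

   With SN k = N_(k-1) and SW k = W_(k-1), the event mu_1 = j means
   SN j <= p < SN (j+1), and rho = k means that SN k <= q and SW k <= s while
   one of the two fails at k+1. Hence the expectation restricted to mu_1 = j and
   rho = k, as a function of the thresholds (p, q, s), is a combination of four
   expectations E[S 1{A <= p} 1{B <= q} 1{C <= s}]. The operator
   (1-x) sum_p x^p (1-y) sum_q y^q w int_0^oo e^(-ws) ds turns each of them into
   E[S x^A y^B e^(-wC)], which is a joint transform of increments. The sum over
   j < k is then a product of two geometric series, equal to the stated function
   of (x, y, w), and D^(-1) undoes the operator because power series and (by
   Lerch's theorem) right-continuous inverse Laplace transforms are unique.
   Finally rho is almost surely finite, as E[2^(-N_k)] tends to 0. *)

Require Import Defs.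
From mathcomp Require Import ring lra zify.
Set Implicit Arguments.
Unset Strict Implicit.
Unset Printing Implicit Defensive.
Local Open Scope classical_set_scope.
Local Open Scope complex_scope.
Local Open Scope ring_scope.

(** * Complex numbers and sequences *)

(** The expectations that occur are of variables of modulus at most 1, so limits are exchanged by
    dominated convergence with a constant bound, or with an exponential under a Laplace transform.
    Conditional expectations are avoided: [Omega] is given two smaller sigma-algebras, one generated
    by the observation times and one by the attacks. The pair of identity maps into them has a
    product law, and Fubini freezes the observation times. As attack times may accumulate on a null
    set, one works on events [hits] with a prescribed vector of counts, where every observation
    interval holds a known block of attack indices. That these events have total probability 1 is
    the case z = 1, v = theta = 0 of the very formula obtained by summing over them. Lerch's theorem
    rests on an explicit approximation: (1 - 2^(-n s / s0))^(2^n), a polynomial in an exponential of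
    s, tends to 1 for s > s0 and to 0 for 0 <= s < s0. On the null event rho = +oo the functional
    need not vanish, since the index is read as 0 there; it must be shown measurable before that
    event can be discarded. *)

Section complex_modulus.
Context {R : realType}.
Implicit Types (z : R[i]) (x y : R).

(** The norm of [R[i]] is itself a complex number, compared in a partial order. Its real part is the
    modulus as an element of [R], ready for real limits, integrals and estimates. *)
Definition cabs z : R := complex.Re `|z|.

Lemma cabsE z : cabs z = Num.sqrt (complex.Re z ^+ 2 + complex.Im z ^+ 2).
Proof. by rewrite /cabs normc_def. Qed.

Lemma normr_cabs z : `|z| = (cabs z)%:C.
Proof. by rewrite cabsE normc_def. Qed.

Lemma cabs_ge0 z : 0 <= cabs z. Proof. by rewrite cabsE sqrtr_ge0. Qed.

Lemma cabs0 : cabs 0 = 0. Proof. by rewrite /cabs normr0. Qed.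

Lemma cabs1 : cabs 1 = 1. Proof. by rewrite /cabs normr1. Qed.

Lemma cabsM z1 z2 : cabs (z1 * z2) = cabs z1 * cabs z2.
Proof. by apply: complexI; rewrite rmorphM /= -!normr_cabs normrM. Qed.

Lemma cabsX z n : cabs (z ^+ n) = cabs z ^+ n.
Proof. by apply: complexI; rewrite rmorphXn /= -!normr_cabs normrX. Qed.

Lemma cabsN z : cabs (- z) = cabs z.
Proof. by rewrite /cabs normrN. Qed.

Lemma cabsD z1 z2 : cabs (z1 + z2) <= cabs z1 + cabs z2.
Proof. by rewrite -lecR rmorphD /= -!normr_cabs ler_normD. Qed.

Lemma cabsV z : cabs z^-1 = (cabs z)^-1.
Proof. by apply: complexI; rewrite fmorphV /= -!normr_cabs normfV. Qed.

Lemma cabs_real x : cabs x%:C = `|x|.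
Proof. by rewrite cabsE /= expr0n addr0 sqrtr_sqr. Qed.

Lemma cabs_eq0 z : (cabs z == 0) = (z == 0).
Proof.
by rewrite -(normr_eq0 z) normr_cabs; apply/eqP/eqP => [->//|/complexI].
Qed.

Lemma cabs_gt0 z : (0 < cabs z) = (z != 0).
Proof. by rewrite lt_def cabs_ge0 andbT cabs_eq0. Qed.

Lemma le1_cabs z : (`|z| <= 1) = (cabs z <= 1).
Proof. by rewrite normr_cabs -lecR. Qed.

Lemma cabs_conj z : cabs (conjc z) = cabs z.
Proof. by rewrite !cabsE; case: z => a b /=; rewrite sqrrN. Qed.

Lemma cabs_sum I (r : seq I) (Q : pred I) (f : I -> R[i]) :
  cabs (\sum_(i <- r | Q i) f i) <= \sum_(i <- r | Q i) cabs (f i).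
Proof.
elim/big_rec2: _ => [|i x z _ le]; first by rewrite cabs0.
by rewrite (le_trans (cabsD _ _))// lerD2l.
Qed.

Lemma Re_le_cabs z : `|complex.Re z| <= cabs z.
Proof. by rewrite cabsE -sqrtr_sqr ler_wsqrtr// lerDl sqr_ge0. Qed.

Lemma Im_le_cabs z : `|complex.Im z| <= cabs z.
Proof. by rewrite cabsE -sqrtr_sqr ler_wsqrtr// lerDr sqr_ge0. Qed.

Lemma cabs_le_ReIm z : cabs z <= `|complex.Re z| + `|complex.Im z|.
Proof.
rewrite cabsE -(ger0_norm (_ : 0 <= `|complex.Re z| + `|complex.Im z|)).
  rewrite -sqrtr_sqr ler_wsqrtr// sqrrD !real_normK ?num_real//.
  by rewrite lerD2r lerDl mulrn_wge0// mulr_ge0.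
by rewrite addr_ge0.
Qed.

Lemma ReD z1 z2 : complex.Re (z1 + z2) = complex.Re z1 + complex.Re z2.
Proof. by case: z1; case: z2. Qed.

Lemma ImD z1 z2 : complex.Im (z1 + z2) = complex.Im z1 + complex.Im z2.
Proof. by case: z1; case: z2. Qed.

Lemma ReN z : complex.Re (- z) = - complex.Re z. Proof. by case: z. Qed.

Lemma ImN z : complex.Im (- z) = - complex.Im z. Proof. by case: z. Qed.

Lemma ReB z1 z2 : complex.Re (z1 - z2) = complex.Re z1 - complex.Re z2.
Proof. by rewrite ReD ReN. Qed.

Lemma ImB z1 z2 : complex.Im (z1 - z2) = complex.Im z1 - complex.Im z2.
Proof. by rewrite ImD ImN. Qed.

Lemma ReM z1 z2 : complex.Re (z1 * z2) =
  complex.Re z1 * complex.Re z2 - complex.Im z1 * complex.Im z2.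
Proof. by case: z1; case: z2. Qed.

Lemma ImM z1 z2 : complex.Im (z1 * z2) =
  complex.Re z1 * complex.Im z2 + complex.Im z1 * complex.Re z2.
Proof. by case: z1; case: z2. Qed.

Lemma Re_sum I (r : seq I) (Q : pred I) (f : I -> R[i]) :
  complex.Re (\sum_(i <- r | Q i) f i) = \sum_(i <- r | Q i) complex.Re (f i).
Proof. by apply: (big_morph _ ReD). Qed.

Lemma Im_sum I (r : seq I) (Q : pred I) (f : I -> R[i]) :
  complex.Im (\sum_(i <- r | Q i) f i) = \sum_(i <- r | Q i) complex.Im (f i).
Proof. by apply: (big_morph _ ImD). Qed.

Lemma complex_ext z1 z2 : complex.Re z1 = complex.Re z2 ->
  complex.Im z1 = complex.Im z2 -> z1 = z2.
Proof. by case: z1 => a b; case: z2 => c d /= -> ->. Qed.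

Lemma cexp0 : cexp 0 = 1 :> R[i].
Proof. by rewrite /cexp/= expR0 cos0 sin0 mul1r. Qed.

Lemma cexpD z1 z2 : cexp (z1 + z2) = cexp z1 * cexp z2.
Proof.
rewrite /cexp ReD ImD expRD cosD sinD.
by apply: complex_ext; rewrite !(ReM, ImM)/=; ring.
Qed.

Lemma cexp_sum I (r : seq I) (Q : pred I) (f : I -> R[i]) :
  cexp (\sum_(i <- r | Q i) f i) = \prod_(i <- r | Q i) cexp (f i).
Proof. by apply: (big_morph cexp cexpD cexp0). Qed.

Lemma cabs_cexp z : cabs (cexp z) = expR (complex.Re z).
Proof.
by rewrite cabsM cabs_real ger0_norm ?expR_ge0// cabsE/= cos2Dsin2 sqrtr1 mulr1.
Qed.

Lemma cexp_real x : cexp x%:C = (expR x)%:C.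
Proof. by rewrite /cexp/= cos0 sin0 mulr1. Qed.

Lemma cabs_cexp_le1 z : complex.Re z <= 0 -> cabs (cexp z) <= 1.
Proof. by move=> z0; rewrite cabs_cexp -expR0 ler_expR. Qed.

End complex_modulus.

(** * Limits of complex sequences *)

Section complex_convergence.
Context {R : realType}.
Implicit Types (u v : nat -> R[i]) (a b l : R[i]).

(** Convergence by coordinates matches the coordinatewise definition of [cintegral]; [ccvg_cabs0]
    recovers the usual criterion by the modulus. *)
Definition ccvg u l := (complex.Re (u n) @[n --> \oo] --> complex.Re l) /\
  (complex.Im (u n) @[n --> \oo] --> complex.Im l).

Lemma ccvg_unique u a b : ccvg u a -> ccvg u b -> a = b.
Proof.
by move=> [ua1 ua2] [ub1 ub2]; apply: complex_ext;
  [apply: cvg_unique ub1|apply: cvg_unique ub2].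
Qed.

Lemma ccvg_cst a : ccvg (fun=> a) a.
Proof. by split; apply: cvg_cst. Qed.

Lemma ccvgD u v a b : ccvg u a -> ccvg v b -> ccvg (fun n => u n + v n) (a + b).
Proof.
move=> [ua1 ua2] [vb1 vb2]; split.
  by under eq_fun do rewrite ReD; rewrite ReD; apply: cvgD.
by under eq_fun do rewrite ImD; rewrite ImD; apply: cvgD.
Qed.

Lemma ccvgN u a : ccvg u a -> ccvg (fun n => - u n) (- a).
Proof.
move=> [ua1 ua2]; split.
  by under eq_fun do rewrite ReN; rewrite ReN; apply: cvgN.
by under eq_fun do rewrite ImN; rewrite ImN; apply: cvgN.
Qed.

Lemma ccvgB u v a b : ccvg u a -> ccvg v b -> ccvg (fun n => u n - v n) (a - b).
Proof. by move=> ua vb; apply: ccvgD => //; apply: ccvgN. Qed.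

Lemma ccvgM u v a b : ccvg u a -> ccvg v b -> ccvg (fun n => u n * v n) (a * b).
Proof.
move=> [ua1 ua2] [vb1 vb2]; split.
  by under eq_fun do rewrite ReM; rewrite ReM; apply: cvgB; apply: cvgM.
by under eq_fun do rewrite ImM; rewrite ImM; apply: cvgD; apply: cvgM.
Qed.

Lemma ccvg_sum I (r : seq I) (f : I -> nat -> R[i]) (l : I -> R[i]) :
  (forall i, ccvg (f i) (l i)) ->
  ccvg (fun n => \sum_(i <- r) f i n) (\sum_(i <- r) l i).
Proof.
move=> fl; elim: r => [|i r IH].
  by under eq_fun do rewrite big_nil; rewrite big_nil; exact: ccvg_cst.
under eq_fun do rewrite big_cons; rewrite big_cons; exact: ccvgD.
Qed.

Lemma ccvg_prod I (r : seq I) (f : I -> nat -> R[i]) (l : I -> R[i]) :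
  (forall i, ccvg (f i) (l i)) ->
  ccvg (fun n => \prod_(i <- r) f i n) (\prod_(i <- r) l i).
Proof.
move=> fl; elim: r => [|i r IH].
  by under eq_fun do rewrite big_nil; rewrite big_nil; exact: ccvg_cst.
under eq_fun do rewrite big_cons; rewrite big_cons; exact: ccvgM.
Qed.

Lemma ccvg_cabs0 u l : (cabs (u n - l) @[n --> \oo] --> (0 : R)) <-> ccvg u l.
Proof.
split=> [ul|[ul1 ul2]].
  split; apply/cvgrPdist_le => e e0.
    near=> n; rewrite distrC -ReB (le_trans (Re_le_cabs _))//.
    by rewrite -[leLHS]ger0_norm ?cabs_ge0//; near: n; exact: cvgr0_norm_le.
  near=> n; rewrite distrC -ImB (le_trans (Im_le_cabs _))//.
  by rewrite -[leLHS]ger0_norm ?cabs_ge0//; near: n; exact: cvgr0_norm_le.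
have H : (`|complex.Re (u n) - complex.Re l| +
          `|complex.Im (u n) - complex.Im l|) @[n --> \oo] --> (0 : R).
  rewrite -[X in _ --> X]addr0; apply: cvgD; apply/norm_cvg0P/subr_cvg0 => //.
apply: squeeze_cvgr H; last exact: cvg_cst.
by near=> n; rewrite cabs_ge0 -ReB -ImB cabs_le_ReIm.
Unshelve. all: by end_near. Qed.

Lemma eq_ccvg u v l : (forall n, u n = v n) -> ccvg u l -> ccvg v l.
Proof. by move=> /funext ->. Qed.

Lemma near_ccvg u v l : (\forall n \near \oo, u n = v n) -> ccvg u l -> ccvg v l.
Proof.
move=> uv [h1 h2]; split; [apply: cvg_trans h1|apply: cvg_trans h2];
  by apply: near_eq_cvg; near=> n; rewrite (near uv n).
Unshelve. all: by end_near. Qed.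

Lemma ccvg_real (r : nat -> R) (x : R) :
  r n @[n --> \oo] --> x -> ccvg (fun n => (r n)%:C) x%:C.
Proof. by move=> rx; split => //=; apply: cvg_cst. Qed.

Lemma ccvg_squeeze u l (e : nat -> R) : (\forall n \near \oo, cabs (u n - l) <= e n) ->
  e n @[n --> \oo] --> (0 : R) -> ccvg u l.
Proof.
move=> ue e0; apply/ccvg_cabs0; apply: squeeze_cvgr e0; last exact: cvg_cst.
by near=> n; rewrite cabs_ge0/=; near: n.
Unshelve. all: by end_near. Qed.

Lemma ccvg_le u l (C : R) : ccvg u l -> (forall n, cabs (u n) <= C) -> cabs l <= C.
Proof.
move=> /ccvg_cabs0 ul uC; apply/ler_addgt0Pr => e e0.
have [n _ /(_ n (leqnn _))] := cvgr0_norm_le _ ul _ e0.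
rewrite /= ger0_norm ?cabs_ge0// => h.
rewrite -[l](subKr (u n)) (le_trans (cabsD _ _))// lerD// cabsN//.
Qed.

Lemma ccvg_geometric z : cabs z < 1 -> ccvg (fun n => z ^+ n) 0.
Proof.
move=> z1; apply: (@ccvg_squeeze _ _ (fun n => cabs z ^+ n)).
  by near=> n; rewrite subr0 cabsX.
by apply: cvg_expr; rewrite ger0_norm// cabs_ge0.
Unshelve. all: by end_near. Qed.

Lemma ccvg_geometric_series z : cabs z < 1 ->
  ccvg (fun n => \sum_(k < n) z ^+ k) (1 - z)^-1.
Proof.
move=> z1; have z1' : 1 - z != 0.
  by rewrite subr_eq0; apply: contraTneq z1 => <-; rewrite cabs1 ltxx.
have E n : \sum_(k < n) z ^+ k = (1 - z ^+ n) * (1 - z)^-1.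
  by rewrite -opprB subrX1 -mulNr opprB mulrC mulKf.
under [fun n => _]eq_fun do rewrite E.
rewrite -[X in ccvg _ X]mul1r -[X in ccvg _ (X * _)]subr0.
apply: ccvgM; last exact: ccvg_cst.
by apply: ccvgB; [exact: ccvg_cst|exact: ccvg_geometric].
Qed.

End complex_convergence.

(** * Complex-valued integrals *)

Section complex_measurability.
Context d (T : measurableType d) {R : realType}.
Implicit Types (f g : T -> R[i]).

Definition cmeas f := measurable_fun setT (fun x => complex.Re (f x)) /\
  measurable_fun setT (fun x => complex.Im (f x)).

Lemma eq_cmeas f g : f =1 g -> cmeas f -> cmeas g.
Proof. by move=> /funext ->. Qed.

Lemma cmeas_cst a : cmeas (fun=> a).
Proof. by split; apply: measurable_cst. Qed.

Lemma cmeasD f g : cmeas f -> cmeas g -> cmeas (fun x => f x + g x).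
Proof.
move=> [f1 f2] [g1 g2]; split.
  by under eq_fun do rewrite ReD; exact: measurable_funD.
by under eq_fun do rewrite ImD; exact: measurable_funD.
Qed.

Lemma cmeasN f : cmeas f -> cmeas (fun x => - f x).
Proof.
move=> [f1 f2]; split.
  by under eq_fun do rewrite ReN; exact: measurable_funN.
by under eq_fun do rewrite ImN; exact: measurable_funN.
Qed.

Lemma cmeasB f g : cmeas f -> cmeas g -> cmeas (fun x => f x - g x).
Proof. by move=> mf mg; apply: cmeasD => //; exact: cmeasN. Qed.

Lemma cmeasM f g : cmeas f -> cmeas g -> cmeas (fun x => f x * g x).
Proof.
move=> [f1 f2] [g1 g2]; split.
  by under eq_fun do rewrite ReM; apply: measurable_funB; exact: measurable_funM.
by under eq_fun do rewrite ImM; apply: measurable_funD; exact: measurable_funM.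
Qed.

Lemma cmeas_sum I (r : seq I) (f : I -> T -> R[i]) :
  (forall i, cmeas (f i)) -> cmeas (fun x => \sum_(i <- r) f i x).
Proof.
move=> mf; elim: r => [|i r IH].
  by under eq_fun do rewrite big_nil; exact: cmeas_cst.
by under eq_fun do rewrite big_cons; exact: cmeasD.
Qed.

Lemma cmeas_prod I (r : seq I) (f : I -> T -> R[i]) :
  (forall i, cmeas (f i)) -> cmeas (fun x => \prod_(i <- r) f i x).
Proof.
move=> mf; elim: r => [|i r IH].
  by under eq_fun do rewrite big_nil; exact: cmeas_cst.
by under eq_fun do rewrite big_cons; exact: cmeasM.
Qed.

Lemma cmeas_real (r : T -> R) : measurable_fun setT r -> cmeas (fun x => (r x)%:C).
Proof. by move=> mr; split => //=; exact: measurable_cst. Qed.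

Lemma cmeas_cexp f : cmeas f -> cmeas (fun x => cexp (f x)).
Proof.
move=> [f1 f2]; apply: cmeasM.
  by apply: cmeas_real; apply: measurableT_comp => //; exact: measurable_expR.
by split => /=; apply: measurableT_comp => //; apply: continuous_measurable_fun;
  [exact: continuous_cos|exact: continuous_sin].
Qed.

Lemma cmeas_bool (b : T -> bool) :
  measurable_fun setT b -> cmeas (fun x => (b x)%:R).
Proof.
move=> mb; rewrite (_ : (fun x => _) = fun x => ((if b x then 1 else 0 : R)%:C)).
  by apply: cmeas_real; apply: measurable_fun_ifT => //; exact: measurable_cst.
by apply/funext => x; case: (b x).
Qed.

Lemma cmeas_cvg (h : nat -> T -> R[i]) f :
  (forall n, cmeas (h n)) -> (forall x, ccvg (h ^~ x) (f x)) -> cmeas f.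
Proof.
move=> mh hf; split.
  by apply: (measurable_fun_cvg (fun m => (mh m).1)) => x _; apply: (hf x).1.
by apply: (measurable_fun_cvg (fun m => (mh m).2)) => x _; apply: (hf x).2.
Qed.

End complex_measurability.

Lemma cmeas_comp d1 d2 (T1 : measurableType d1) (T2 : measurableType d2)
    (R : realType) (f : T2 -> R[i]) (g : T1 -> T2) :
  cmeas f -> measurable_fun setT g -> cmeas (f \o g).
Proof. by move=> [f1 f2] mg; split; [exact: measurableT_comp f1 mg|
  exact: measurableT_comp f2 mg]. Qed.

Section complex_integration.
Context d (T : measurableType d) {R : realType} (mu : {measure set T -> \bar R}).
Implicit Types (f g : T -> R[i]) (G : T -> R).

Local Notation cint f := (cintegral mu setT f).
Local Notation cintable f := (cintegrable mu setT f).

Lemma cintegrable_meas f : cintable f -> cmeas f.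
Proof.
by move=> [f1 f2]; split; apply/measurable_EFinP; apply: measurable_int; eassumption.
Qed.

Lemma le_cintegrable f G : cmeas f -> mu.-integrable setT (EFin \o G) ->
  (forall x, cabs (f x) <= G x) -> cintable f.
Proof.
move=> [f1 f2] iG fG; split.
  apply: (le_integrable measurableT _ _ iG) => [|x _].
    exact/measurable_EFinP.
  by rewrite /= lee_fin (le_trans (Re_le_cabs _))// (le_trans (fG _))// ler_norm.
apply: (le_integrable measurableT _ _ iG) => [|x _].
  exact/measurable_EFinP.
by rewrite /= lee_fin (le_trans (Im_le_cabs _))// (le_trans (fG _))// ler_norm.
Qed.

Lemma cintegrableD f g : cintable f -> cintable g -> cintable (fun x => f x + g x).
Proof.
move=> [f1 f2] [g1 g2]; split; [move: (integrableD measurableT f1 g1)|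
  move: (integrableD measurableT f2 g2)]; apply: eq_integrable => // x _ /=;
  by rewrite ?ReD ?ImD EFinD.
Qed.

Lemma cintegralD f g : cintable f -> cintable g ->
  cint (fun x => f x + g x) = cint f + cint g.
Proof.
move=> [f1 f2] [g1 g2]; apply: complex_ext; rewrite ?ReD ?ImD /=.
  by rewrite -RintegralD//; apply: eq_Rintegral => x _; rewrite ReD.
by rewrite -RintegralD//; apply: eq_Rintegral => x _; rewrite ImD.
Qed.

Lemma integrableZ_real (r : R) (h : T -> R) : mu.-integrable setT (EFin \o h) ->
  mu.-integrable setT (EFin \o (fun x => r * h x)).
Proof. exact: integrableZl. Qed.

Lemma cintegrableZ a f : cintable f -> cintable (fun x => a * f x).
Proof.
move=> [f1 f2]; split.
  apply: eq_integrable (integrableB measurableT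
    (integrableZ_real (complex.Re a) f1) (integrableZ_real (complex.Im a) f2)) => //.
  by move=> x _ /=; rewrite ReM EFinB.
apply: eq_integrable (integrableD measurableT
  (integrableZ_real (complex.Re a) f2) (integrableZ_real (complex.Im a) f1)) => //.
by move=> x _ /=; rewrite ImM EFinD.
Qed.

Lemma cintegralZ a f : cintable f -> cint (fun x => a * f x) = a * cint f.
Proof.
move=> [f1 f2].
have i1 r := integrableZ_real r f1; have i2 r := integrableZ_real r f2.
apply: complex_ext; rewrite ?ReM ?ImM /=.
  rewrite -!RintegralZl// -RintegralB//.
  by apply: eq_Rintegral => x _; rewrite ReM.
rewrite -!RintegralZl// -RintegralD//.
by apply: eq_Rintegral => x _; rewrite ImM.
Qed.

Lemma cintegrableN f : cintable f -> cintable (fun x => - f x).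
Proof. by move=> /(cintegrableZ (-1)); under eq_fun do rewrite mulN1r. Qed.

Lemma cintegralN f : cintable f -> cint (fun x => - f x) = - cint f.
Proof.
move=> fi; rewrite -mulN1r -cintegralZ//.
by congr cintegral; apply/funext => x; rewrite mulN1r.
Qed.

Lemma cintegrableB f g : cintable f -> cintable g -> cintable (fun x => f x - g x).
Proof. by move=> fi gi; apply: cintegrableD => //; exact: cintegrableN. Qed.

Lemma cintegralB f g : cintable f -> cintable g ->
  cint (fun x => f x - g x) = cint f - cint g.
Proof.
by move=> fi gi; rewrite cintegralD ?cintegralN//; exact: cintegrableN.
Qed.

Lemma cintegral0 : cint (fun=> 0) = 0.
Proof.
rewrite /cintegral/= !Rintegral_cst//= !mul0r; exact: complex_ext.
Qed.

Lemma cintegrable0 : cintable (fun=> 0).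
Proof. by split => /=; exact: integrable0. Qed.

Lemma cintegrable_sum I (r : seq I) (f : I -> T -> R[i]) :
  (forall i, cintable (f i)) -> cintable (fun x => \sum_(i <- r) f i x).
Proof.
move=> fi; elim: r => [|i r IH].
  by under eq_fun do rewrite big_nil; exact: cintegrable0.
by under eq_fun do rewrite big_cons; exact: cintegrableD.
Qed.

Lemma cintegral_sum I (r : seq I) (f : I -> T -> R[i]) :
  (forall i, cintable (f i)) ->
  cint (fun x => \sum_(i <- r) f i x) = \sum_(i <- r) cint (f i).
Proof.
move=> fi; elim: r => [|i r IH].
  by under eq_fun do rewrite big_nil; rewrite big_nil cintegral0.
under eq_fun do rewrite big_cons; rewrite big_cons cintegralD ?IH//.
exact: cintegrable_sum.
Qed.

(* Rotating the integral onto the positive real axis reduces the bound to the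
   real part. *)
Lemma cabs_cintegral_le f G : cintable f -> mu.-integrable setT (EFin \o G) ->
  (forall x, cabs (f x) <= G x) -> cabs (cint f) <= \int[mu]_x G x.
Proof.
move=> fi iG fG; have [->|I0] := eqVneq (cint f) 0.
  rewrite cabs0; apply: Rintegral_ge0 => x _.
  by rewrite (le_trans _ (fG x))// cabs_ge0.
have c0 : 0 < cabs (cint f) by rewrite cabs_gt0.
rewrite -(ler_pM2l c0).
have -> : cabs (cint f) * cabs (cint f) =
    complex.Re (cint (fun x => conjc (cint f) * f x)).
  by rewrite cintegralZ// [conjc _ * _]mulrC -sqr_normc normr_cabs -rmorphXn.
rewrite -RintegralZl//.
have ci := cintegrableZ (conjc (cint f)) fi.
apply: le_Rintegral => //; first exact: ci.1.
  exact: integrableZ_real.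
move=> x _; rewrite (le_trans (ler_norm _))// (le_trans (Re_le_cabs _))//.
by rewrite cabsM (cabs_conj (cintegral mu setT f)) ler_wpM2l ?cabs_ge0.
Qed.

Lemma Rintegral_cvg (h : nat -> T -> R) (l G : T -> R) :
  (forall n, measurable_fun setT (h n)) ->
  (forall x, h n x @[n --> \oo] --> l x) -> mu.-integrable setT (EFin \o G) ->
  (forall n x, `|h n x| <= G x) ->
  \int[mu]_x h n x @[n --> \oo] --> \int[mu]_x l x.
Proof.
move=> mh hl iG hG; have ml := measurable_fun_cvg mh (fun x _ => hl x).
have meh n : measurable_fun setT (fun x => (h n x)%:E).
  by apply/measurable_EFinP; exact: mh.
have mel : measurable_fun setT (fun x => (l x)%:E) by exact/measurable_EFinP.
have [||il _] := @dominated_convergence _ _ _ mu setT measurableT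
  (fun n x => (h n x)%:E) (fun x => (l x)%:E) (EFin \o G) meh mel _ iG _.
- by apply: aeW => x _; apply: cvg_EFin (hl x); near=> n.
- by apply: aeW => x n _; rewrite /= lee_fin.
by rewrite -[X in _ --> X -> _]fineK ?integrable_fin_num// => /fine_cvg.
Unshelve. all: by end_near. Qed.

Lemma cintegral_cvg (f_ : nat -> T -> R[i]) f G : (forall n, cmeas (f_ n)) ->
  (forall x, ccvg (f_ ^~ x) (f x)) -> mu.-integrable setT (EFin \o G) ->
  (forall n x, cabs (f_ n x) <= G x) -> ccvg (fun n => cint (f_ n)) (cint f).
Proof.
move=> mf ff iG fG; split => /=.
  apply: (Rintegral_cvg (fun n => (mf n).1) (fun x => (ff x).1) iG) => n x.
  exact: le_trans (Re_le_cabs _) (fG n x).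
apply: (Rintegral_cvg (fun n => (mf n).2) (fun x => (ff x).2) iG) => n x.
exact: le_trans (Im_le_cabs _) (fG n x).
Qed.

Lemma ae_eq_cintegral f g : cmeas f -> cmeas g ->
  {ae mu, forall x, f x = g x} -> cint f = cint g.
Proof.
move=> [f1 f2] [g1 g2] fg; apply: complex_ext => /=; congr fine;
  apply: ae_eq_integral => //; try exact/measurable_EFinP;
  by move: fg; apply: filterS => x fgx _ /=; rewrite fgx.
Qed.

End complex_integration.

(** * Fubini's theorem for complex integrands *)

Section complex_fubini.
Context d1 d2 (T1 : measurableType d1) (T2 : measurableType d2) {R : realType}.
Variables (m1 : {sigma_finite_measure set T1 -> \bar R})
  (m2 : {sigma_finite_measure set T2 -> \bar R}).

Section real.
Variable f : T1 * T2 -> R.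
Hypothesis fi : (m1 \x m2)%E.-integrable setT (EFin \o f).

(** Integrability of the fibres is asked at every point, not almost everywhere: all inner integrals
    are then finite, [fine] loses nothing, and the inner integral is exactly [fubini_F]. *)
Lemma Rintegral_prod1 : (forall x, m2.-integrable setT (fun y => (f (x, y))%:E)) ->
  m1.-integrable setT (EFin \o (fun x => \int[m2]_y f (x, y))) /\
  \int[m1]_x \int[m2]_y f (x, y) = \int[(m1 \x m2)%E]_z f z.
Proof.
move=> fi2; have E : EFin \o (fun x => \int[m2]_y f (x, y)) =
    fubini_F m2 (EFin \o f).
  apply/funext => x; rewrite /= /Rintegral fineK//.
  exact: (integrable_fin_num _ (fi2 x)).
split; first by rewrite E; exact: integrable_fubini_F.
by rewrite /Rintegral -/(comp EFin _) -integral12_prod_meas1// -E.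
Qed.

Lemma Rintegral_prod2 : (forall y, m1.-integrable setT (fun x => (f (x, y))%:E)) ->
  \int[m2]_y \int[m1]_x f (x, y) = \int[(m1 \x m2)%E]_z f z.
Proof.
move=> fi1; have E : EFin \o (fun y => \int[m1]_x f (x, y)) =
    fubini_G m1 (EFin \o f).
  apply/funext => x; rewrite /= /Rintegral fineK//.
  exact: (integrable_fin_num _ (fi1 x)).
by rewrite /Rintegral -/(comp EFin _) -integral21_prod_meas1// -E.
Qed.

End real.

Variable f : T1 * T2 -> R[i].
Hypothesis fi : cintegrable (m1 \x m2)%E setT f.
Hypothesis fi2 : forall x, cintegrable m2 setT (fun y => f (x, y)).

Lemma cintegral_prod_meas : cintegral (m1 \x m2)%E setT f =
  cintegral m1 setT (fun x => cintegral m2 setT (fun y => f (x, y))).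
Proof.
by apply: complex_ext => /=; symmetry;
  [apply: (Rintegral_prod1 fi.1 _).2 => x; exact: (fi2 x).1|
   apply: (Rintegral_prod1 fi.2 _).2 => x; exact: (fi2 x).2].
Qed.

Lemma cintegrable_fubini : cintegrable m1 setT (fun x =>
  cintegral m2 setT (fun y => f (x, y))).
Proof.
by split; [apply: (Rintegral_prod1 fi.1 _).1 => x; exact: (fi2 x).1|
   apply: (Rintegral_prod1 fi.2 _).1 => x; exact: (fi2 x).2].
Qed.

Hypothesis fi1 : forall y, cintegrable m1 setT (fun x => f (x, y)).

Lemma cintegral_fubini :
  cintegral m1 setT (fun x => cintegral m2 setT (fun y => f (x, y))) =
  cintegral m2 setT (fun y => cintegral m1 setT (fun x => f (x, y))).
Proof.
rewrite -cintegral_prod_meas; apply: complex_ext => /=; symmetry;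
  [apply: (Rintegral_prod2 fi.1) => y; exact: (fi1 y).1|
   apply: (Rintegral_prod2 fi.2) => y; exact: (fi1 y).2].
Qed.

End complex_fubini.

(** * Series and the operator Dinv *)

Section complex_series.
Context {R : realType}.
Implicit Types (a b : nat -> R[i]) (x z : R[i]) (r C : R).

(** The coordinatewise limits have a default value for divergent series; geometric domination makes
    [csum] the true sum ([csum_cvg]). *)
Definition csum a : R[i] :=
  limn (fun n => \sum_(p < n) complex.Re (a p)) +i*
  limn (fun n => \sum_(p < n) complex.Im (a p)).

(** One pair [C], [r] for a whole family of series makes their tails uniformly small, as the
    exchange of limits in [csum_limit] requires. *)
Definition geom_dominated C r a := forall p, cabs (a p) <= C * r ^+ p.

Lemma sum_geometric_le r n : 0 <= r < 1 -> \sum_(p < n) r ^+ p <= (1 - r)^-1.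
Proof.
move=> /andP[r0 r1]; have r1' : 1 - r > 0 by rewrite subr_gt0.
have -> : \sum_(p < n) r ^+ p = (1 - r ^+ n) / (1 - r).
  by rewrite -opprB subrX1 -mulNr opprB mulrC mulKf// gt_eqF.
by rewrite -[leRHS]mul1r ler_pM2r ?invr_gt0// gerBl exprn_ge0.
Qed.

Lemma geom_dominated_ge0 C r a : geom_dominated C r a -> 0 <= C.
Proof. by move=> /(_ 0%N); rewrite expr0 mulr1; apply: le_trans (cabs_ge0 _). Qed.

Lemma is_cvg_dominated_series (s : nat -> R) C r : 0 <= r < 1 ->
  (forall p, `|s p| <= C * r ^+ p) -> cvgn (fun n => \sum_(p < n) s p).
Proof.
move=> /andP[r0 r1] sC; rewrite (_ : (fun n => _) = series s); last first.
  by apply/funext => n; rewrite /series/= big_mkord.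
apply: normed_cvg; apply: series_le_cvg (is_cvg_geometric_series (a := C) (z := r) _).
- by move=> n; exact: normr_ge0.
- by move=> n; exact: le_trans (normr_ge0 _) (sC n).
- exact: sC.
- by rewrite ger0_norm.
Qed.

Section dominated.
Variable r : R.
Hypothesis r01 : 0 <= r < 1.

Lemma csum_cvg C a : geom_dominated C r a ->
  ccvg (fun n => \sum_(p < n) a p) (csum a).
Proof.
move=> aC; split => /=.
  under eq_fun do rewrite Re_sum.
  have : cvgn (fun n => \sum_(p < n) complex.Re (a p)); last by [].
  apply: (is_cvg_dominated_series (s := fun p => complex.Re (a p)) r01) => p.
  exact: le_trans (Re_le_cabs _) (aC p).
under eq_fun do rewrite Im_sum.
have : cvgn (fun n => \sum_(p < n) complex.Im (a p)); last by [].
apply: (is_cvg_dominated_series (s := fun p => complex.Im (a p)) r01) => p.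
exact: le_trans (Im_le_cabs _) (aC p).
Qed.

Lemma csum_le C a : geom_dominated C r a -> cabs (csum a) <= C / (1 - r).
Proof.
move=> aC; apply: ccvg_le (csum_cvg aC) _ => n.
apply: (le_trans (cabs_sum _ _ _)).
apply: (@le_trans _ _ (\sum_(p < n) C * r ^+ p)); first exact: ler_sum.
rewrite -mulr_sumr ler_wpM2l ?(geom_dominated_ge0 aC)//.
exact: sum_geometric_le.
Qed.

Lemma eq_csum a b : a =1 b -> csum a = csum b.
Proof. by move=> /funext ->. Qed.

Lemma csum_split C a n : geom_dominated C r a ->
  csum a = \sum_(p < n) a p + csum (fun p => a (n + p)%N).
Proof.
move=> aC; have aC' : geom_dominated (C * r ^+ n) r (fun p => a (n + p)%N).
  by move=> p; rewrite -mulrA -exprD.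
have h : ccvg (fun m => \sum_(p < (n + m)%N) a p)
    (\sum_(p < n) a p + csum (fun p => a (n + p)%N)).
  under [fun m => _]eq_fun => m.
    rewrite big_split_ord/=; over.
  apply: ccvgD; first exact: ccvg_cst.
  have [c1 c2] := csum_cvg aC'.
  by split.
apply: ccvg_unique h.
have [c1 c2] := csum_cvg aC.
by split; [move: c1|move: c2]; rewrite -(cvg_shiftn n) /=;
  under eq_fun do rewrite addnC.
Qed.

Lemma csum_tail C a n : geom_dominated C r a ->
  cabs (csum a - \sum_(p < n) a p) <= C * r ^+ n / (1 - r).
Proof.
move=> aC; rewrite (csum_split n aC) addrC addKr; apply: csum_le => p.
by rewrite -mulrA -exprD.
Qed.

Lemma csum_unique C a l : geom_dominated C r a ->
  ccvg (fun n => \sum_(p < n) a p) l -> csum a = l.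
Proof. by move=> aC; apply: ccvg_unique; exact: csum_cvg aC. Qed.

Lemma geom_dominatedD C1 C2 a b : geom_dominated C1 r a -> geom_dominated C2 r b ->
  geom_dominated (C1 + C2) r (fun p => a p + b p).
Proof. by move=> ha hb p; rewrite (le_trans (cabsD _ _))// mulrDl lerD. Qed.

Lemma csumD C1 C2 a b : geom_dominated C1 r a -> geom_dominated C2 r b ->
  csum (fun p => a p + b p) = csum a + csum b.
Proof.
move=> ha hb; apply: (csum_unique (geom_dominatedD ha hb)).
under eq_fun do rewrite big_split/=.
by apply: ccvgD; [exact: csum_cvg ha|exact: csum_cvg hb].
Qed.

Lemma csumZ C c a : geom_dominated C r a -> csum (fun p => c * a p) = c * csum a.
Proof.
move=> ha; apply: (@csum_unique (cabs c * C)) => [p|].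
  by rewrite cabsM -mulrA ler_wpM2l// cabs_ge0.
under eq_fun do rewrite -mulr_sumr.
by apply: ccvgM; [exact: ccvg_cst|exact: csum_cvg ha].
Qed.

(* Tannery's theorem. *)
Lemma csum_limit C (u : nat -> nat -> R[i]) a :
  (forall n, geom_dominated C r (u n)) -> (forall p, ccvg (u ^~ p) (a p)) ->
  ccvg (fun n => csum (u n)) (csum a).
Proof.
move=> uC ua; have [r0 r1] := andP r01.
have r1' : 0 < 1 - r by rewrite subr_gt0.
have aC : geom_dominated C r a by move=> p; apply: ccvg_le (ua p) _ => n; exact: uC.
apply/ccvg_cabs0/cvgrPdist_le => e e0.
have tail0 : C * r ^+ n / (1 - r) @[n --> \oo] --> (0 : R).
  rewrite -[X in _ --> X](mul0r (1 - r)^-1); apply: cvgMr_tmp.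
  rewrite -[X in _ --> X](mulr0 C); apply: cvgMl_tmp.
  by apply: cvg_expr; rewrite ger0_norm.
have e3 : 0 < e / 3 by rewrite divr_gt0.
have [n _ /(_ n (leqnn _)) /= tn] := cvgr0_norm_le _ tail0 _ e3.
have {}tn : C * r ^+ n / (1 - r) <= e / 3 by exact: le_trans (ler_norm _) tn.
have /ccvg_cabs0 su : ccvg (fun k => \sum_(p < n) u k p) (\sum_(p < n) a p).
  by apply: ccvg_sum => p; exact: ua.
near=> k.
rewrite sub0r normrN ger0_norm ?cabs_ge0//.
have -> : csum (u k) - csum a = (csum (u k) - \sum_(p < n) u k p) +
   (\sum_(p < n) u k p - \sum_(p < n) a p) - (csum a - \sum_(p < n) a p) by ring.
have -> : e = e / 3 + e / 3 + e / 3 by field.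
rewrite (le_trans (cabsD _ _))// cabsN lerD//; last exact: le_trans (csum_tail n aC) tn.
rewrite (le_trans (cabsD _ _))// lerD//; first exact: le_trans (csum_tail n (uC k)) tn.
rewrite -[leLHS]ger0_norm ?cabs_ge0//; near: k.
exact: (cvgr0_norm_le _ su).
Unshelve. all: by end_near. Qed.

End dominated.

Lemma csum_geometric z : cabs z < 1 -> csum (fun p => z ^+ p) = (1 - z)^-1.
Proof.
move=> z1; apply: (@csum_unique (cabs z) _ 1); first by rewrite cabs_ge0.
  by move=> p; rewrite cabsX mul1r.
exact: ccvg_geometric_series.
Qed.

End complex_series.

(** * Derivatives of power series and extraction of coefficients *)

Section power_series.
Context {R : realType}.
Implicit Types (a b : nat -> R[i]) (f : R[i] -> R[i]) (x z : R[i]) (r C : R).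

(** This says that the radius of convergence is at least 1. Unlike boundedness of the coefficients,
    it survives differentiation ([subgeometric_dseq]), hence can be iterated. *)
Definition subgeometric a := forall r, 0 < r < 1 ->
  exists C, forall p, cabs (a p) * r ^+ p <= C.

Definition is_pseries a f := subgeometric a /\
  forall x, cabs x < 1 -> f x = csum (fun p => a p * x ^+ p).

Definition dseq a p : R[i] := p.+1%:R * a p.+1.

Lemma ccvg_shiftS (u : nat -> R[i]) l : ccvg u l -> ccvg (fun n => u n.+1) l.
Proof.
move=> [l1 l2]; split.
  by rewrite (cvg_shiftS (fun n => complex.Re (u n))).
by rewrite (cvg_shiftS (fun n => complex.Im (u n))).
Qed.

Lemma cabs_nat n : cabs (n%:R : R[i]) = n%:R.
Proof. by rewrite -(rmorph_nat (real_complex R)) cabs_real normr_nat. Qed.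

(** Each of the [p] terms [t ^+ i] with [i < p] is at least [t ^+ p], so the left side is below a
    partial geometric sum. *)
Lemma mul_nat_expr_le (t : R) p : 0 <= t < 1 -> p%:R * t ^+ p <= (1 - t)^-1.
Proof.
move=> t01; apply: le_trans (sum_geometric_le p t01).
rewrite -[X in X%:R]card_ord -mulr_natl mulr1 mulr_natl -sumr_const ler_sum// => i _.
by move: t01 => /andP[t0 t1]; apply: ler_wiXn2l => //; [exact: ltW|exact: ltnW].
Qed.

Lemma subgeometric_dseq a : subgeometric a -> subgeometric (dseq a).
Proof.
(* A radius strictly between [r] and 1: the power of [r / s] absorbs the factor [p.+1], the power of
   [s] is paid for by the hypothesis on [a]. *)
move=> sa r /andP[r0 r1]; pose s := (1 + r) / 2.
have s0 : 0 < s by rewrite /s; lra.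
have s1 : s < 1 by rewrite /s; lra.
have rs : r < s by rewrite /s; lra.
have [C aC] := sa s (introT andP (conj s0 s1)).
have C0 : 0 <= C by apply: le_trans (aC 0%N); rewrite mulr_ge0 ?cabs_ge0 ?expr0.
have rs01 : 0 <= r / s < 1 by rewrite divr_ge0 ?ltW//= ltr_pdivrMr// mul1r.
exists (C * (1 - r / s)^-1 / r) => p.
rewrite ler_pdivlMr// -mulrA -exprSr cabsM cabs_nat.
have -> : r ^+ p.+1 = (r / s) ^+ p.+1 * s ^+ p.+1.
  by rewrite -exprMn divfK// gt_eqF.
rewrite mulrC mulrACA mulrC; apply: ler_pM.
- by rewrite mulr_ge0 ?cabs_ge0// exprn_ge0// ltW.
- by rewrite mulr_ge0// exprn_ge0//; case/andP: rs01.
- by rewrite mulrC.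
- by rewrite mulrC; exact: mul_nat_expr_le.
Qed.

Lemma subgeometric_dominated a x : subgeometric a -> cabs x < 1 ->
  exists C r, 0 <= r < 1 /\ geom_dominated C r (fun p => a p * x ^+ p).
Proof.
move=> sa x1; have x0 := cabs_ge0 x; pose s := (1 + cabs x) / 2.
have s0 : 0 < s by rewrite /s; lra.
have s1 : s < 1 by rewrite /s; lra.
have xs : cabs x < s by rewrite /s; lra.
have [C aC] := sa s (introT andP (conj s0 s1)).
exists C, (cabs x / s); split.
  by rewrite divr_ge0//= ?ltW// ltr_pdivrMr// mul1r.
move=> p; rewrite cabsM cabsX.
have -> : cabs x ^+ p = s ^+ p * (cabs x / s) ^+ p.
  by rewrite -exprMn mulrC divfK// gt_eqF.
by rewrite mulrA ler_wpM2r// exprn_ge0// divr_ge0// ltW.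
Qed.

(* The remainders D_p satisfy D_(p+1) = (x + h) D_p + h^2 p x^(p-1). *)
Lemma expr_taylor1 x h r p : cabs x + cabs h <= r ->
  cabs ((x + h) ^+ p - x ^+ p - h * (p%:R * x ^+ p.-1)) * r ^+ 2 <=
  cabs h ^+ 2 * (p%:R ^+ 2 * r ^+ p).
Proof.
move=> xhr; have [x0 h0] := (cabs_ge0 x, cabs_ge0 h).
have r0 : 0 <= r by apply: le_trans xhr; rewrite addr_ge0.
have xr : cabs x <= r by apply: le_trans xhr; rewrite lerDl.
elim: p => [|p IH].
  rewrite !expr0 mul0r mulr0 subrr subr0 cabs0 mul0r.
  by rewrite mulr_ge0 ?exprn_ge0// mulr_ge0.
have -> : (x + h) ^+ p.+1 - x ^+ p.+1 - h * (p.+1%:R * x ^+ p) =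
    (x + h) * ((x + h) ^+ p - x ^+ p - h * (p%:R * x ^+ p.-1)) +
    h ^+ 2 * (p%:R * x ^+ p.-1).
  case: p {IH} => [|p]; first by rewrite !expr0 !expr1 !mul0r; ring.
  by rewrite /= !exprS -!(natr1 p.+1); ring.
apply: (@le_trans _ _ (r * (cabs h ^+ 2 * (p%:R ^+ 2 * r ^+ p)) +
    cabs h ^+ 2 * (p%:R * r ^+ p.+1))).
  apply: (le_trans (ler_wpM2r (exprn_ge0 2 r0) (cabsD _ _))).
  rewrite mulrDl; apply: lerD.
    rewrite cabsM -mulrA; apply: ler_pM => //; rewrite ?cabs_ge0 ?mulr_ge0 ?cabs_ge0 ?exprn_ge0//.
    exact: le_trans (cabsD _ _) xhr.
  rewrite cabsM cabsX cabsM cabs_nat cabsX -!mulrA.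
  rewrite ler_wpM2l ?exprn_ge0 ?cabs_ge0//.
  case: p {IH} => [|p]; first by rewrite !mul0r.
  have -> : r ^+ p.+2 = r ^+ p * r ^+ 2 by rewrite -exprD addn2.
  apply: ler_wpM2l => //=.
  by rewrite ler_wpM2l// ler_wpM2r ?exprn_ge0// lerXn2r// nnegrE.
rewrite mulrCA -mulrDr ler_wpM2l ?exprn_ge0//.
rewrite mulrCA -exprS -mulrDl ler_wpM2r ?exprn_ge0//.
have : (0 : R) <= p%:R by []. rewrite -natr1; nra.
Qed.

(** A remainder quadratic in [h], with a constant independent of [h]: this is differentiability at
    [x], and it also identifies the derivative as the series of [dseq a]. *)
Lemma pseries_taylor1 a f x : is_pseries a f -> cabs x < 1 ->
  exists K d : R, 0 < d /\ forall h, cabs h < d ->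
    cabs (f (x + h) - f x - h * csum (fun p => dseq a p * x ^+ p)) <=
    K * cabs h ^+ 2.
Proof.
move=> [sa fE] x1; have x0 := cabs_ge0 x.
(* Since (1 - e)^4 >= 1 - 4e, this [t] satisfies [cabs x < t ^+ 4]. With r = t^4 the power r^p
   offers four factors t^p: one bounds [a p], two absorb the p^2 of [expr_taylor1], and the last one
   sums to a geometric series. *)
pose t := 1 - (1 - cabs x) / 8.
have t0 : 0 < t by rewrite /t; lra.
have t1 : t < 1 by rewrite /t; lra.
have t4 : cabs x < t ^+ 4.
  apply: (@lt_le_trans _ _ (1 - 4 * ((1 - cabs x) / 8))); first lra.
  rewrite /t; set e := (_ / 8); have : 0 <= e <= 1 by apply/andP; rewrite /e; split; lra.
  by move=> /andP[e0 e1]; rewrite !exprS expr0; nra.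
have [C aC] := sa t (introT andP (conj t0 t1)).
have C0 : 0 <= C by apply: le_trans (aC 0%N); rewrite mulr_ge0 ?cabs_ge0 ?expr0.
have t01 : 0 <= t < 1 by rewrite ltW.
pose r := t ^+ 4; have r0 : 0 < r by rewrite exprn_gt0.
have r1 : r < 1 by rewrite exprn_ilt1// ltW.
exists (C * (1 - t)^-1 ^+ 3 / r ^+ 2), (r - cabs x); split; first by rewrite subr_gt0.
move=> h hd; have xhr : cabs x + cabs h <= r by rewrite -lerBrDl ltW.
have xh1 : cabs (x + h) < 1.
  by rewrite (le_lt_trans (cabsD _ _))// (le_lt_trans xhr).
have [C1 [r1' [r1b /csum_cvg c1]]] := subgeometric_dominated sa xh1.
have [C2 [r2 [r2b /csum_cvg c2]]] := subgeometric_dominated sa x1.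
have [C3 [r3 [r3b /csum_cvg c3]]] :=
  subgeometric_dominated (subgeometric_dseq sa) x1.
rewrite !fE//.
(* The derivative series receives a zero term at [p = 0], so that the partial sums of all three
   series run over the same indices. *)
have {}c3 : ccvg (fun n => \sum_(p < n.+1) a p * (p%:R * x ^+ p.-1))
    (csum (fun p => dseq a p * x ^+ p)).
  apply: eq_ccvg (c3 r3b) => n; rewrite big_ord_recl/= mul0r mulr0 add0r.
  by apply: eq_bigr => p _; rewrite /dseq /= [RHS]mulrCA mulrA.
have c := ccvgB (ccvgB (ccvg_shiftS (c1 r1b)) (ccvg_shiftS (c2 r2b)))
  (ccvgM (ccvg_cst h) c3).
apply: ccvg_le c _ => n.
rewrite mulr_sumr -!sumrB (le_trans (cabs_sum _ _ _))//.
apply: (@le_trans _ _ (\sum_(p < n.+1)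
   (C * (1 - t)^-1 ^+ 2 / r ^+ 2 * cabs h ^+ 2) * t ^+ p)).
  apply: ler_sum => p _.
  have -> : a p * (x + h) ^+ p - a p * x ^+ p - h * (a p * (p%:R * x ^+ p.-1)) =
      a p * ((x + h) ^+ p - x ^+ p - h * (p%:R * x ^+ p.-1)) by ring.
  rewrite cabsM -(ler_pM2r (exprn_gt0 2 r0)) -[leLHS]mulrA.
  apply: (le_trans (ler_wpM2l (cabs_ge0 _) (expr_taylor1 p xhr))).
  have -> : C * (1 - t)^-1 ^+ 2 / r ^+ 2 * cabs h ^+ 2 * t ^+ p * r ^+ 2 =
      cabs h ^+ 2 * (C * (1 - t)^-1 ^+ 2 * t ^+ p).
    by field; rewrite gt_eqF//=; lra.
  rewrite mulrCA ler_wpM2l ?exprn_ge0 ?cabs_ge0//.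
  have -> : cabs (a p) * (p%:R ^+ 2 * r ^+ p) =
      (cabs (a p) * t ^+ p) * (p%:R * t ^+ p) ^+ 2 * t ^+ p.
    rewrite /r -exprM mulnC exprM; set tp := t ^+ p; ring.
  rewrite ler_wpM2r ?exprn_ge0 ?(ltW t0)//.
  have pt0 : 0 <= p%:R * t ^+ p by rewrite mulr_ge0// exprn_ge0// ltW.
  apply: ler_pM => //.
  - by rewrite mulr_ge0 ?cabs_ge0// exprn_ge0// ltW.
  - by rewrite exprn_ge0.
  - by rewrite lerXn2r ?nnegrE ?invr_ge0 ?subr_ge0 ?(ltW t1)//; exact: mul_nat_expr_le.
rewrite -mulr_sumr.
have -> : C * (1 - t)^-1 ^+ 3 / r ^+ 2 * cabs h ^+ 2 =
  (C * (1 - t)^-1 ^+ 2 / r ^+ 2 * cabs h ^+ 2) * (1 - t)^-1 by rewrite exprSr; ring.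
rewrite ler_wpM2l ?sum_geometric_le//.
rewrite mulr_ge0 ?exprn_ge0 ?cabs_ge0// divr_ge0 ?exprn_ge0 ?(ltW r0)//.
  by rewrite mulr_ge0// exprn_ge0// invr_ge0 subr_ge0 ltW.
exact: ltW.
Qed.

Lemma is_pseries_derive1 a f : is_pseries a f ->
  is_pseries (dseq a) (derive1 (V := R[i]^o) f).
Proof.
move=> pf; split; first exact: subgeometric_dseq pf.1.
move=> x x1; have [K [d [d0 Kd]]] := pseries_taylor1 pf x1.
rewrite /derive1; apply: (@cvg_lim R[i]^o) => //; set l := csum _; apply/cvgrPdist_lt => /= e e0.
have e0R : 0 < complex.Re e by move: e0; rewrite ltcE => /andP[].
have eE : e = (complex.Re e)%:C by apply/esym/RRe_real/gtr0_real.
(* Within this distance the bound [K * cabs h ^+ 2], divided by [cabs h], stays below [e]; the added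
   1 avoids a division by zero. *)
pose dd : R := Num.min d (complex.Re e / (`|K| + 1)).
have dd0 : 0 < dd by rewrite lt_min d0 divr_gt0// ltr_pwDr.
near=> h.
have h0 : h != 0 by near: h; exact: (@nbhs_dnbhs_neq R[i]^o).
have : `|h| < dd%:C by near: h; apply: (@dnbhs0_lt _ R[i]^o); rewrite ltcR.
rewrite normr_cabs ltcR lt_min => /andP[hd hK].
have -> : l - h^-1 *: (f (h + x) - f x : R[i]^o) =
    - (h^-1 * (f (x + h) - f x - h * l)).
  rewrite [h + x]addrC; change (l - h^-1 * (f (x + h) - f x) =
    - (h^-1 * (f (x + h) - f x - h * l))); by field.
rewrite normrN normr_cabs eE ltcR cabsM cabsV mulrC ltr_pdivrMr ?cabs_gt0//.
rewrite (le_lt_trans (Kd h hd))// expr2 mulrA ltr_pM2r ?cabs_gt0//.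
rewrite (le_lt_trans (ler_wpM2r (cabs_ge0 h) (ler_norm K)))//.
move: hK; rewrite ltr_pdivlMr ?ltr_pwDr// => hK.
rewrite (le_lt_trans _ hK)// mulrC ler_wpM2l ?cabs_ge0//.
by rewrite lerDl.
Unshelve. all: by end_near. Qed.

Lemma iter_dseq a k p :
  p`!%:R * iter k dseq a p = (p + k)`!%:R * a (p + k)%N.
Proof.
elim: k p => [|k IH] p; first by rewrite addn0.
rewrite iterS {1}/dseq mulrA -natrM mulnC -factS IH.
by rewrite addSnnS.
Qed.

Lemma is_pseries_derive1n a f k : is_pseries a f ->
  is_pseries (iter k dseq a) (derive1n (V := R[i]^o) k f).
Proof.
move=> pf; elim: k => [//|k IH].
exact: is_pseries_derive1 IH.
Qed.

Lemma is_pseries0 a f : is_pseries a f -> f 0 = a 0%N.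
Proof.
move=> [sa fE]; rewrite fE ?cabs0//.
have [C [r [r01 aC]]] : exists C r, 0 <= r < 1 /\
    geom_dominated C r (fun p => a p * 0 ^+ p).
  by apply: subgeometric_dominated; rewrite ?cabs0.
apply: (csum_unique r01 aC); apply: near_ccvg (ccvg_cst (a 0%N)).
exists 1%N => // -[//|n] _ /=; rewrite big_ord_recl expr0 mulr1 big1 ?addr0// => i _.
by rewrite expr0n mulr0.
Qed.

(** The k-th derivative at 0 is k! times the k-th coefficient, and [Dinv] divides by k!. Bounded
    coefficients suffice, because they are subgeometric. *)
Lemma Dinv_pseries a (f : R[i] -> R[i]) (C : R) k : (forall p, cabs (a p) <= C) ->
  (forall x, cabs x < 1 -> f x / (1 - x) = csum (fun p => a p * x ^+ p)) ->
  Dinv k f = a k.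
Proof.
move=> aC fE; have pf : is_pseries a (fun x => f x / (1 - x)).
  split => // r /andP[r0 r1]; exists C => p.
  rewrite (le_trans _ (aC p))// ler_piMr ?cabs_ge0// exprn_ile1// ltW//.
rewrite /Dinv (is_pseries0 (is_pseries_derive1n k pf)).
have := iter_dseq a k 0; rewrite mul1r add0n => ->.
rewrite mulKf// pnatr_eq0 -lt0n fact_gt0//.
Qed.

End power_series.

(** * Uniqueness of the inverse Laplace transform *)

Section step_approximation.
Context {R : realType}.
Implicit Types (b x s : R).

Lemma bernoulli_sub x m : 0 <= x <= 1 -> 1 - m%:R * x <= (1 - x) ^+ m.
Proof.
move=> /andP[x0 x1]; elim: m => [|m IH]; first by rewrite mul0r subr0.
rewrite exprSr (le_trans _ (ler_wpM2r _ IH)) ?subr_ge0//.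
have : (0 : R) <= m%:R by []. rewrite -natr1; nra.
Qed.

Lemma bernoulli_add x m : 0 <= x -> 1 + m%:R * x <= (1 + x) ^+ m.
Proof.
move=> x0; elim: m => [|m IH]; first by rewrite mul0r addr0.
rewrite exprSr (le_trans _ (ler_wpM2r _ IH)) ?addr_ge0//.
have : (0 : R) <= m%:R by []. rewrite -natr1; nra.
Qed.

(** The quantity behaves like exp(-(2b)^n), so the limit jumps at b = 1/2. Here Bernoulli's
    inequality gives the lower bound 1 - (2b)^n. *)
Lemma step_cvg1 b : 0 <= b < 2^-1 ->
  (1 - b ^+ n) ^+ (2 ^ n) @[n --> \oo] --> (1 : R).
Proof.
move=> /andP[b0 b2]; have b1 : b <= 1 by lra.
have h : 1 - (2 * b) ^+ n @[n --> \oo] --> (1 : R).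
  rewrite -[X in _ --> X]subr0; apply: cvgB; first exact: cvg_cst.
  by apply: cvg_expr; rewrite ger0_norm; lra.
apply: squeeze_cvgr h _; last exact: cvg_cst.
near=> n; have bn : 0 <= b ^+ n <= 1 by rewrite exprn_ge0//= exprn_ile1.
apply/andP; split.
  by have := bernoulli_sub (2 ^ n)%N bn; rewrite exprMn natrX.
by case/andP: bn => bn0 bn1; rewrite exprn_ile1 ?subr_ge0// gerBl.
Unshelve. all: by end_near. Qed.

Lemma step_cvg0 b : 2^-1 < b <= 1 ->
  (1 - b ^+ n) ^+ (2 ^ n) @[n --> \oo] --> (0 : R).
Proof.
move=> /andP[b2 b1]; have b0 : 0 < b by rewrite (lt_trans _ b2).
have b20 : 0 < 2 * b by rewrite mulr_gt0.
have h : (2 * b)^-1 ^+ n @[n --> \oo] --> (0 : R).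
  apply: cvg_expr; rewrite ger0_norm ?invr_ge0 ?(ltW b20)//.
  by rewrite invf_lt1//; lra.
apply: squeeze_cvgr h; last exact: cvg_cst.
near=> n; have /andP[bn0 bn1] : 0 <= b ^+ n <= 1.
  by rewrite exprn_ge0 ?(ltW b0)//= exprn_ile1// ltW.
rewrite exprn_ge0 ?subr_ge0//= exprVn -[leRHS]mul1r ler_pdivlMr ?exprn_gt0//.
rewrite exprMn -natrX.
(* Multiplying by (1 + b^n)^(2^n), which is at least (2b)^n by Bernoulli, turns the base into 1 -
   b^(2n), at most 1. *)
apply: (@le_trans _ _ ((1 - b ^+ n) ^+ (2 ^ n) * (1 + b ^+ n) ^+ (2 ^ n))).
  rewrite ler_wpM2l ?exprn_ge0 ?subr_ge0//.
  by apply: le_trans (bernoulli_add _ bn0); rewrite lerDr.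
rewrite -exprMn exprn_ile1//; last by rewrite -subr_sqr expr1n gerBl sqr_ge0.
by rewrite mulr_ge0 ?subr_ge0 ?addr_ge0.
Unshelve. all: by end_near. Qed.

End step_approximation.

(** * A function whose Laplace transform vanishes on the positive reals *)

Section lerch.
Context {R : realType}.
Local Notation mu := (@lebesgue_measure R).
Local Notation D := (`[0%R, +oo[%classic : set (measurableTypeR R)).
Variable phi : R -> R.
Hypothesis phi_int : forall w : R, 0 < w ->
  mu.-integrable D (EFin \o (fun s => expR (- (w * s)) * phi s)).
Hypothesis phi_int0 : forall w : R, 0 < w ->
  \int[mu]_(s in D) (expR (- (w * s)) * phi s) = 0.

Let mD : @measurable _ (measurableTypeR R) D. Proof. exact: measurable_itv. Qed.

(** One more factor [1 - expR (- (b * s))] subtracts from the integrand the same one with [w + b] in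
    place of [w]. The induction therefore has to carry all [w] at once. *)
Lemma lerch_step (b : R) m : 0 <= b -> forall w : R, 0 < w ->
  mu.-integrable D (EFin \o
    (fun s => expR (- (w * s)) * (1 - expR (- (b * s))) ^+ m * phi s)) /\
  \int[mu]_(s in D) (expR (- (w * s)) * (1 - expR (- (b * s))) ^+ m * phi s) = 0.
Proof.
move=> b0; elim: m => [|m IH] w w0.
  split; first by apply: eq_integrable (phi_int w0) => // s _ /=; rewrite mulr1.
  by rewrite -[RHS](phi_int0 w0); apply: eq_Rintegral => s _; rewrite mulr1.
have [i1 z1] := IH w w0; have [i2 z2] := IH _ (ltr_pwDl w0 b0).
have E s : expR (- (w * s)) * (1 - expR (- (b * s))) ^+ m.+1 * phi s =
    expR (- (w * s)) * (1 - expR (- (b * s))) ^+ m * phi s -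
    expR (- ((w + b) * s)) * (1 - expR (- (b * s))) ^+ m * phi s.
  by rewrite mulrDl opprD expRD exprSr; ring.
split.
  by apply: eq_integrable (integrableB mD i1 i2) => // s _ /=; rewrite E EFinB.
under eq_Rintegral => s _ do rewrite E.
by rewrite RintegralB// z1 z2 subrr.
Qed.

Lemma lerch_tail (s0 : R) : 0 < s0 ->
  \int[mu]_(s in D) (\1_(`]s0, +oo[%classic) s * (expR (- s) * phi s)) = 0.
Proof.
(* With this rate [expR (- (a * s))] equals 1/2 exactly at [s0], which is where the limits of
   [step_cvg1] and [step_cvg0] switch. *)
move=> s00; pose a := ln 2 / s0.
have a0 : 0 < a by rewrite divr_gt0// ln_gt0// ltr1n.
pose h (n : nat) s := expR (- (1 * s)) *
  (1 - expR (- (n%:R * a * s))) ^+ (2 ^ n) * phi s.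
have hi n := lerch_step (2 ^ n) (mulr_ge0 (ler0n R n) (ltW a0)) (@ltr01 R).
have ipsi := phi_int (@ltr01 R).
pose l s : \bar R := (\1_(`]s0, +oo[%classic) s * (expR (- s) * phi s))%:E.
have ml : measurable_fun D l.
  apply/measurable_EFinP; apply: measurable_funM.
    by apply: measurable_indic; exact: measurable_itv.
  apply/measurable_EFinP; apply: eq_measurable_fun (measurable_int _ ipsi).
  by move=> s _ /=; rewrite mul1r.
have as0 : expR (- (a * s0)) = 2^-1 by rewrite expRN divfK ?gt_eqF// lnK// posrE.
have hE n s : expR (- (n%:R * a * s)) = expR (- (a * s)) ^+ n.
  by rewrite -expRM_natl -mulrA mulrN.
have [||_ _ cv] := @dominated_convergence _ _ _ mu D mD (fun n s => (h n s)%:E) l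
  (fun s => (`|expR (- (1 * s)) * phi s|)%:E) (fun n => measurable_int _ (hi n).1) ml _
  (integrable_norm ipsi) _.
(* At [s0] itself neither of the two step limits applies; a single point is negligible. *)
- exists [set s0]; split; [exact: measurable_set1|exact: lebesgue_measure_set1|].
  move=> s /=; apply: contra_notP => /eqP ss0 Ds; apply: cvg_EFin; first by near=> n.
  have hs n : h n s = (1 - expR (- (a * s)) ^+ n) ^+ (2 ^ n) * (expR (- s) * phi s).
    by rewrite /h mul1r hE; ring.
  rewrite /comp; under eq_fun do rewrite hs; apply: cvgMr_tmp; rewrite indicE.
  have [s0s|ss0'] := ltP s0 s.
    rewrite mem_set; last by rewrite /= in_itv/= s0s.
    by apply: step_cvg1; rewrite expR_ge0/= -as0 ltr_expR ltrN2 ltr_pM2l.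
  rewrite memNset; last by rewrite /= in_itv/= andbT => /(le_lt_trans ss0'); rewrite ltxx.
  have {ss0 ss0'}ss0 : s < s0 by rewrite lt_neqAle ss0.
  apply: step_cvg0; rewrite -as0 ltr_expR ltrN2 ltr_pM2l// ss0/= -expR0 ler_expR oppr_le0.
  by rewrite mulr_ge0 ?(ltW a0)//; move: Ds; rewrite /= in_itv/= andbT.
- apply: aeW => s n /=; rewrite in_itv/= andbT => s_ge0; rewrite lee_fin /h !normrM.
  rewrite ler_wpM2r// ler_piMr// ger0_norm; last first.
    by rewrite exprn_ge0// subr_ge0 -expR0 ler_expR oppr_le0 mulr_ge0// mulr_ge0// ltW.
  rewrite exprn_ile1 ?gerBl ?expR_ge0//.
  by rewrite subr_ge0 -expR0 ler_expR oppr_le0 mulr_ge0// mulr_ge0// ltW.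
have : (\int[mu]_(s in D) l s = 0)%E.
  have z n : (\int[mu]_(s in D) (h n s)%:E = 0)%E.
    have := (hi n).2; rewrite /Rintegral => /eqP.
    by rewrite fine_eq0 ?integrable_fin_num//; [move/eqP|exact: (hi n).1].
  move: cv; under eq_fun do rewrite z.
  by move/cvg_unique => /(_ _ _ (cvg_cst _)); apply.
by move=> il; rewrite /Rintegral -/l il.
Unshelve. all: by end_near. Qed.

Lemma lerch_itv (a b : R) : 0 < a -> a < b ->
  mu.-integrable D (EFin \o (fun s => \1_(`]a, b]%classic) s * (expR (- s) * phi s))) /\
  \int[mu]_(s in D) (\1_(`]a, b]%classic) s * (expR (- s) * phi s)) = 0.
Proof.
move=> a0 ab; have ipsi := phi_int (@ltr01 R).
have il c : mu.-integrable D
    (EFin \o (fun s => \1_(`]c, +oo[%classic) s * (expR (- s) * phi s))).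
  apply: le_integrable (ipsi) => //=.
    apply/measurable_EFinP; apply: measurable_funM.
      by apply: measurable_indic; exact: measurable_itv.
    apply/measurable_EFinP; apply: eq_measurable_fun (measurable_int _ ipsi).
    by move=> s _ /=; rewrite mul1r.
  move=> s _; rewrite lee_fin mul1r normrM ler_piMl// indicE.
  by case: (_ \in _); rewrite ?normr1 ?normr0.
have E s : \1_(`]a, b]%classic) s * (expR (- s) * phi s) =
    \1_(`]a, +oo[%classic) s * (expR (- s) * phi s) -
    \1_(`]b, +oo[%classic) s * (expR (- s) * phi s).
  rewrite -mulrBl; congr (_ * _); rewrite !indicE !mem_setE !in_itv/= !andbT.
  by have [] := ltP a s; have [] := leP s b => //=; lra.
split.
  by apply: eq_integrable (integrableB mD (il a) (il b)) => // s _ /=; rewrite E EFinB.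
under eq_Rintegral => s _ do rewrite E.
by rewrite RintegralB// !lerch_tail ?subrr// (lt_trans a0).
Qed.

End lerch.

(** Right-continuity of an inverse transform is stated in the topology of [R[i]^o]; this translates
    it into the coordinates used for all other limits. *)
Lemma cvg_complexP {R : realType} T (F : set_system T) {FF : Filter F}
    (f : T -> R[i]) (l : R[i]) :
  ((f : T -> R[i]^o) x @[x --> F] --> (l : R[i]^o)) <->
  (complex.Re (f x) @[x --> F] --> complex.Re l) /\
  (complex.Im (f x) @[x --> F] --> complex.Im l).
Proof.
split=> [fl|[fl1 fl2]].
  have cl e : 0 < e -> \forall x \near F, cabs (l - f x) < e.
    move=> e0; have eC0 : 0 < e%:C by rewrite ltcR.
    move/cvgrPdist_lt : fl => /(_ _ eC0); apply: filterS => x.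
    by rewrite normr_cabs ltcR.
  split; apply/cvgrPdist_lt => e e0; near=> x.
    rewrite -ReB (le_lt_trans (Re_le_cabs _))//; near: x; exact: cl.
  rewrite -ImB (le_lt_trans (Im_le_cabs _))//; near: x; exact: cl.
apply/cvgrPdist_lt => e e0.
have eE : e = (complex.Re e)%:C by apply/esym/RRe_real/gtr0_real.
have e2 : 0 < complex.Re e / 2 by move: e0; rewrite eE ltcR => ?; rewrite divr_gt0.
near=> x; rewrite eE (_ : `|_| = (cabs (l - f x))%:C); last exact: normr_cabs.
rewrite ltcR (le_lt_trans (cabs_le_ReIm _))// [ltRHS]splitr ReB ImB ltrD//.
  by near: x; move/cvgrPdist_lt : fl1; exact.
by near: x; move/cvgrPdist_lt : fl2; exact.
Unshelve. all: by end_near. Qed.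

Section lerch_uniqueness.
Context {R : realType}.
Local Notation mu := (@lebesgue_measure R).
Local Notation D := (`[0%R, +oo[%classic : set (measurableTypeR R)).

(** Were [phi s] positive, right-continuity would keep [phi] above [phi s / 2] on an interval to the
    right of [s], against the vanishing of the integrals over intervals. *)
Lemma lerch_le0 (phi : R -> R) :
  (forall w : R, 0 < w ->
    mu.-integrable D (EFin \o (fun s => expR (- (w * s)) * phi s))) ->
  (forall w : R, 0 < w -> \int[mu]_(s in D) (expR (- (w * s)) * phi s) = 0) ->
  (forall s, 0 <= s -> phi x @[x --> s^'+] --> phi s) ->
  forall s, 0 <= s -> phi s <= 0.
Proof.
move=> phii phi0 phir s s0; rewrite leNgt; apply/negP => phis.
have c0 : 0 < phi s / 2 by rewrite divr_gt0.
have : \forall x \near s^'+, phi s / 2 < phi x.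
  by apply: (cvgr_gt (phi s) (phir s s0)); lra.
move=> [d /= d0 dphi].
(* The interval stays away from [s], so that its left end is positive even for [s = 0], as
   [lerch_itv] demands. *)
have [a0 ab] : 0 < s + d / 3 /\ s + d / 3 < s + d / 2 by split; lra.
have phic x : s + d / 3 < x <= s + d / 2 -> phi s / 2 < phi x.
  move=> /andP[ax xb]; apply: dphi => /=; last by lra.
  by rewrite ltr_norml; lra.
have [ii i0] := lerch_itv phii phi0 a0 ab.
have mD : @measurable _ (measurableTypeR R) D by exact: measurable_itv.
pose k := expR (- (s + d / 2)) * (phi s / 2).
have k0 : 0 < k by rewrite mulr_gt0 ?expR_gt0.
pose I : set (measurableTypeR R) := `]s + d / 3, s + d / 2]%classic.
have mI : @measurable _ (measurableTypeR R) I by exact: measurable_itv.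
have iI : mu.-integrable D (EFin \o \1_I).
  by apply: integrableS (integrable_indic_itv _ _ _ _) => //; exact: measurableT.
have : \int[mu]_(x in D) (k * \1_I x) <=
    \int[mu]_(x in D) (\1_I x * (expR (- x) * phi x)).
  apply: le_Rintegral => //; first exact: (integrableZl mD k iI).
  move=> x _; rewrite mulrC !indicE; case: (boolP (x \in I)) => xI; last by rewrite !mul0r.
  move: xI; rewrite inE /I/= in_itv/= !mul1r => xI; have px := phic _ xI.
  rewrite ler_pM ?expR_ge0 ?(ltW c0) ?(ltW px)// ler_expR lerN2.
  by case/andP: xI.
apply/negP; rewrite i0 -ltNge RintegralZl// mulr_gt0//.
rewrite /Rintegral integral_indic// setIidl; last first.
  by move=> x; rewrite /I/= !in_itv/= andbT => /andP[]; lra.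
have := lebesgue_measure_itv `]s + d / 3, s + d / 2]; rewrite -/I => mI'.
change (0 < fine (lebesgue_measure I)); rewrite mI'.
by rewrite /= lte_fin ab -EFinB/= subr_gt0.
Qed.

Lemma lerch_eq0 (phi : R -> R) :
  (forall w : R, 0 < w ->
    mu.-integrable D (EFin \o (fun s => expR (- (w * s)) * phi s))) ->
  (forall w : R, 0 < w -> \int[mu]_(s in D) (expR (- (w * s)) * phi s) = 0) ->
  (forall s, 0 <= s -> phi x @[x --> s^'+] --> phi s) ->
  forall s, 0 <= s -> phi s = 0.
Proof.
move=> phii phi0 phir s s0; apply/eqP; rewrite eq_le (lerch_le0 phii)//=.
have mD : @measurable _ (measurableTypeR R) D by exact: measurable_itv.
rewrite -oppr_le0; apply: (@lerch_le0 (fun s => - phi s)) => // [w w0|w w0|x x0].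
- by apply: eq_integrable (integrableZl mD (-1) (phii w w0)) => // x _ /=;
    rewrite -EFinM mulN1r mulrN.
- have : \int[mu]_(s in D) (-1 * (expR (- (w * s)) * phi s)) = 0.
    by rewrite RintegralZl ?phi0 ?mulr0//; exact: phii.
  by under eq_Rintegral => x _ do rewrite mulN1r -mulrN.
- by apply: cvgN; exact: phir.
Qed.

(** Only real [w] are used: then the kernel is real and commutes with taking real and imaginary
    parts, so both coordinates reduce to the real statement. The auxiliary [p] stands for either of
    them. *)
Lemma is_inverse_laplace_unique (H : R[i] -> R[i]) (f g : R -> R[i]) :
  is_inverse_laplace H f -> is_inverse_laplace H g ->
  forall s, 0 <= s -> f s = g s.
Proof.
move=> [fr fH] [gr gH] s s0.
have mD : @measurable _ (measurableTypeR R) D by exact: measurable_itv.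
have ReE (w : R) (k : R -> R[i]) x : complex.Re (cexp (- (w%:C * x%:C)) * k x) =
    expR (- (w * x)) * complex.Re (k x).
  by rewrite -rmorphM -rmorphN cexp_real ReM/= mul0r subr0.
have ImE (w : R) (k : R -> R[i]) x : complex.Im (cexp (- (w%:C * x%:C)) * k x) =
    expR (- (w * x)) * complex.Im (k x).
  by rewrite -rmorphM -rmorphN cexp_real ImM/= mul0r addr0.
suff H0 (p : R[i] -> R) :
    (forall (w : R) (k : R -> R[i]) x,
      p (cexp (- (w%:C * x%:C)) * k x) = expR (- (w * x)) * p (k x)) ->
    (forall w : R, 0 < w ->
      mu.-integrable D (EFin \o (fun x => p (cexp (- (w%:C * x%:C)) * f x))) /\
      mu.-integrable D (EFin \o (fun x => p (cexp (- (w%:C * x%:C)) * g x))) /\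
      \int[mu]_(x in D) p (cexp (- (w%:C * x%:C)) * f x) =
      \int[mu]_(x in D) p (cexp (- (w%:C * x%:C)) * g x)) ->
    (forall x, 0 <= x -> p (f y) @[y --> x^'+] --> p (f x)) ->
    (forall x, 0 <= x -> p (g y) @[y --> x^'+] --> p (g x)) -> p (f s) = p (g s).
  apply: complex_ext; first apply: (H0 (@complex.Re R)) => [//|w w0|x x0|x x0].
  - have [|[fi _] fE] := fH w%:C; first by [].
    have [|[gi _] gE] := gH w%:C; first by [].
    by split => //; split => //; rewrite -gE in fE; exact: (congr1 (@complex.Re R) fE).
  - by have /cvg_complexP[] := fr x x0.
  - by have /cvg_complexP[] := gr x x0.
  apply: (H0 (@complex.Im R)) => [//|w w0|x x0|x x0].
  - have [|[_ fi] fE] := fH w%:C; first by [].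
    have [|[_ gi] gE] := gH w%:C; first by [].
    by split => //; split => //; rewrite -gE in fE; exact: (congr1 (@complex.Im R) fE).
  - by have /cvg_complexP[] := fr x x0.
  - by have /cvg_complexP[] := gr x x0.
move=> pE pfg pf pg; apply/eqP; rewrite -subr_eq0; apply/eqP.
apply: (@lerch_eq0 (fun x => p (f x) - p (g x))) => // [w w0|w w0|x x0].
- have [fi [gi _]] := pfg w w0.
  apply: eq_integrable (integrableB mD fi gi) => // x _ /=.
  by rewrite !pE mulrBr EFinB.
- have [fi [gi fg]] := pfg w w0.
  have : \int[mu]_(x in D) (p (cexp (- (w%:C * x%:C)) * f x) -
    p (cexp (- (w%:C * x%:C)) * g x)) = 0 by rewrite RintegralB// fg subrr.
  by under eq_Rintegral => x _ do rewrite !pE -mulrBr.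
- by apply: cvgB; [exact: pf|exact: pg].
Qed.

Lemma inverse_laplaceE (H : R[i] -> R[i]) (f : R -> R[i]) :
  is_inverse_laplace H f -> forall s, 0 <= s -> inverse_laplace H s = f s.
Proof.
move=> fH s s0; apply: is_inverse_laplace_unique (fH) s s0.
by apply: (@xgetPex _ _ [set f | is_inverse_laplace H f]); exists f.
Qed.

End lerch_uniqueness.

(** * Laplace transforms of damped functions *)

Section laplace_exponential.
Context {R : realType}.
Local Notation mu := (@lebesgue_measure R).
Implicit Types (w c : R[i]) (a b s : R).

(** The free factor [c] serves twice in [cintegral_itv_cexp]: [- w^-1] yields the real part of the
    integral and ['i%C / w] the imaginary part, from one real derivative. *)
Lemma is_derive_Re_cexp w c s :
  is_derive s 1 (fun s => complex.Re (c * cexp (- (w * s%:C))) : R)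
    (complex.Re (- (w * c) * cexp (- (w * s%:C)))).
Proof.
case: w c => [x y] [c1 c2].
rewrite [X in is_derive _ _ X](_ : _ = fun s =>
    expR (- x * s) * (c1 * cos (- y * s) - c2 * sin (- y * s))); last first.
  apply/funext => t; rewrite /cexp !(ReM, ImM, ReN, ImN)/= !mulr0 !subr0 !add0r.
  by rewrite !mulNr; ring.
have dl k : is_derive s 1 (fun s : R => k * s) k.
  have := @is_deriveZ _ _ _ (@id R) k s 1 1 (is_derive_id _ _).
  by rewrite /GRing.scale/= mulr1.
have dE : is_derive s 1 (fun s : R => expR (- x * s)) (expR (- x * s) * - x).
  exact: (is_derive1_comp (is_derive_expR _) (dl _)).
have dC : is_derive s 1 (fun s : R => cos (- y * s)) (- sin (- y * s) * - y).
  exact: (is_derive1_comp (is_derive_cos _) (dl _)).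
have dS : is_derive s 1 (fun s : R => sin (- y * s)) (cos (- y * s) * - y).
  exact: (is_derive1_comp (is_derive_sin _) (dl _)).
have H : is_derive s 1 (fun s : R => expR (- x * s) *
    (c1 * cos (- y * s) - c2 * sin (- y * s)))
    (expR (- x * s) * (c1 * (- sin (- y * s) * - y) - c2 * (cos (- y * s) * - y)) +
     (c1 * cos (- y * s) - c2 * sin (- y * s)) * (expR (- x * s) * - x)) :=
  is_deriveM dE (is_deriveB (is_deriveZ c1 dC) (is_deriveZ c2 dS)).
apply: (is_derive_eq H); rewrite /cexp !(ReM, ImM, ReN, ImN)/=.
rewrite !mulr0 !subr0 !add0r -!mulNr. ring.
Qed.

Lemma continuous_Re_cexp w c :
  continuous (fun s : R => complex.Re (c * cexp (- (w * s%:C))) : R).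
Proof.
move=> s; have [d _] := is_derive_Re_cexp w c s.
by apply: differentiable_continuous; apply/derivable1_diffP.
Qed.

Lemma integral_Re_cexp w c a b : a < b ->
  \int[mu]_(s in `[a, b]) complex.Re (- (w * c) * cexp (- (w * s%:C))) =
  complex.Re (c * cexp (- (w * b%:C))) - complex.Re (c * cexp (- (w * a%:C))).
Proof.
move=> ab; rewrite /Rintegral.
rewrite (@continuous_FTC2 _ _ (fun s => complex.Re (c * cexp (- (w * s%:C)))))//.
- by apply: continuous_subspaceT => s; exact: continuous_Re_cexp.
- split.
  + by move=> s _; have [] := is_derive_Re_cexp w c s.
  + by apply: cvg_at_right_filter; exact: continuous_Re_cexp.
  + by apply: cvg_at_left_filter; exact: continuous_Re_cexp.
- by move=> s _; have H := is_derive_Re_cexp w c s; rewrite derive1E derive_val.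
Qed.

(** Up to the factor [a] this is the density of an exponential law, hence integrable; it dominates
    all Laplace integrands of bounded functions. *)
Definition damped (a s : R) : R := (0 <= s)%R%:R * expR (- (a * s)).

Lemma measurable_fun_ge a : measurable_fun setT (fun s : measurableTypeR R => a <= s).
Proof. by apply: measurable_fun_ler => //; exact: measurable_cst. Qed.

Lemma integrable_damped a : 0 < a -> mu.-integrable setT (EFin \o damped a).
Proof.
move=> a0; apply: eq_integrable (integrableZl _ a^-1 (integrable_exponential_pdf a0)) => //.
move=> s _ /=; rewrite -EFinM; congr EFin.
rewrite /damped /exponential_pdf patchE mem_setE in_itv/= andbT.
by case: ifPn => s0; rewrite ?mul0r ?mulr0// mul1r mulKf ?gt_eqF// mulNr.
Qed.

Lemma cmeas_cexp_lin w : cmeas (fun s : measurableTypeR R => cexp (- (w * s%:C))).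
Proof.
apply: cmeas_cexp; apply: cmeasN; apply: cmeasM; first exact: cmeas_cst.
by apply: cmeas_real; exact: measurable_id.
Qed.

Lemma cabs_cexp_lin w s : cabs (cexp (- (w * s%:C))) = expR (- (complex.Re w * s)).
Proof. by rewrite cabs_cexp ReN ReM/= mulr0 subr0. Qed.

Lemma cintegrable_damped w (f : measurableTypeR R -> R[i]) (C : R) : 0 < complex.Re w ->
  cmeas f -> (forall s, 0 <= s -> cabs (f s) <= C) ->
  cintegrable mu setT (fun s => (0 <= s)%R%:R * (cexp (- (w * s%:C)) * f s)).
Proof.
move=> w0 mf fC.
pose G := fun s => C * damped (complex.Re w) s. 
apply: (@le_cintegrable _ _ _ mu
  (fun s => (0 <= s)%R%:R * (cexp (- (w * s%:C)) * f s)) G).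
- apply: cmeasM; first by apply: cmeas_bool; exact: measurable_fun_ge.
  by apply: cmeasM => //; exact: cmeas_cexp_lin.
- exact: (integrableZl _ C (integrable_damped w0)).
- move=> s; rewrite /G /damped; case: (leP 0 s) => s0; last first.
    by rewrite !mul0r cabs0 mulr0.
  by rewrite !mul1r cabsM cabs_cexp_lin mulrC ler_wpM2r ?expR_ge0// fC.
Qed.

(* The indicator of [0, +oo[ in the integrand avoids restricted measures. *)
Definition laplace (f : R -> R[i]) w : R[i] :=
  cintegral mu setT (fun s => (0 <= s)%R%:R * (cexp (- (w * s%:C)) * f s)).

Lemma cintegral_itv_cexp w a b : 0 < complex.Re w -> 0 <= a -> a < b ->
  cintegral mu setT (fun s => (a <= s <= b)%R%:R * cexp (- (w * s%:C))) =
  (cexp (- (w * a%:C)) - cexp (- (w * b%:C))) / w.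
Proof.
move=> w0 a0 ab; have w0' : w != 0.
  by apply: contraTneq w0 => ->; rewrite ltxx.
have E (s : R) : cexp (- (w * s%:C)) = - (w * - w^-1) * cexp (- (w * s%:C)).
  by rewrite mulrN opprK divff// mul1r.
have E' (s : R) : - 'i%C * cexp (- (w * s%:C)) = - (w * ('i%C / w)) * cexp (- (w * s%:C)).
  by congr (_ * _); field.
have restr (p : R[i] -> R) : p 0 = 0 ->
    \int[mu]_s p ((a <= s <= b)%R%:R * cexp (- (w * s%:C))) =
    \int[mu]_(s in `[a, b]) p (cexp (- (w * s%:C))).
  move=> p0; rewrite [RHS]Rintegral_mkcond; apply: eq_Rintegral => s _.
  rewrite patchE mem_setE in_itv/=; case: ifPn => ab'; by rewrite ?mul1r ?mul0r.
apply: complex_ext => /=; rewrite restr//.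
  under eq_Rintegral => s _ do rewrite E.
  rewrite integral_Re_cexp// -ReB; congr complex.Re; field; exact: w0'.
have ImRe z : complex.Im z = complex.Re (- 'i%C * z).
  by case: z => x y /=; rewrite oppr0 mul0r mulN1r sub0r opprK.
under eq_Rintegral => s _ do rewrite ImRe E'.
rewrite integral_Re_cexp// -ReB ImRe; congr complex.Re; field; exact: w0'.
Qed.

Lemma cintegral_tail_cexp w a : 0 < complex.Re w -> 0 <= a ->
  cintegral mu setT (fun s => (a <= s)%R%:R * cexp (- (w * s%:C))) =
  cexp (- (w * a%:C)) / w.
Proof.
move=> w0 a0.
(* The successor keeps the interval nondegenerate, since [cintegral_itv_cexp] needs [a < b]. *)
have h : ccvg (fun n => cintegral mu setT (fun s =>
    (a <= s <= a + n.+1%:R)%R%:R * cexp (- (w * s%:C))))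
  (cintegral mu setT (fun s => (a <= s)%R%:R * cexp (- (w * s%:C)))).
  apply: (@cintegral_cvg _ _ _ mu
    (fun n s => (a <= s <= a + n.+1%:R)%R%:R * cexp (- (w * s%:C))) _
    (damped (complex.Re w))).
  - move=> n; apply: cmeasM; last exact: cmeas_cexp_lin.
    apply: cmeas_bool; apply: measurable_and; first exact: measurable_fun_ge.
    by apply: measurable_fun_ler => //; exact: measurable_cst.
  - move=> s; apply: near_ccvg (ccvg_cst _); near=> n.
    suff -> : s <= a + n.+1%:R by rewrite andbT.
    rewrite -lerBlDl; near: n; apply: filterS (nbhs_infty_ger (s - a)) => n.
    by move/le_trans; apply; rewrite ler_nat.
  - exact: integrable_damped.
  - move=> n s; rewrite /damped; case: (leP a s) => as0 /=; last first.
      by rewrite mul0r cabs0 mulr_ge0 ?expR_ge0.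
    rewrite (le_trans a0 as0) mul1r; case: (s <= _); last first.
      by rewrite mul0r cabs0 expR_ge0.
    by rewrite mul1r cabs_cexp_lin.
apply: ccvg_unique h _.
under eq_fun do rewrite cintegral_itv_cexp// ?ltrDl//.
apply: ccvgM; last exact: ccvg_cst.
rewrite -[X in ccvg _ X]subr0; apply: ccvgB; first exact: ccvg_cst.
pose r := expR (- complex.Re w).
apply: (@ccvg_squeeze _ _ _ (fun n => r ^+ n)).
  near=> n; rewrite subr0 cabs_cexp_lin /r -expRM_natl ler_expR mulrN lerN2.
  rewrite mulrC ler_wpM2l ?(ltW w0)//.
  by rewrite -natr1; lra.
by apply: cvg_expr; rewrite ger0_norm ?expR_ge0// -expR0 ltr_expR oppr_lt0.
Unshelve. all: by end_near. Qed.

End laplace_exponential.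

(** * Expectations of bounded complex random variables *)

Section bounded_expectation.
Context d (T : measurableType d) {R : realType} (P : probability T R).
Implicit Types (f g : T -> R[i]) (C : R).

Local Notation "''E' f" := (cexpectation P f) (at level 10, f at level 8).

Lemma Rintegral_probability_cst C : \int[P]_x C = C.
Proof.
have PT : P setT = 1%E by exact: probability_setT.
by rewrite Rintegral_cst// -[RHS]mulr1; congr (_ * _); exact: (congr1 fine PT).
Qed.

Lemma integrable_cst C : P.-integrable setT (EFin \o (fun=> C)).
Proof. exact: (finite_measure_integrable_cst P C). Qed.

Lemma bounded_cintegrable f C : cmeas f -> (forall x, cabs (f x) <= C) ->
  cintegrable P setT f.
Proof. by move=> mf fC; apply: le_cintegrable mf (integrable_cst C) fC. Qed.

Lemma cexpectation_le f C : cmeas f -> (forall x, cabs (f x) <= C) ->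
  cabs ('E f) <= C.
Proof.
move=> mf fC.
apply: (le_trans (cabs_cintegral_le (bounded_cintegrable mf fC) (integrable_cst C) fC)).
by rewrite Rintegral_probability_cst.
Qed.

Lemma cexpectation_cvg (f_ : nat -> T -> R[i]) f C : (forall n, cmeas (f_ n)) ->
  (forall n x, cabs (f_ n x) <= C) -> (forall x, ccvg (f_ ^~ x) (f x)) ->
  ccvg (fun n => 'E (f_ n)) ('E f).
Proof. by move=> mf fC ff; apply: cintegral_cvg mf ff (integrable_cst C) fC. Qed.

Lemma cexpectation_cst a : 'E (fun=> a) = a.
Proof.
rewrite /cexpectation /cintegral !Rintegral_probability_cst.
exact: complex_ext.
Qed.

End bounded_expectation.

Lemma cmeas_nat_fun d (T : measurableType d) {R : realType} (f : nat -> R[i])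
  (c : T -> nat) : measurable_fun setT c -> cmeas (fun x => f (c x)).
Proof.
by move=> mc; split; [apply: (@measurableT_comp _ _ _ _ _ _ (fun n => complex.Re (f n)))|
  apply: (@measurableT_comp _ _ _ _ _ _ (fun n => complex.Im (f n)))].
Qed.

(** * Generating functions of distribution functions *)

Section nat_transform.
Context d (T : measurableType d) {R : realType} (P : probability T R).

Lemma csum_step (y : R[i]) (c : nat) : cabs y < 1 ->
  ccvg (fun n => \sum_(q < n) y ^+ q * (c <= q)%N%:R) (y ^+ c / (1 - y)).
Proof.
move=> y1; have y01 : 0 <= cabs y < 1 by rewrite cabs_ge0.
have dom : geom_dominated 1 (cabs y) (fun q => y ^+ q * (c <= q)%N%:R).
  move=> q; rewrite mul1r cabsM cabsX ler_piMr ?exprn_ge0 ?cabs_ge0//.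
  by case: (c <= q)%N; rewrite ?cabs1 ?cabs0.
have := csum_cvg y01 dom; rewrite (csum_split y01 c dom).
rewrite big1 ?add0r => [|i _]; last by rewrite leqNgt ltn_ord/= mulr0.
under [X in ccvg _ X -> _]eq_csum => q do rewrite leq_addr mulr1 exprD.
rewrite (@csumZ _ _ y01 1); last by move=> q; rewrite cabsX mul1r.
by rewrite csum_geometric.
Qed.

(** Pointwise, summing [y ^+ q] over [q >= c x] gives [y ^+ c x / (1 - y)]. The partial sums are
    bounded by a constant, so the sum passes through the expectation. *)
Lemma csum_cexpectation (y : R[i]) (c : T -> nat) (K : T -> R[i]) C :
  cabs y < 1 -> measurable_fun setT c -> cmeas K -> (forall x, cabs (K x) <= C) ->
  (1 - y) * csum (fun q => y ^+ q * cexpectation P (fun x => K x * (c x <= q)%N%:R)) =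
  cexpectation P (fun x => K x * y ^+ c x).
Proof.
move=> y1 mc mK KC; have y0 := cabs_ge0 y.
have C0 (x : T) : 0 <= C by exact: le_trans (cabs_ge0 _) (KC x).
have y01 : 0 <= cabs y < 1 by rewrite y0.
have y1' : 1 - y != 0.
  by rewrite subr_eq0; apply: contraTneq y1 => <-; rewrite cabs1 ltxx.
have mb q : cmeas (fun x => (c x <= q)%N%:R : R[i]).
  by apply: cmeas_bool; apply: measurable_fun_leq => //; exact: measurable_cst.
have b1 q x : cabs ((c x <= q)%N%:R : R[i]) <= 1.
  by case: (c x <= q)%N; rewrite ?cabs1 ?cabs0.
have KbC q x : cabs (K x * (c x <= q)%N%:R) <= C.
  by rewrite cabsM (le_trans _ (KC x))// ler_piMr// cabs_ge0.
have Kbi q := bounded_cintegrable P (cmeasM mK (mb q)) (KbC q).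
have -> : csum (fun q => y ^+ q * cexpectation P (fun x => K x * (c x <= q)%N%:R)) =
    cexpectation P (fun x => K x * (y ^+ c x / (1 - y))); last first.
  rewrite /cexpectation -cintegralZ.
    by congr cintegral; apply/funext => x; field.
  apply: (@bounded_cintegrable _ _ _ _ _ (C * (cabs (1 - y))^-1)).
    apply: cmeasM => //; apply: cmeasM; last exact: cmeas_cst.
    by apply: (@cmeas_nat_fun _ _ _ (fun n => y ^+ n)).
  move=> x; rewrite !cabsM cabsV cabsX; apply: ler_pM => //.
  - exact: cabs_ge0.
  - by rewrite mulr_ge0 ?exprn_ge0 ?invr_ge0 ?cabs_ge0.
  - by rewrite ler_piMl ?invr_ge0 ?cabs_ge0// exprn_ile1// ltW.
apply: (csum_unique y01 (C := C)) => [q|].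
  rewrite cabsM cabsX mulrC ler_wpM2r ?exprn_ge0//.
  exact: cexpectation_le (cmeasM mK (mb q)) (KbC q).
have E n : \sum_(q < n) y ^+ q * cexpectation P (fun x => K x * (c x <= q)%N%:R) =
    cexpectation P (fun x => K x * \sum_(q < n) y ^+ q * (c x <= q)%N%:R).
  under eq_bigr => q _ do rewrite /cexpectation -cintegralZ//.
  rewrite -cintegral_sum => [|q]; last exact: cintegrableZ.
  congr cintegral; apply/funext => x; rewrite mulr_sumr.
  by apply: eq_bigr => q _; rewrite mulrCA.
under [X in ccvg X _]eq_fun do rewrite E.
apply: (@cexpectation_cvg _ _ _ _ _ _ (C * (1 - cabs y)^-1)).
- by move=> n; apply: cmeasM => //; apply: cmeas_sum => q; apply: cmeasM => //; exact: cmeas_cst.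
- move=> n x; rewrite cabsM ler_pM ?cabs_ge0//.
  rewrite (le_trans (cabs_sum _ _ _))// (le_trans _ (sum_geometric_le n y01))//.
  by apply: ler_sum => q _; rewrite cabsM cabsX ler_piMr ?exprn_ge0.
- by move=> x; apply: ccvgM; [exact: ccvg_cst|exact: csum_step].
Qed.

End nat_transform.

Section laplace_linear.
Context {R : realType}.
Local Notation mu := (@lebesgue_measure R).
Implicit Types (w : R[i]) (f g : measurableTypeR R -> R[i]) (C : R).

Lemma laplace_le w f C : 0 < complex.Re w -> cmeas f ->
  (forall s, cabs (f s) <= C) ->
  cabs (laplace f w) <= C * \int[mu]_s damped (complex.Re w) s.
Proof.
move=> w0 mf fC; rewrite -RintegralZl//; last exact: integrable_damped.
apply: (@cabs_cintegral_le _ _ _ mu).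
- exact: cintegrable_damped w0 mf (fun s _ => fC s).
- exact: (integrableZl _ C (integrable_damped w0)).
- move=> s; rewrite /damped; case: (leP 0 s) => s0; last first.
    by rewrite !mul0r cabs0 mulr0.
  by rewrite !mul1r cabsM cabs_cexp_lin mulrC ler_wpM2r ?expR_ge0.
Qed.

Lemma laplaceD w f g C1 C2 : 0 < complex.Re w -> cmeas f -> cmeas g ->
  (forall s, cabs (f s) <= C1) -> (forall s, cabs (g s) <= C2) ->
  laplace (fun s => f s + g s) w = laplace f w + laplace g w.
Proof.
move=> w0 mf mg fC gC; rewrite /laplace -cintegralD.
- by congr cintegral; apply/funext => s; rewrite !mulrDr.
- exact: cintegrable_damped w0 mf (fun s _ => fC s).
- exact: cintegrable_damped w0 mg (fun s _ => gC s).
Qed.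

Lemma laplaceZ w f c C : 0 < complex.Re w -> cmeas f ->
  (forall s, cabs (f s) <= C) ->
  laplace (fun s => c * f s) w = c * laplace f w.
Proof.
move=> w0 mf fC; rewrite /laplace -cintegralZ.
  by congr cintegral; apply/funext => s; ring.
exact: cintegrable_damped w0 mf (fun s _ => fC s).
Qed.

Lemma laplace_cvg w (f_ : nat -> measurableTypeR R -> R[i]) f C : 0 < complex.Re w ->
  (forall n, cmeas (f_ n)) -> (forall n s, cabs (f_ n s) <= C) ->
  (forall s, 0 <= s -> ccvg (f_ ^~ s) (f s)) ->
  ccvg (fun n => laplace (f_ n) w) (laplace f w).
Proof.
move=> w0 mf fC ff; apply: (@cintegral_cvg _ _ _ mu
   (fun n s => (0 <= s)%R%:R * (cexp (- (w * s%:C)) * f_ n s)) _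
   (fun s => C * damped (complex.Re w) s)).
- move=> n; apply: cmeasM; first by apply: cmeas_bool; exact: measurable_fun_ge.
  by apply: cmeasM => //; exact: cmeas_cexp_lin.
- move=> s; case: (leP 0 s) => s0; last first.
    by under eq_fun do rewrite mul0r; rewrite mul0r; exact: ccvg_cst.
  by apply: ccvgM; [exact: ccvg_cst|apply: ccvgM; [exact: ccvg_cst|exact: ff]].
- exact: (integrableZl _ C (integrable_damped w0)).
- move=> n s; rewrite /damped; case: (leP 0 s) => s0; last first.
    by rewrite !mul0r cabs0 mulr0.
  by rewrite !mul1r cabsM cabs_cexp_lin mulrC ler_wpM2r ?expR_ge0.
Qed.

End laplace_linear.

(** * Laplace transforms of distribution functions *)

Section laplace_fubini.
Context d (T : measurableType d) {R : realType} (P : probability T R).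
Local Notation mu := (@lebesgue_measure R).

Variables (K : T -> R[i]) (e : T -> R) (C : R).
Hypotheses (mK : cmeas K) (KC : forall x, cabs (K x) <= C).
Hypotheses (me : measurable_fun setT e) (e0 : forall x, 0 <= e x).

Let Phi (s : measurableTypeR R) := cexpectation P (fun x => K x * (e x <= s)%R%:R).

Let integrand w (z : measurableTypeR R * T) : R[i] :=
  (0 <= z.1)%R%:R * (cexp (- (w * z.1%:C)) * (K z.2 * (e z.2 <= z.1)%R%:R)).

Let b1 (b : bool) : cabs (b%:R : R[i]) <= 1.
Proof. by case: b; rewrite ?cabs1 ?cabs0. Qed.

Let KbC x s : cabs (K x * (e x <= s)%R%:R) <= C.
Proof. by rewrite cabsM (le_trans _ (KC x))// ler_piMr ?cabs_ge0. Qed.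

Let mintegrand w : cmeas (integrand w).
Proof.
apply: cmeasM.
  apply: cmeas_bool; apply: measurable_fun_ler; first exact: measurable_cst.
  exact: measurable_fst.
apply: cmeasM; first exact: (cmeas_comp (cmeas_cexp_lin w) measurable_fst).
apply: cmeasM; first exact: (cmeas_comp mK measurable_snd).
apply: cmeas_bool; apply: measurable_fun_ler; last exact: measurable_fst.
exact: (measurableT_comp me measurable_snd).
Qed.

Let integrand_le w (z : measurableTypeR R * T) :
  cabs (integrand w z) <= C * damped (complex.Re w) z.1.
Proof.
rewrite /integrand /damped; case: (leP 0 z.1) => s0; last first.
  by rewrite !mul0r cabs0 mulr0.
by rewrite !mul1r cabsM cabs_cexp_lin mulrC ler_wpM2r ?expR_ge0.
Qed.

Let C0 : 0 <= C.
Proof.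
apply: (le_trans (cabs_ge0 (cexpectation P K))); exact: cexpectation_le.
Qed.

Let integrand_int w : 0 < complex.Re w ->
  cintegrable (mu \x P)%E setT (integrand w).
Proof.
move=> w0; pose G (z : measurableTypeR R * T) := C * damped (complex.Re w) z.1.
have id := integrableZl measurableT C (integrable_damped w0).
apply: (@le_cintegrable _ _ _ _ _ G) => //.
have mG : measurable_fun setT (EFin \o G).
  exact: (measurableT_comp (measurable_int _ id) measurable_fst).
apply/integrable12ltyP => //.
move/integrableP : id => [_]; apply: le_lt_trans.
rewrite le_eqVlt; apply/orP; left; apply/eqP; apply: eq_integral => s _.
transitivity (\int[P]_(x in setT) cst `|(C * damped (complex.Re w) s)%:E| x)%E => //.
by rewrite integral_cst// -[RHS]mule1; congr (_ * _)%E; exact: probability_setT.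
Qed.

Let integrand_fiber w s : 0 < complex.Re w ->
  cintegrable P setT (fun x => integrand w (s, x)).
Proof.
move=> w0; apply: (@bounded_cintegrable _ _ _ _ _ (C * damped (complex.Re w) s)).
  exact: (cmeas_comp (mintegrand w) (pair1_measurable s)).
by move=> x; exact: integrand_le w (s, x).
Qed.

Let integrand_cofiber w x : 0 < complex.Re w ->
  cintegrable mu setT (fun s => integrand w (s, x)).
Proof.
move=> w0; apply: (@le_cintegrable _ _ _ mu (fun s => integrand w (s, x))
  (fun s => C * damped (complex.Re w) s)).
- exact: (cmeas_comp (mintegrand w) (pair2_measurable x)).
- exact: (integrableZl measurableT C (integrable_damped w0)).
- by move=> s; exact: integrand_le w (s, x).
Qed.

Let integrand_inner w s : cexpectation P (fun x => integrand w (s, x)) =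
  (0 <= s)%R%:R * (cexp (- (w * s%:C)) * Phi s).
Proof.
rewrite mulrA -cintegralZ; last first.
  apply: (@bounded_cintegrable _ _ _ _ _ C) => //; apply: cmeasM => //.
  by apply: cmeas_bool; apply: measurable_fun_ler => //; exact: measurable_cst.
by congr cintegral; apply/funext => x; rewrite /integrand/= mulrA.
Qed.

(** After Fubini the inner integral is that of the exponential over the half-line from [e x], equal
    to [cexp (- (w * (e x)%:C)) / w]; the outer factor [w] cancels the division. *)
Lemma laplace_cexpectation w : 0 < complex.Re w ->
  w * laplace Phi w = cexpectation P (fun x => K x * cexp (- (w * (e x)%:C))).
Proof.
move=> w0; have w0' : w != 0 by apply: contraTneq w0 => ->; rewrite ltxx.
rewrite /laplace.
have -> : (fun s : R => (0 <= s)%R%:R * (cexp (- (w * s%:C)) * Phi s)) =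
    fun s => cexpectation P (fun x => integrand w (s, x)).
  by apply/funext => s; rewrite integrand_inner.
have -> := cintegral_fubini (integrand_int w0) (fun s => integrand_fiber s w0)
  (fun x => integrand_cofiber x w0).
have -> : (fun x => cintegral mu setT (fun s => integrand w (s, x))) =
    fun x => K x * (cexp (- (w * (e x)%:C)) / w).
  apply/funext => x; rewrite -cintegral_tail_cexp// -cintegralZ; last first.
    apply: (@le_cintegrable _ _ _ mu (fun s : measurableTypeR R =>
      (e x <= s)%R%:R * cexp (- (w * s%:C))) (damped (complex.Re w))).
    - apply: cmeasM; last exact: cmeas_cexp_lin.
      by apply: cmeas_bool; exact: measurable_fun_ge.
    - exact: integrable_damped.
    - move=> s; rewrite /damped; case: (leP (e x) s) => es; last first.
        by rewrite mul0r cabs0 mulr_ge0 ?expR_ge0.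
      by rewrite (le_trans (e0 x) es) !mul1r cabs_cexp_lin.
  congr cintegral; apply/funext => s; rewrite /integrand/=.
  case: (leP (e x) s) => es; last by rewrite !mul0r !mulr0.
  by rewrite (le_trans (e0 x) es) !mul1r mulr1 mulrC.
rewrite /cexpectation -cintegralZ.
  by congr cintegral; apply/funext => x; field.
apply: (@bounded_cintegrable _ _ _ _ _ (C * (cabs w)^-1)).
  apply: cmeasM => //; apply: cmeasM; last exact: cmeas_cst.
  apply: cmeas_cexp; apply: cmeasN; apply: cmeasM; first exact: cmeas_cst.
  exact: cmeas_real.
move=> x; rewrite cabsM [cabs (_ / w)]cabsM cabsV cabs_cexp_lin; apply: ler_pM => //.
- exact: cabs_ge0.
- by rewrite mulr_ge0 ?expR_ge0 ?invr_ge0 ?cabs_ge0.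
- rewrite ler_piMl ?invr_ge0 ?cabs_ge0// -expR0 ler_expR oppr_le0.
  by rewrite mulr_ge0 ?(ltW w0).
Qed.

(** Measurability in the threshold is a by-product of Fubini at [w = 1]: the inner integral is
    measurable, and multiplying by exp(s) removes the damping. For negative [s] the expectation is
    0, as [e] is nonnegative. *)
Lemma cmeas_cexpectation_threshold : cmeas Phi.
Proof.
have w0 : 0 < complex.Re (1 : R[i]) by [].
have mI : cmeas (fun s : measurableTypeR R =>
    cexpectation P (fun x => integrand 1 (s, x))).
  apply: (@cintegrable_meas _ _ _ mu).
  exact: cintegrable_fubini (integrand_int w0) (fun s => integrand_fiber s w0).
apply: (@eq_cmeas _ _ _ (fun s : measurableTypeR R =>
    cexp (- (- 1 * s%:C)) * cexpectation P (fun x => integrand 1 (s, x)))).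
  move=> s; rewrite integrand_inner.
  have -> : cexp (- (- 1 * s%:C)) * ((0 <= s)%R%:R * (cexp (- (1 * s%:C)) * Phi s)) =
      (0 <= s)%R%:R * (cexp (- (- 1 * s%:C)) * cexp (- (1 * s%:C)) * Phi s) by ring.
  rewrite -cexpD mulN1r opprK mul1r subrr cexp0 mul1r.
  case: (leP 0 s) => s0; first by rewrite mul1r.
  rewrite mul0r /Phi; under [in RHS]eq_fun => x.
    rewrite leNgt (lt_le_trans s0 (e0 x)) mulr0; over.
  by rewrite cexpectation_cst.
by apply: cmeasM => //; exact: cmeas_cexp_lin.
Qed.


End laplace_fubini.

(** * Threshold transforms *)

Section threshold_transform.
Context {R : realType}.
Implicit Types (Phi Psi : nat -> nat -> measurableTypeR R -> R[i]) (C : R).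

Definition admissible C Phi := forall p q,
  cmeas (Phi p q) /\ forall s, cabs (Phi p q s) <= C.

Definition weighted_csum (f : nat -> R[i]) (x : R[i]) :=
  (1 - x) * csum (fun p => x ^+ p * f p).

Lemma eq_weighted_csum (f g : nat -> R[i]) x : f =1 g ->
  weighted_csum f x = weighted_csum g x.
Proof. by move=> /funext ->. Qed.

(** The direct operator inverted by [Dxyw_inv]. The sum over [p] is outermost because [Dxyw_inv]
    undoes [x] first, then [y], then [w]. *)
Definition threshold_transform Phi (x y w : R[i]) : R[i] :=
  weighted_csum (fun p =>
    weighted_csum (fun q => w * laplace (Phi p q) w) y) x.

(** A bound uniform in [p] and [q]: for fixed [w] the Laplace transforms are the coefficients of
    power series. *)
Let wbound C (w : R[i]) :=
  cabs w * (C * \int[@lebesgue_measure R]_s damped (complex.Re w) s).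

Lemma bounded_geom_dominated (f : nat -> R[i]) C x : (forall p, cabs (f p) <= C) ->
  geom_dominated C (cabs x) (fun p => x ^+ p * f p).
Proof. by move=> fC p; rewrite cabsM cabsX mulrC ler_wpM2r ?exprn_ge0 ?cabs_ge0. Qed.

Let cabs01 (x : R[i]) : cabs x < 1 -> 0 <= cabs x < 1.
Proof. by rewrite cabs_ge0. Qed.

Lemma weighted_csum_le (f : nat -> R[i]) C x : cabs x < 1 ->
  (forall p, cabs (f p) <= C) ->
  cabs (weighted_csum f x) <= cabs (1 - x) * (C / (1 - cabs x)).
Proof.
move=> x1 fC; rewrite cabsM ler_wpM2l ?cabs_ge0//.
exact: (csum_le (cabs01 x1) (bounded_geom_dominated x fC)).
Qed.

Lemma weighted_csumD (f g : nat -> R[i]) C1 C2 x : cabs x < 1 ->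
  (forall p, cabs (f p) <= C1) -> (forall p, cabs (g p) <= C2) ->
  weighted_csum (fun p => f p + g p) x = weighted_csum f x + weighted_csum g x.
Proof.
move=> x1 fC gC; rewrite /weighted_csum -mulrDr.
rewrite -(csumD (cabs01 x1) (bounded_geom_dominated x fC) (bounded_geom_dominated x gC)).
by congr (_ * _); apply: eq_csum => p; rewrite mulrDr.
Qed.

Lemma weighted_csumZ (f : nat -> R[i]) C c x : cabs x < 1 ->
  (forall p, cabs (f p) <= C) ->
  weighted_csum (fun p => c * f p) x = c * weighted_csum f x.
Proof.
move=> x1 fC; rewrite /weighted_csum mulrCA.
rewrite -(csumZ (cabs01 x1) c (bounded_geom_dominated x fC)).
by congr (_ * _); apply: eq_csum => p; rewrite mulrCA.
Qed.

Lemma weighted_csum_cvg (f_ : nat -> nat -> R[i]) (f : nat -> R[i]) C x : cabs x < 1 ->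
  (forall n p, cabs (f_ n p) <= C) -> (forall p, ccvg (f_ ^~ p) (f p)) ->
  ccvg (fun n => weighted_csum (f_ n) x) (weighted_csum f x).
Proof.
move=> x1 fC ff; apply: ccvgM; first exact: ccvg_cst.
apply: (csum_limit (cabs01 x1) (C := C)) => [n|p].
  exact: bounded_geom_dominated.
by apply: ccvgM => //; exact: ccvg_cst.
Qed.

Lemma wlaplace_le C Phi w p q : 0 < complex.Re w -> admissible C Phi ->
  cabs (w * laplace (Phi p q) w) <= wbound C w.
Proof.
move=> w0 /(_ p q)[mPhi PhiC]; rewrite cabsM ler_wpM2l ?cabs_ge0//.
exact: laplace_le.
Qed.

Section at_point.
Variables x y w : R[i].
Hypotheses (x1 : cabs x < 1) (y1 : cabs y < 1) (w0 : 0 < complex.Re w).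

Let inner_le C Phi : admissible C Phi -> forall p,
  cabs (weighted_csum (fun q => w * laplace (Phi p q) w) y) <=
  cabs (1 - y) * (wbound C w / (1 - cabs y)).
Proof.
move=> aPhi p; apply: weighted_csum_le => // q; exact: wlaplace_le.
Qed.

Lemma eq_threshold_transform Phi Psi : (forall p q s, Phi p q s = Psi p q s) ->
  threshold_transform Phi x y w = threshold_transform Psi x y w.
Proof.
move=> PP; rewrite (_ : Phi = Psi)//.
by apply/funext => p; apply/funext => q; apply/funext => s.
Qed.

Lemma threshold_transformD C1 C2 Phi Psi : admissible C1 Phi -> admissible C2 Psi ->
  threshold_transform (fun p q s => Phi p q s + Psi p q s) x y w =
  threshold_transform Phi x y w + threshold_transform Psi x y w.
Proof.
move=> aPhi aPsi.
rewrite -(weighted_csumD x1 (inner_le aPhi) (inner_le aPsi)).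
apply: eq_weighted_csum => p.
rewrite -(weighted_csumD y1 (fun q => wlaplace_le p q w0 aPhi)
  (fun q => wlaplace_le p q w0 aPsi)).
apply: eq_weighted_csum => q; rewrite -mulrDr; congr (_ * _).
have [[m1 b1] [m2 b2]] := (aPhi p q, aPsi p q).
exact: (laplaceD w0 m1 m2 b1 b2).
Qed.

Lemma threshold_transformZ C Phi c : admissible C Phi ->
  threshold_transform (fun p q s => c * Phi p q s) x y w =
  c * threshold_transform Phi x y w.
Proof.
move=> aPhi; rewrite -(weighted_csumZ c x1 (inner_le aPhi)).
apply: eq_weighted_csum => p.
rewrite -(weighted_csumZ c y1 (fun q => wlaplace_le p q w0 aPhi)).
apply: eq_weighted_csum => q; rewrite mulrCA; congr (_ * _).
have [m1 b1] := aPhi p q; exact: (laplaceZ c w0 m1 b1).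
Qed.

Lemma threshold_transform_cvg C (Phi_ : nat -> nat -> nat -> measurableTypeR R -> R[i])
    Phi : (forall n, admissible C (Phi_ n)) ->
  (forall p q s, 0 <= s -> ccvg (fun n => Phi_ n p q s) (Phi p q s)) ->
  ccvg (fun n => threshold_transform (Phi_ n) x y w) (threshold_transform Phi x y w).
Proof.
move=> aPhi cPhi; apply: (weighted_csum_cvg x1 (fun n p => inner_le (aPhi n) p)) => p.
apply: (weighted_csum_cvg y1 (fun n q => wlaplace_le p q w0 (aPhi n))) => q.
apply: ccvgM; first exact: ccvg_cst.
apply: (laplace_cvg w0 (C := C)) => [n|n s|s s0].
- exact: (aPhi n p q).1.
- exact: (aPhi n p q).2.
- exact: cPhi.
Qed.

End at_point.

Lemma admissibleD C1 C2 Phi Psi : admissible C1 Phi -> admissible C2 Psi ->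
  admissible (C1 + C2) (fun p q s => Phi p q s + Psi p q s).
Proof.
move=> a1 a2 p q; have [[m1 b1] [m2 b2]] := (a1 p q, a2 p q).
by split => [|s]; [exact: cmeasD|rewrite (le_trans (cabsD _ _))// lerD].
Qed.

Lemma admissibleZ C c Phi : admissible C Phi ->
  admissible (cabs c * C) (fun p q s => c * Phi p q s).
Proof.
move=> a1 p q; have [m1 b1] := a1 p q.
by split => [|s]; [apply: cmeasM => //; exact: cmeas_cst|
  rewrite cabsM ler_wpM2l ?cabs_ge0].
Qed.

(* The generating functions in p and q and the Laplace transform in s turn
   Phi p q into a product of one-sided transforms, undone one by one. *)
Lemma Dxyw_inv_threshold_transform C Phi (F : R[i] -> R[i] -> R[i] -> R[i]) :
  admissible C Phi ->
  (forall p q s, 0 <= s -> (Phi p q : R -> R[i]^o) t @[t --> s^'+] --> (Phi p q s : R[i]^o)) ->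
  (forall x y w, cabs x < 1 -> cabs y < 1 -> 0 < complex.Re w ->
    F x y w = threshold_transform Phi x y w) ->
  forall p q (s : R), 0 <= s -> Dxyw_inv F p q s = Phi p q s.
Proof.
move=> aPhi rPhi FE p q s s0; apply: inverse_laplaceE => //; split.
  by move=> t t0; exact: rPhi.
move=> w w0 /=; have [mPhi bPhi] := aPhi p q.
have w0' : w != 0 by apply: contraTneq w0 => ->; rewrite ltxx.
have eint := cintegrable_damped w0 mPhi (fun s _ => bPhi s).
have unit1 (z : R[i]) : cabs z < 1 -> 1 - z != 0.
  move=> z1; rewrite subr_eq0; apply: contraTneq z1 => <-; by rewrite cabs1 ltxx.
have D1 y : cabs y < 1 -> Dinv p (fun x => F x y w) =
    weighted_csum (fun q => w * laplace (Phi p q) w) y.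
  move=> y1; apply: (Dinv_pseries (a := fun p =>
      weighted_csum (fun q => w * laplace (Phi p q) w) y)
    (C := cabs (1 - y) * (wbound C w / (1 - cabs y)))) => [p'|x x1].
    by apply: weighted_csum_le => // q'; exact: wlaplace_le.
  rewrite FE// /threshold_transform {1}/weighted_csum mulrC mulKf ?unit1//.
  by apply: eq_csum => n; rewrite mulrC.
have D2 : Dinv q (fun y => Dinv p (fun x => F x y w)) = w * laplace (Phi p q) w.
  apply: (Dinv_pseries (a := fun q => w * laplace (Phi p q) w)
    (C := wbound C w)) => [q'|y y1]; first exact: wlaplace_le.
  rewrite D1// /weighted_csum mulrC mulKf ?unit1//.
  by apply: eq_csum => n; rewrite mulrC.
rewrite D2 mulrC mulKf//.
have mD : @measurable _ (measurableTypeR R) `[0%R, +oo[%classic by exact: measurable_itv.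
have restr (k : R[i] -> R) : k 0 = 0 ->
    (fun s => k (cexp (- (w * s%:C)) * Phi p q s)) \_ `[0%R, +oo[%classic =
    (fun s => k ((0 <= s)%R%:R * (cexp (- (w * s%:C)) * Phi p q s))).
  move=> k0; apply/funext => t; rewrite patchE mem_setE in_itv/= andbT.
  by case: ifPn => t0; rewrite ?mul1r ?mul0r.
have restrE (k : R[i] -> R) : k 0 = 0 ->
    (EFin \o (fun s => k (cexp (- (w * s%:C)) * Phi p q s))) \_ `[0%R, +oo[%classic =
    EFin \o (fun s => k ((0 <= s)%R%:R * (cexp (- (w * s%:C)) * Phi p q s))).
  move=> k0; apply/funext => t; rewrite -(restr k k0) /= !patchE.
  by case: ifPn.
split; [split|].
- by apply/(integrable_mkcond _ mD); rewrite (restrE (@complex.Re R))//; exact: eint.1.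
- by apply/(integrable_mkcond _ mD); rewrite (restrE (@complex.Im R))//; exact: eint.2.
- apply: complex_ext; rewrite /= Rintegral_mkcond.
    by rewrite (restr (@complex.Re R)).
  by rewrite (restr (@complex.Im R)).
Qed.

End threshold_transform.

Section threshold_indicator.
Context d (T : measurableType d) {R : realType} (P : probability T R).
Variables (S : T -> R[i]) (a c : T -> nat) (e : T -> R).
Hypotheses (mS : cmeas S) (S1 : forall x, cabs (S x) <= 1).
Hypotheses (ma : measurable_fun setT a) (mc : measurable_fun setT c).
Hypotheses (me : measurable_fun setT e) (e0 : forall x, 0 <= e x).

Definition threshold_indicator p q (s : measurableTypeR R) : R[i] :=
  cexpectation P (fun x => S x * (a x <= p)%N%:R * (c x <= q)%N%:R * (e x <= s)%R%:R).

Let mle (k : T -> nat) p : measurable_fun setT k ->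
  cmeas (fun x => (k x <= p)%N%:R : R[i]).
Proof.
by move=> mk; apply: cmeas_bool; apply: measurable_fun_leq => //; exact: measurable_cst.
Qed.

Let b1 (b : bool) : cabs (b%:R : R[i]) <= 1.
Proof. by case: b; rewrite ?cabs1 ?cabs0. Qed.

Let le1M (z1 z2 : R[i]) : cabs z1 <= 1 -> cabs z2 <= 1 -> cabs (z1 * z2) <= 1.
Proof. by move=> h1 h2; rewrite cabsM mulr_ile1 ?cabs_ge0. Qed.

Lemma admissible_threshold_indicator : admissible 1 threshold_indicator.
Proof.
move=> p q; split => [|s].
  apply: (cmeas_cexpectation_threshold P (C := 1)) => //.
    by apply: cmeasM; [apply: cmeasM => //; exact: mle|exact: mle].
  by move=> x; rewrite !le1M.
apply: cexpectation_le => [|x]; last by do ?[exact: S1|exact: b1|apply: le1M].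
apply: cmeasM; first by apply: cmeasM; [apply: cmeasM => //; exact: mle|exact: mle].
by apply: cmeas_bool; apply: measurable_fun_ler => //; exact: measurable_cst.
Qed.

Lemma threshold_transform_indicator x y w : cabs x < 1 -> cabs y < 1 ->
  0 < complex.Re w -> threshold_transform threshold_indicator x y w =
  cexpectation P (fun t => S t * x ^+ a t * y ^+ c t * cexp (- (w * (e t)%:C))).
Proof.
move=> x1 y1 w0; rewrite /threshold_transform.
have mw : cmeas (fun t => cexp (- (w * (e t)%:C))).
  apply: cmeas_cexp; apply: cmeasN; apply: cmeasM; first exact: cmeas_cst.
  exact: cmeas_real.
have cw t : cabs (cexp (- (w * (e t)%:C))) <= 1.
  by rewrite cabs_cexp_lin -expR0 ler_expR oppr_le0 mulr_ge0 ?(ltW w0).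
have cy t : cabs (y ^+ c t) <= 1 by rewrite cabsX exprn_ile1 ?cabs_ge0// ltW.
have my : cmeas (fun t => y ^+ c t) by exact: (@cmeas_nat_fun _ _ _ (fun n => y ^+ n)).
have -> : (fun p => weighted_csum (fun q => w * laplace (threshold_indicator p q) w) y) =
   (fun p => cexpectation P (fun t => (S t * y ^+ c t * cexp (- (w * (e t)%:C))) *
     (a t <= p)%N%:R)).
  apply/funext => p; have mSa : cmeas (fun t => S t * (a t <= p)%N%:R).
    by apply: cmeasM => //; exact: mle.
  (* Each of the three transforms acts on one indicator; the remaining factors, bounded by 1, take
     the role of [K]. *)
  have -> : (fun q => w * laplace (threshold_indicator p q) w) =
      fun q => cexpectation P (fun t => S t * (a t <= p)%N%:R *
        cexp (- (w * (e t)%:C)) * (c t <= q)%N%:R).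
    apply/funext => q; rewrite (laplace_cexpectation P (C := 1))//.
    - by congr cexpectation; apply/funext => t; rewrite mulrAC.
    - by apply: cmeasM => //; exact: mle.
    - by move=> t; do ?[exact: S1|exact: b1|exact: cw|exact: cy|apply: le1M].
  rewrite /weighted_csum (csum_cexpectation P (C := 1))//.
  - by congr cexpectation; apply/funext => t; ring.
  - exact: cmeasM.
  - by move=> t; do ?[exact: S1|exact: b1|exact: cw|exact: cy|apply: le1M].
rewrite /weighted_csum (csum_cexpectation P (C := 1))//.
- by congr cexpectation; apply/funext => t; ring.
- by apply: cmeasM => //; exact: cmeasM.
- by move=> t; do ?[exact: S1|exact: b1|exact: cw|exact: cy|apply: le1M].
Qed.

End threshold_indicator.

(** * Independence *)

Section distribution_expectation.
Context d d' (T : measurableType d) (T' : measurableType d') {R : realType}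
  (P : probability T R).

Lemma Rintegral_distribution (X : {mfun T >-> T'}) (f : T' -> R) :
  measurable_fun setT f -> P.-integrable setT (EFin \o (f \o X)) ->
  \int[distribution P X]_y f y = \int[P]_x f (X x).
Proof.
move=> mf fi; rewrite /Rintegral; congr fine.
rewrite (@integral_distribution _ _ _ _ _ P X (EFin \o f))//.
exact/measurable_EFinP.
Qed.

Lemma cexpectation_distribution (X : {mfun T >-> T'}) (f : T' -> R[i]) C :
  cmeas f -> (forall x, cabs (f x) <= C) ->
  cexpectation (distribution P X) f = cexpectation P (f \o X).
Proof.
move=> mf fC.
have [i1 i2] : cintegrable P setT (f \o X).
  apply: (bounded_cintegrable _ (C := C)) => [|x]; last exact: fC.
  by apply: (cmeas_comp mf); exact: measurable_funPT.
by apply: complex_ext; rewrite /= Rintegral_distribution//; [exact: mf.1|exact: mf.2].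
Qed.

End distribution_expectation.

Section identical_distribution.
Context d d' (T : measurableType d) (T' : measurableType d') {R : realType}
  (P : probability T R).

Lemma identically_distributed_cexpectation (X Y : T -> T') (f : T' -> R[i]) C :
  measurable_fun setT X -> measurable_fun setT Y -> identically_distributed P X Y ->
  cmeas f -> (forall x, cabs (f x) <= C) ->
  cexpectation P (fun x => f (X x)) = cexpectation P (fun x => f (Y x)).
Proof.
move=> mX mY XY mf fC.
have -> : (fun x => f (X x)) = f \o mfun_Sub (mem_set mX) by [].
have -> : (fun x => f (Y x)) = f \o mfun_Sub (mem_set mY) by [].
rewrite -!(cexpectation_distribution P _ mf fC).
by apply: complex_ext; congr fine; apply: eq_measure_integral => A mA _; exact: XY.
Qed.

End identical_distribution.

Section independent_fubini.
Context d d1 d2 (T : measurableType d) (T1 : measurableType d1)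
  (T2 : measurableType d2) {R : realType} (P : probability T R).

(** The product formula on rectangles identifies the joint law with the product of the laws, where
    Fubini applies. [X1] and [X2] may be identity maps into [Omega] with smaller sigma-algebras. *)
Lemma independent_fubini (X1 : T -> T1) (X2 : T -> T2) (F : T1 * T2 -> R[i]) C :
  measurable_fun setT X1 -> measurable_fun setT X2 ->
  (forall A B, measurable A -> measurable B ->
    P (X1 @^-1` A `&` X2 @^-1` B) = (P (X1 @^-1` A) * P (X2 @^-1` B))%E) ->
  cmeas F -> (forall z, cabs (F z) <= C) ->
  cexpectation P (fun x => F (X1 x, X2 x)) =
  cexpectation P (fun x1 => cexpectation P (fun x2 => F (X1 x1, X2 x2))).
Proof.
move=> m1 m2 ind mF FC; have m12 := measurable_fun_pair m1 m2.
pose Y1 := mfun_Sub (mem_set m1); pose Y2 := mfun_Sub (mem_set m2).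
pose Y12 := mfun_Sub (mem_set m12).
have E : cexpectation P (fun x => F (X1 x, X2 x)) =
    cintegral (distribution P Y1 \x distribution P Y2)%E setT F.
  rewrite -[LHS](cexpectation_distribution P Y12 mF FC).
  apply: complex_ext; congr fine; apply: eq_measure_integral => A mA _; symmetry;
    by apply: product_measure_unique => // B1 B2 mB1 mB2; exact: ind.
have Ffib a : cmeas (fun b => F (a, b)).
  exact: (cmeas_comp mF (pair1_measurable a)).
have Fi a : cintegrable (distribution P Y2) setT (fun b => F (a, b)).
  by apply: (bounded_cintegrable _ (C := C)).
have Fint : cintegrable (distribution P Y1 \x distribution P Y2)%E setT F.
  apply: (le_cintegrable mF (G := fun=> C)) => //.
  apply/integrableP; split; first exact: measurable_cst.
  have -> : (\int[(distribution P Y1 \x distribution P Y2)]_x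
      `|(EFin \o (fun=> C)) x| = \int[(distribution P Y1 \x distribution P Y2)]_x
      cst `|C%:E| x)%E by [].
  rewrite integral_cst// -setXTT [X in (_ * X)%E](_ : _ =
    (distribution P Y1 setT * distribution P Y2 setT)%E); last first.
    exact: product_measure1E.
  by rewrite -ge0_fin_numE ?fin_numM ?fin_num_measure// ?mule_ge0.
rewrite E (cintegral_prod_meas Fint Fi).
have mG : cmeas (fun a => cexpectation (distribution P Y2) (fun b => F (a, b))).
  exact: cintegrable_meas (cintegrable_fubini Fint Fi).
rewrite -/(cexpectation _ _) (cexpectation_distribution P Y1 mG (C := C)); last first.
  by move=> a; exact: cexpectation_le.
congr cexpectation; apply/funext => x1 /=.
by rewrite (cexpectation_distribution P Y2 (Ffib _) (C := C)).
Qed.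

End independent_fubini.

Section step_sum.
Context {R : realType}.
Implicit Type t : R.

Lemma step_sum_full t n : n%:R <= t -> \sum_(i < n) (i.+1%:R <= t)%R%:R = n%:R :> R.
Proof.
move=> nt; rewrite (eq_bigr (fun=> 1)); first by rewrite sumr_const card_ord.
by move=> i _; rewrite (le_trans _ nt)// ler_nat.
Qed.

(** The sum counts the integers from 1 to [n] that are at most [t], that is, it is the integer part
    of [t]. It controls the approximation by simple functions in [factor_unit]. *)
Lemma step_sum_bounds t n : 0 <= t <= n%:R ->
  \sum_(i < n) (i.+1%:R <= t)%R%:R <= t <= \sum_(i < n) (i.+1%:R <= t)%R%:R + 1.
Proof.
move=> /andP[t0]; elim: n => [|n IH] tn.
  by rewrite big_ord0 t0 add0r (le_trans tn).
rewrite big_ord_recr/=; have [tn1|nt] := leP t n%:R.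
  rewrite [(n.+1%:R <= t)%R]leNgt (le_lt_trans tn1) ?ltr_nat//= mulr0n addr0.
  exact: IH.
rewrite step_sum_full ?(ltW nt)//; case: (leP n.+1%:R t) => nt1.
  by rewrite mulr1n natr1; lra.
by rewrite mulr0n addr0 (ltW nt)/= natr1.
Qed.

End step_sum.

Section indicator.
Context d (T : measurableType d) {R : realType} (P : probability T R).
Implicit Types (A B : set T).

Definition ind A (x : T) : R[i] := (x \in A)%:R.

Lemma cmeas_ind A : measurable A -> cmeas (ind A).
Proof.
move=> mA; rewrite (_ : ind A = fun x => (\1_A x)%:C).
  by apply: cmeas_real; exact: measurable_indic.
by apply/funext => x; rewrite /ind indicE rmorph_nat.
Qed.

Lemma cabs_ind A x : cabs (ind A x) <= 1.
Proof. by rewrite /ind; case: (x \in A); rewrite ?cabs1 ?cabs0. Qed.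

Lemma cexpectation_ind A : measurable A -> cexpectation P (ind A) = (fine (P A))%:C.
Proof.
move=> mA; apply: complex_ext => /=.
  congr fine; rewrite -[in RHS](setIT A) -integral_indic//.
  apply: eq_integral => x _ /=; rewrite indicE /ind; congr EFin.
  by case: (x \in A).
rewrite (_ : (fun x => complex.Im (ind A x)) = fun=> 0); last first.
  by apply/funext => x; rewrite /ind; case: (x \in A).
by rewrite Rintegral_cst// mul0r.
Qed.

Lemma indI A B x : ind (A `&` B) x = ind A x * ind B x.
Proof.
rewrite /ind in_setI; case: (x \in A); case: (x \in B); by rewrite ?mulr1 ?mulr0.
Qed.

Lemma prod_ind (I : eqType) (s : seq I) (A : I -> set T) x :
  \prod_(i <- s) ind (A i) x = ind (\bigcap_(i in [set` s]) A i) x.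
Proof.
elim: s => [|i s IH]; first by rewrite big_nil /ind mem_set.
rewrite big_cons IH -indI; congr ind; apply/seteqP; split => [y [Ai As] j /=|y As].
  by rewrite inE => /orP[/eqP ->//|js]; exact: As.
split; first by apply: As; rewrite /= mem_head.
by move=> j /= js; apply: As; rewrite /= inE js orbT.
Qed.

Lemma measurable_bigcap_seq (I : choiceType) (s : seq I) (A : I -> set T) :
  (forall i, i \in s -> measurable (A i)) ->
  measurable (\bigcap_(i in [set` s]) A i).
Proof. by move=> mA; apply: fin_bigcap_measurable => //; exact: mA. Qed.

End indicator.

(** * Product formulas for expectations under independence *)

Section independence.
Context d (T : measurableType d) {R : realType} (P : probability T R).
Local Notation "''E' f" := (cexpectation P f) (at level 10, f at level 8).
Implicit Types (F : set_system T) (Y Z : T -> R[i]).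

Definition measurable_wrt F Z := forall B, measurable B ->
  F ((fun x => complex.Re (Z x)) @^-1` B) /\ F ((fun x => complex.Im (Z x)) @^-1` B).

Lemma measurable_wrt_cmeas F Z : F `<=` measurable -> measurable_wrt F Z -> cmeas Z.
Proof.
by move=> Fm ZF; split => _ B mB; rewrite setTI; apply: Fm; [exact: (ZF B mB).1|
  exact: (ZF B mB).2].
Qed.

Section factor.
Variables (F : set_system T) (Y : T -> R[i]) (C : R).
Hypotheses (Fm : F `<=` measurable) (mY : cmeas Y) (YC : forall x, cabs (Y x) <= C).
Hypothesis FY : forall A, F A ->
  'E (fun x => ind A x * Y x) = (fine (P A))%:C * 'E Y.

Let C0 : 0 <= C.
Proof. by apply: (le_trans (cabs_ge0 ('E Y))); exact: cexpectation_le. Qed.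

(* Uniform approximation by F-simple functions. *)
Let factor_unit (Z : T -> R) : (forall B, measurable B -> F (Z @^-1` B)) ->
  (forall x, 0 <= Z x <= 1) ->
  'E (fun x => (Z x)%:C * Y x) = 'E (fun x => (Z x)%:C) * 'E Y.
Proof.
move=> ZF Z01.
(* Layer cake: the average of the indicators of these superlevel sets is the integer part of (n + 1)
   Z divided by n + 1, within 1 / (n + 1) of Z. *)
pose A n i := Z @^-1` `[(i.+1%:R / n.+1%:R : R), +oo[%classic.
have FA n i : F (A n i) by apply: ZF; exact: measurable_itv.
pose Zn n x : R[i] := n.+1%:R^-1 * \sum_(i < n.+1) ind (A n i) x.
have mA n i : cmeas (ind (A n i) : T -> R[i]) by apply: cmeas_ind; exact: Fm.
have mZn n : cmeas (Zn n).
  by apply: cmeasM; [exact: cmeas_cst|exact: cmeas_sum].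
have ZnE n x : Zn n x = (n.+1%:R^-1 * \sum_(i < n.+1) (i.+1%:R <= n.+1%:R * Z x)%R%:R)%:C.
  rewrite rmorphM fmorphV rmorph_nat rmorph_sum; congr (_ * _).
  apply: eq_bigr => i _; rewrite /ind rmorph_nat; congr (nat_of_bool _)%:R.
  rewrite mulrC -ler_pdivrMr//; apply/idP/idP.
    by rewrite inE /A/= in_itv/= andbT.
  by rewrite inE /A/= in_itv/= andbT.
have Zn_close n x : cabs (Zn n x - (Z x)%:C) <= n.+1%:R^-1.
  rewrite ZnE -rmorphB cabs_real /=.
  have /andP[z0 z1] := Z01 x.
  have := @step_sum_bounds R (n.+1%:R * Z x) n.+1.
  rewrite mulr_ge0// ler_piMr// => /(_ isT) /andP[s1 s2].
  set S := \sum_(i < _) _ in s1 s2 *.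
  have -> : n.+1%:R^-1 * S - Z x = n.+1%:R^-1 * (S - n.+1%:R * Z x).
    by rewrite mulrBr mulKf.
  rewrite normrM ger0_norm ?invr_ge0// ler_piMr ?invr_ge0//.
  by rewrite ler_norml; lra.
have Zn1 n x : cabs (Zn n x) <= 2.
  rewrite -[Zn n x](subrK (Z x)%:C) (le_trans (cabsD _ _))//.
  rewrite (_ : 2 = 1 + 1)//; apply: lerD.
    by rewrite (le_trans (Zn_close n x))// invf_le1// ler1n.
  by rewrite cabs_real ger0_norm; have /andP[] := Z01 x.
have inv0 : (n.+1%:R^-1 : R) @[n --> \oo] --> (0 : R) by exact: cvg_harmonic.
have Zn_cvg x : ccvg (Zn ^~ x) (Z x)%:C.
  by apply: (ccvg_squeeze _ inv0); near=> n; exact: Zn_close.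
have EZn n : 'E (fun x => Zn n x * Y x) = 'E (Zn n) * 'E Y.
  have iA i : cintegrable P setT (ind (A n i) : T -> R[i]).
    by apply: (bounded_cintegrable _ (C := 1)) => // x; exact: cabs_ind.
  have iAY i : cintegrable P setT (fun x => ind (A n i) x * Y x).
    apply: (bounded_cintegrable _ (C := C)); first exact: cmeasM.
    by move=> x; rewrite cabsM (le_trans _ (YC x))// ler_piMl ?cabs_ge0 ?cabs_ind.
  have -> : 'E (Zn n) = n.+1%:R^-1 * \sum_(i < n.+1) (fine (P (A n i)))%:C.
    rewrite /cexpectation cintegralZ; last exact: cintegrable_sum.
    rewrite cintegral_sum//; congr (_ * _); apply: eq_bigr => i _.
    by apply: cexpectation_ind; exact: Fm.
  have -> : (fun x => Zn n x * Y x) =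
      fun x => n.+1%:R^-1 * \sum_(i < n.+1) ind (A n i) x * Y x.
    by apply/funext => x; rewrite /Zn -mulrA mulr_suml.
  rewrite /cexpectation cintegralZ; last exact: cintegrable_sum.
  rewrite cintegral_sum// -mulrA mulr_suml; congr (_ * _); apply: eq_bigr => i _.
  exact: FY.
have h1 : ccvg (fun n => 'E (fun x => Zn n x * Y x)) ('E (fun x => (Z x)%:C * Y x)).
  apply: (cexpectation_cvg P (C := 2 * C)) => [n|n x|x].
  - exact: cmeasM.
  - by rewrite cabsM ler_pM ?cabs_ge0.
  - by apply: ccvgM => //; exact: ccvg_cst.
apply: ccvg_unique h1 _; under eq_fun do rewrite EZn.
apply: ccvgM; last exact: ccvg_cst.
exact: (cexpectation_cvg P (C := 2)).
Unshelve. all: by end_near. Qed.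

Let factor_real (Z : T -> R) B : (forall B, measurable B -> F (Z @^-1` B)) ->
  (forall x, `|Z x| <= B) ->
  'E (fun x => (Z x)%:C * Y x) = 'E (fun x => (Z x)%:C) * 'E Y.
Proof.
(* An affine change of variable sends [-D, D] onto [0, 1]; the added 1 makes [D] positive. *)
move=> ZF ZB; pose D := `|B| + 1; have D0 : 0 < D by rewrite ltr_pwDr.
pose Z' x := (Z x + D) / (2 * D).
have Z'F A : measurable A -> F (Z' @^-1` A).
  move=> mA; rewrite (_ : _ @^-1` _ = Z @^-1` ((fun t => (t + D) / (2 * D)) @^-1` A))//.
  apply: ZF; rewrite -[X in measurable X]setTI.
  apply: (measurable_funM (measurable_funD _ _)) => //; exact: measurable_cst.
have Z'01 x : 0 <= Z' x <= 1.
  have := ZB x; rewrite ler_norml => /andP[z1 z2].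
  have := ler_norm B; rewrite /Z' /D => h.
  by rewrite divr_ge0 ?mulr_ge0 ?(ltW D0)//= ?ler_pdivrMr ?mulr_gt0// ?mul1r /D; lra.
have mZ' : cmeas (fun x => (Z' x)%:C).
  by apply: cmeas_real => _ A mA; rewrite setTI; apply: Fm; exact: Z'F.
have ZE x : (Z x)%:C = (2 * D)%:C * (Z' x)%:C - D%:C.
  by rewrite -rmorphM -rmorphB; congr (_%:C); rewrite /Z'; field; rewrite gt_eqF.
have iZ' : cintegrable P setT (fun x => (Z' x)%:C).
  apply: (bounded_cintegrable _ (C := 1)) => // x.
  by rewrite cabs_real ger0_norm; have /andP[] := Z'01 x.
have iY := bounded_cintegrable P mY YC.
have iZ'Y : cintegrable P setT (fun x => (Z' x)%:C * Y x).
  apply: (bounded_cintegrable _ (C := C)) => [|x]; first exact: cmeasM.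
  have /andP[z0 z1] := Z'01 x.
  by rewrite cabsM (le_trans _ (YC x))// ler_piMl ?cabs_ge0// cabs_real ger0_norm.
have -> : 'E (fun x => (Z x)%:C) = (2 * D)%:C * 'E (fun x => (Z' x)%:C) - D%:C.
  rewrite -[in RHS](cexpectation_cst P D%:C) /cexpectation -cintegralZ//.
  rewrite -cintegralB; first by congr cintegral; apply/funext => x; rewrite ZE.
    exact: cintegrableZ.
  by apply: (bounded_cintegrable _ (C := cabs D%:C)) => //; exact: cmeas_cst.
have -> : 'E (fun x => (Z x)%:C * Y x) =
    (2 * D)%:C * 'E (fun x => (Z' x)%:C * Y x) - D%:C * 'E Y.
  rewrite /cexpectation -!cintegralZ// -cintegralB.
  - by congr cintegral; apply/funext => x; rewrite ZE; ring.
  - exact: cintegrableZ.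
  - exact: cintegrableZ.
by rewrite (factor_unit Z'F Z'01); ring.
Qed.

Lemma cexpectation_factor Z B : measurable_wrt F Z -> (forall x, cabs (Z x) <= B) ->
  'E (fun x => Z x * Y x) = 'E Z * 'E Y.
Proof.
move=> ZF ZB; have [mR mI] := measurable_wrt_cmeas Fm ZF.
have B0 : 0 <= B.
  by apply: (le_trans (cabs_ge0 ('E Z))); apply: cexpectation_le.
have iz (r : T -> R) : measurable_fun setT r -> (forall x, `|r x| <= B) ->
    cintegrable P setT (fun x => (r x)%:C).
  move=> mr rB; apply: (bounded_cintegrable _ (C := B)); first exact: cmeas_real.
  by move=> x; rewrite cabs_real.
have izY (r : T -> R) : measurable_fun setT r -> (forall x, `|r x| <= B) ->
    cintegrable P setT (fun x => (r x)%:C * Y x).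
  move=> mr rB; apply: (bounded_cintegrable _ (C := B * C)).
    by apply: cmeasM => //; exact: cmeas_real.
  by move=> x; rewrite cabsM cabs_real ler_pM// cabs_ge0.
have RB x : `|complex.Re (Z x)| <= B by exact: le_trans (Re_le_cabs _) (ZB x).
have IB x : `|complex.Im (Z x)| <= B by exact: le_trans (Im_le_cabs _) (ZB x).
have ZE x : Z x = (complex.Re (Z x))%:C + 'i%C * (complex.Im (Z x))%:C.
  exact: complexE.
have -> : 'E Z = 'E (fun x => (complex.Re (Z x))%:C) +
    'i%C * 'E (fun x => (complex.Im (Z x))%:C).
  rewrite /cexpectation -cintegralZ; last exact: iz.
  rewrite -cintegralD; [|exact: iz|exact/cintegrableZ/iz].
  by congr cintegral; apply/funext => x; exact: ZE.
have -> : 'E (fun x => Z x * Y x) = 'E (fun x => (complex.Re (Z x))%:C * Y x) +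
    'i%C * 'E (fun x => (complex.Im (Z x))%:C * Y x).
  rewrite /cexpectation -cintegralZ; last exact: izY.
  rewrite -cintegralD; [|exact: izY|exact/cintegrableZ/izY].
  by congr cintegral; apply/funext => x; rewrite {1}ZE mulrDl mulrA.
rewrite (factor_real _ RB); last by move=> A mA; exact: (ZF A mA).1.
rewrite (factor_real _ IB); last by move=> A mA; exact: (ZF A mA).2.
by rewrite mulrDl mulrA.
Qed.

End factor.

Lemma cabs_prod_le1 (I : Type) (s : seq I) (Z : I -> R[i]) :
  (forall i, cabs (Z i) <= 1) -> cabs (\prod_(i <- s) Z i) <= 1.
Proof.
move=> Z1; elim: s => [|i s IH]; first by rewrite big_nil cabs1.
by rewrite big_cons cabsM mulr_ile1 ?cabs_ge0.
Qed.

(* The indicators are replaced by the functions Z i one at a time. *)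
Lemma cexpectation_factor_prod (I : eqType) (F : I -> set_system T) Y B :
  (forall i, F i `<=` measurable) -> cmeas Y -> (forall x, cabs (Y x) <= B) ->
  (forall (s : seq I) (A : I -> set T), uniq s -> (forall i, i \in s -> F i (A i)) ->
    'E (fun x => \prod_(i <- s) ind (A i) x * Y x) =
    \prod_(i <- s) (fine (P (A i)))%:C * 'E Y) ->
  forall (s : seq I) (Z : I -> T -> R[i]), uniq s ->
    (forall i, measurable_wrt (F i) (Z i)) -> (forall i x, cabs (Z i x) <= 1) ->
    'E (fun x => \prod_(i <- s) Z i x * Y x) = \prod_(i <- s) 'E (Z i) * 'E Y.
Proof.
move=> Fm mY YB H s Z us ZF Z1.
have B0 : 0 <= B by apply: (le_trans (cabs_ge0 ('E Y))); exact: cexpectation_le.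
have mZ i : cmeas (Z i) by exact: measurable_wrt_cmeas (Fm i) (ZF i).
(* The factors over [r] are functions, those over [s'] still indicators. To factor out the head of
   [r], [cexpectation_factor] asks for the case where it is an indicator; this is the induction
   hypothesis with that index moved to [s']. *)
suff gen (r s' : seq I) (A : I -> set T) : uniq (r ++ s') ->
    (forall i, i \in s' -> F i (A i)) ->
    'E (fun x => \prod_(i <- r) Z i x * (\prod_(i <- s') ind (A i) x * Y x)) =
    \prod_(i <- r) 'E (Z i) * (\prod_(i <- s') (fine (P (A i)))%:C * 'E Y).
  have := gen s [::] (fun=> set0); rewrite cats0 big_nil mul1r => <- //.
  by congr cexpectation; apply/funext => x; rewrite big_nil mul1r.
elim: r s' A => [|i r IH] s' A /=.
  move=> us' FA; rewrite big_nil mul1r -H//.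
  by congr cexpectation; apply/funext => x; rewrite big_nil mul1r.
move=> /andP[]; rewrite mem_cat => /norP[ir is'] urs' FA.
pose W x := \prod_(j <- r) Z j x * (\prod_(j <- s') ind (A j) x * Y x).
have -> : (fun x => \prod_(j <- i :: r) Z j x * (\prod_(j <- s') ind (A j) x * Y x)) =
    fun x => Z i x * W x.
  by apply/funext => x; rewrite big_cons -mulrA.
(* Nothing is known about [A j] outside [s']; replacing it there by [setT] makes every indicator
   measurable. *)
pose mA j := if j \in s' then A j else setT.
have mmA j : measurable (mA j).
  by rewrite /mA; case: ifPn => // js; exact: (Fm j _ (FA j js)).
have WE x : W x = \prod_(j <- r) Z j x * (\prod_(j <- s') ind (mA j) x * Y x).
  congr (_ * (_ * _)); apply: eq_big_seq => j js; by rewrite /mA js.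
have mW : cmeas W.
  apply: (eq_cmeas (fun x => esym (WE x))).
  apply: cmeasM; first exact: cmeas_prod.
  by apply: cmeasM => //; apply: cmeas_prod => j; exact: cmeas_ind.
have WB x : cabs (W x) <= B.
  rewrite cabsM [cabs (_ * Y x)]cabsM mulrA (le_trans _ (YB x))// ler_piMl ?cabs_ge0//.
  rewrite mulr_ile1 ?cabs_ge0// cabs_prod_le1// => j; exact: cabs_ind.
rewrite (cexpectation_factor (Fm i) mW WB _ (ZF i) (Z1 i)).
  by rewrite big_cons -mulrA; congr (_ * _); exact: IH.
move=> D FD; have := IH (i :: s') (fun j => if j == i then D else A j).
rewrite big_cons eqxx.
have E1 x : \prod_(j <- s') ind (if j == i then D else A j) x =
    \prod_(j <- s') ind (A j) x :> R[i].
  by apply: eq_big_seq => j js; case: eqP is' js => // -> /negP.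
have -> : \prod_(j <- s') (fine (P (if j == i then D else A j)))%:C =
    \prod_(j <- s') (fine (P (A j)))%:C.
  by apply: eq_big_seq => j js; case: eqP is' js => // -> /negP.
have -> : (fun x => \prod_(j <- r) Z j x * (\prod_(j <- i :: s')
    ind (if j == i then D else A j) x * Y x)) = fun x => ind D x * W x.
  by apply/funext => x; rewrite big_cons eqxx E1 /W; ring.
move=> ->.
- by rewrite IH//; ring.
- rewrite (perm_uniq (_ : perm_eq _ (i :: r ++ s'))) /=; last first.
    by rewrite perm_catC/= perm_cons perm_catC.
  by rewrite mem_cat negb_or ir is' urs'.
- by move=> j; rewrite inE; case: eqP => [->//|_ /= js]; exact: FA.
Qed.

Lemma mutually_independent_seq (I : choiceType) (F : I -> set_system T) :
  mutually_independent P F -> forall (s : seq I) (A : I -> set T), uniq s ->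
  (forall i, i \in s -> F i (A i)) ->
  P (\bigcap_(i in [set` s]) A i) = (\prod_(i <- s) P (A i))%E.
Proof.
move=> mi s A us FA; have := mi [fset i in s]%fset A.
have -> : [set` [fset i in s]%fset] = [set` s].
  by apply/seteqP; split => i /=; rewrite !inE.
move=> ->.
  apply: perm_big; apply: uniq_perm; [exact: fset_uniq|exact: us|].
  by move=> i; rewrite !inE.
by move=> i; rewrite !inE; exact: FA.
Qed.

Lemma fine_prod_probability (I : Type) (s : seq I) (A : I -> set T) :
  (forall i, measurable (A i)) ->
  fine (\prod_(i <- s) P (A i))%E = \prod_(i <- s) fine (P (A i)).
Proof.
move=> mA; suff -> : (\prod_(i <- s) P (A i) = (\prod_(i <- s) fine (P (A i)))%:E)%E by [].
elim: s => [|i s IH]; first by rewrite !big_nil.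
by rewrite !big_cons IH EFinM fineK// fin_num_measure.
Qed.

Lemma cexpectation_prod_ind (I : choiceType) (F : I -> set_system T) :
  mutually_independent P F -> (forall i, F i `<=` measurable) ->
  forall (s : seq I) (A : I -> set T), uniq s -> (forall i, i \in s -> F i (A i)) ->
  'E (fun x => \prod_(i <- s) ind (A i) x) = \prod_(i <- s) (fine (P (A i)))%:C.
Proof.
move=> mi Fm s A us FA.
have -> : (fun x => \prod_(i <- s) ind (A i) x : R[i]) = ind (\bigcap_(i in [set` s]) A i).
  by apply/funext => x; rewrite prod_ind.
rewrite cexpectation_ind; last first.
  by apply: measurable_bigcap_seq => i /FA; exact: Fm.
rewrite (mutually_independent_seq mi us FA) -rmorph_prod; congr (_%:C).
pose B i := if i \in s then A i else setT.
have mB i : measurable (B i).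
  by rewrite /B; case: ifPn => // /FA; exact: Fm.
have -> : (\prod_(i <- s) P (A i) = \prod_(i <- s) P (B i))%E.
  by apply: eq_big_seq => i js; rewrite /B js.
by rewrite fine_prod_probability//; apply: eq_big_seq => i js; rewrite /B js.
Qed.

End independence.

(** * The complex exponential series *)

Section exponential_series.

(** Generic in the field, so that the corner of two complex numbers can be compared with the corner
    of their moduli. *)
Definition exp_sum (K : numFieldType) (z : K) n := \sum_(k < n) z ^+ k / k`!%:R.

(* The product of two partial sums of the exponential series exceeds the
   partial sum at a + b by this corner. *)
Definition exp_corner (K : numFieldType) (a b : K) n :=
  \sum_(i < n) \sum_(j < n | (n <= i + j)%N) (a ^+ i / i`!%:R) * (b ^+ j / j`!%:R).

(** By the binomial theorem the terms with [i + j = k] add up to the k-th term at [a + b]. The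
    square of indices below [n] is the triangle [i + j < n] together with the corner. *)
Lemma exp_sumM (K : numFieldType) (a b : K) n :
  exp_sum a n * exp_sum b n = exp_sum (a + b) n + exp_corner a b n.
Proof.
pose u i j := (a ^+ i / i`!%:R) * (b ^+ j / j`!%:R).
have -> : exp_sum a n * exp_sum b n = \sum_(i < n) \sum_(j < n) u i j.
  by rewrite /exp_sum mulr_suml; apply: eq_bigr => i _; rewrite mulr_sumr.
have -> : exp_sum (a + b) n = \sum_(i < n) \sum_(j < n | (i + j < n)%N) u i j.
  have bin k : (a + b) ^+ k / k`!%:R = \sum_(i < k.+1) u i (k - i)%N.
    rewrite addrC exprDn mulr_suml; apply: eq_bigr => i _.
    have ik : (i <= k)%N by rewrite -ltnS.
    have := bin_fact ik; move=> /(congr1 (fun m => m%:R : K)) E.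
    rewrite -E !natrM -mulr_natr /u.
    have nz m : (m`!%:R : K) != 0 by rewrite pnatr_eq0 -lt0n fact_gt0.
    have nC : ('C(k, i)%:R : K) != 0 by rewrite pnatr_eq0 -lt0n bin_gt0.
    by field; rewrite !nz nC.
  have inner (i k : 'I_n) : \sum_(j < n | (i + j == k)%N) u i j =
      if (i <= k)%N then u i (k - i)%N else 0.
    case: leqP => ik; last first.
      by rewrite big1// => j /eqP E; move: ik; rewrite -E ltnNge leq_addr.
    have kin : (k - i < n)%N by rewrite (leq_ltn_trans (leq_subr _ _)).
    rewrite (big_pred1 (Ordinal kin))// => j /=; apply/eqP/eqP => [E|->/=].
      by apply: val_inj; rewrite /= -E addKn.
    by rewrite subnKC.
  have step (k : 'I_n) : (a + b) ^+ k / k`!%:R = \sum_(i < n) \sum_(j < n | (i + j == k)%N) u i j.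
    rewrite bin (big_ord_widen n (fun i => u i (k - i)%N))// big_mkcond.
    by apply: eq_bigr => i _; rewrite ltnS inner.
  rewrite /exp_sum (eq_bigr _ (fun k _ => step k)) exchange_big/=.
  apply: eq_bigr => i _; rewrite (exchange_big_dep xpredT)//= [RHS]big_mkcond.
  apply: eq_bigr => j _; case: ltnP => ij.
    by rewrite (big_pred1 (Ordinal ij))// => k; rewrite /= -val_eqE/= eq_sym.
  by rewrite big1// => k /eqP E; move: ij; rewrite E leqNgt ltn_ord.
rewrite /exp_corner -big_split; apply: eq_bigr => i _ /=.
rewrite (bigID (fun j : 'I_n => (i + j < n)%N))/=; congr (_ + _).
by apply: eq_bigl => j; rewrite -leqNgt.
Qed.

Context {R : realType}.
Implicit Types (z : R[i]) (x y : R).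

Lemma exp_sum_cvg x : exp_sum x n @[n --> \oo] --> expR x.
Proof.
have -> : exp_sum x = series (exp_coeff x).
  by apply/funext => n; rewrite /exp_sum /series/= big_mkord.
exact: is_cvg_series_exp_coeff.
Qed.

(** For real arguments the corner is a difference of convergent sequences, with limit zero by the
    functional equation of [expR]. *)
Lemma exp_corner_cvg0 x y : exp_corner x y n @[n --> \oo] --> (0 : R).
Proof.
have E n : exp_corner x y n = exp_sum x n * exp_sum y n - exp_sum (x + y) n.
  by rewrite exp_sumM addrC addKr.
under eq_fun do rewrite E.
rewrite -(subrr (expR (x + y))) {1}expRD.
by apply: cvgB; [apply: cvgM|]; exact: exp_sum_cvg.
Qed.

Lemma cabs_exp_corner_le z1 z2 n :
  cabs (exp_corner z1 z2 n) <= exp_corner (cabs z1) (cabs z2) n.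
Proof.
rewrite (le_trans (cabs_sum _ _ _))//; apply: ler_sum => i _.
rewrite (le_trans (cabs_sum _ _ _))//; apply: ler_sum => j _.
by rewrite !cabsM !cabsV !cabsX !cabs_nat.
Qed.

Lemma exp_sum_imaginary_cvg y : ccvg (exp_sum (0 +i* y)) (cexp (0 +i* y)).
Proof.
have iy k : (0 +i* y) ^+ k / k`!%:R =
    cos_coeff y k +i* sin_coeff y k :> R[i].
  have -> : (0 +i* y : R[i]) = 'i%C * y%:C by apply: complex_ext; rewrite ?ReM ?ImM/=; ring.
  have iX : ('i%C : R[i]) ^+ k =
      ((~~ odd k)%:R * (-1) ^+ k./2) +i* ((odd k)%:R * (-1) ^+ k.-1./2).
    rewrite -{1}(odd_double_half k) exprD -mul2n exprM sqr_i.
    rewrite -(rmorphN1 (real_complex R)) -rmorphXn.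
    case: (boolP (odd k)) => ok /=.
      rewrite expr1; apply: complex_ext; rewrite ?ReM ?ImM/=; last first.
        suff -> : (k.-1)./2 = k./2 by ring.
        by rewrite -{1}(odd_double_half k) ok add1n/= doubleK.
      by ring.
    by rewrite expr0; apply: complex_ext; rewrite ?ReM ?ImM/=; ring.
  rewrite exprMn -(rmorphXn (real_complex R)) -(rmorph_nat (real_complex R)).
  rewrite -fmorphV -mulrA -rmorphM iX.
  by apply: complex_ext; rewrite ?ReM ?ImM/= /cos_coeff /sin_coeff/= -?exprnP; ring.
rewrite /cexp/= expR0 mul1r; split => /=.
  have -> : (fun n => complex.Re (exp_sum (0 +i* y) n)) = series (cos_coeff y).
    apply/funext => n; rewrite /exp_sum Re_sum /series/= big_mkord.
    by apply: eq_bigr => k _; rewrite iy.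
  rewrite unlock; exact: is_cvg_series_cos_coeff.
have -> : (fun n => complex.Im (exp_sum (0 +i* y) n)) = series (sin_coeff y).
  apply/funext => n; rewrite /exp_sum Im_sum /series/= big_mkord.
  by apply: eq_bigr => k _; rewrite iy.
by rewrite unlock; exact: is_cvg_series_sin_coeff.
Qed.

Lemma exp_sum_real_cvg x : ccvg (exp_sum x%:C) (expR x)%:C.
Proof.
have h := ccvg_real (@exp_sum_cvg x); apply: eq_ccvg h => n.
rewrite /exp_sum rmorph_sum; apply: eq_bigr => k _.
by rewrite rmorphM rmorphXn fmorphV rmorph_nat.
Qed.

(** [cexp] is defined through [expR], [cos] and [sin]. The series at [z] is the product of the real
    and the imaginary series up to a corner, which is dominated by the real corner of the moduli and
    hence vanishes. *)
Lemma exp_sum_ccvg z : ccvg (exp_sum z) (cexp z).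
Proof.
have zE : z = (complex.Re z)%:C + (0 +i* complex.Im z).
  by apply: complex_ext; rewrite ?ReD ?ImD/= ?addr0 ?add0r.
set x := complex.Re z in zE; set y := complex.Im z in zE.
have E n : exp_sum z n = exp_sum x%:C n * exp_sum (0 +i* y) n -
    exp_corner x%:C (0 +i* y) n.
  by rewrite exp_sumM -zE addrK.
apply: (@eq_ccvg _ (fun n => exp_sum x%:C n * exp_sum (0 +i* y) n -
    exp_corner x%:C (0 +i* y) n)) => [n|]; first by rewrite E.
rewrite -[X in ccvg _ X]subr0 {1}zE cexpD cexp_real.
apply: ccvgB.
  by apply: ccvgM; [exact: exp_sum_real_cvg|exact: exp_sum_imaginary_cvg].
apply: ccvg_squeeze (@exp_corner_cvg0 (cabs x%:C) (cabs (0 +i* y))).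
by near=> n; rewrite subr0; exact: cabs_exp_corner_le.
Unshelve. all: by end_near. Qed.

End exponential_series.

(** * Poisson counts on a deterministic grid *)

Section counting_intervals.
Context {R : realType}.

Lemma counting_nat_interval l c :
  counting [set k | (l <= k < l + c)%N] = c%:R%:E :> \bar R.
Proof.
have E : [set k | (l <= k < l + c)%N] = addn l @` `I_c.
  apply/seteqP; split => [k /= /andP[lk kc]|_ [j /= jc <-]].
    by exists (k - l)%N; lia.
  lia.
rewrite E /counting asboolT; last exact: finite_image.
congr (_%:R%:E); apply: card_fset_set.
by apply: inj_card_eq => x y _ _ /addnI.
Qed.

Lemma counting_set0 : counting (set0 : set nat) = 0%E :> \bar R.
Proof. by rewrite /counting asboolT// fset_set0. Qed.

Lemma counting_eq0 (A : set nat) : counting A = 0%E :> \bar R -> A = set0.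
Proof.
rewrite /counting; case: asboolP => // fA [] /eqP; rewrite pnatr_eq0 => /eqP A0.
by apply: fset_set_set0 => //; apply/eqP; rewrite -cardfs_eq0 A0.
Qed.

Variable u : nat -> R.
Hypothesis u_incr : forall k, u k < u k.+1.

Lemma u_leq k k' : (k <= k')%N -> u k <= u k'.
Proof.
move=> kk'; rewrite -(subnK kk'); elim: (k' - k)%N => [//|n IH].
by rewrite addSn (le_trans IH)// ltW.
Qed.

(** The first alternative includes accumulation of the points below [a]; it has to be carried along,
    since only strict monotonicity is assumed here. *)
Lemma initial_segment a : (forall k, u k <= a) \/ exists l, forall k, (u k <= a) = (k < l)%N.
Proof.
have [|nall] := pselect (forall k, u k <= a); [by left|right].
have ex : exists k, ~~ (u k <= a).
  by apply: contrapT => h; apply: nall => k; apply: contrapT => /negP ka; apply: h; exists k.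
case: (ex_minnP ex) => l ul lmin; exists l => k; apply/idP/idP => [uk|kl].
  rewrite ltnNge; apply/negP => lk; move/negP: ul; apply.
  exact: le_trans (u_leq lk) uk.
by apply: contrapT => /negP /lmin; rewrite leqNgt kl.
Qed.

Lemma segment_inj l l' : (forall k, (k < l)%N = (k < l')%N) -> l = l'.
Proof. by move=> h; have := h l; have := h l'; rewrite !ltnn; lia. Qed.

(** The count becomes a statement about positions of single points, from which measurability
    follows. The last alternative is an interval lying beyond all points. *)
Lemma counting_intervalP a b c : a <= b ->
  (counting [set k | `]a, b]%classic (u k)] = c%:R%:E :> \bar R) <->
  (exists l, (forall k, (u k <= a) = (k < l)%N) /\
             (forall k, (u k <= b) = (k < l + c)%N)) \/
  (c = 0%N /\ forall k, u k <= a).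
Proof.
move=> ab; have setE l m : (forall k, (u k <= a) = (k < l)%N) ->
    (forall k, (u k <= b) = (k < m)%N) ->
    [set k | `]a, b]%classic (u k)] = [set k | (l <= k < l + (m - l))%N].
  move=> ha hb; apply/seteqP; split => k /=; rewrite in_itv/= hb ltNge ha -leqNgt; lia.
split=> [cc|[[l [ha hb]]|[-> ha]]].
- have [ha|[l ha]] := initial_segment a.
    right; split => //; move: cc.
    rewrite (_ : [set k | _] = set0) ?counting_set0; last first.
      by rewrite -subset0 => k /=; rewrite in_itv/= ltNge ha.
    by move=> [] /eqP; rewrite eq_sym pnatr_eq0 => /eqP.
  left; exists l; split => //.
  have [hb|[m hb]] := initial_segment b.
    exfalso; move: cc; rewrite /counting; case: asboolP => // fS _.
    have : finite_set [set k | (l <= k)%N].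
      by apply: sub_finite_set fS => k /= lk; rewrite in_itv/= hb ltNge ha -leqNgt lk.
    move=> fl; apply: infinite_nat; rewrite (_ : setT = `I_l `|` [set k | (l <= k)%N]).
      by rewrite finite_setU; split => //; exact: finite_II.
    by apply/seteqP; split => // k _ /=; case: (ltnP k l); [left|right].
  move=> k; move: cc; rewrite (setE l m ha hb) counting_nat_interval => -[] /eqP.
  rewrite eqr_nat => /eqP ml.
  have lm : (l <= m)%N.
    rewrite leqNgt; apply/negP => ml'; have := ha m; rewrite ml' => um.
    by have := hb m; rewrite ltnn (le_trans um ab).
  by rewrite hb -ml subnKC.
- rewrite (setE l (l + c)%N ha hb) addKn; exact: counting_nat_interval.
- rewrite (_ : [set k | _] = set0) ?counting_set0//.
  by rewrite -subset0 => k /=; rewrite in_itv/= ltNge ha.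
Qed.

End counting_intervals.

Lemma measurable_bool_eq d (T : measurableType d) (f : T -> bool) b :
  measurable_fun setT f -> measurable [set x | f x = b].
Proof. by move=> mf; rewrite -[X in measurable X]setTI; exact: (mf _ [set b]). Qed.

Lemma measurable_forall_nat d (T : measurableType d) (A : nat -> T -> Prop) :
  (forall k, measurable [set x | A k x]) -> measurable [set x | forall k, A k x].
Proof.
move=> mA; rewrite (_ : [set x | _] = \bigcap_k [set x | A k x]).
  exact: bigcapT_measurable.
by apply/seteqP; split => x /= h k; [move=> _; exact: h|exact: (h k I)].
Qed.

Lemma measurable_exists_nat d (T : measurableType d) (A : nat -> T -> Prop) :
  (forall k, measurable [set x | A k x]) -> measurable [set x | exists k, A k x].
Proof.
move=> mA; rewrite (_ : [set x | _] = \bigcup_k [set x | A k x]).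
  exact: bigcupT_measurable.
by apply/seteqP; split => x /= [k]; [exists k|exists k].
Qed.

Lemma ae_eq_probability d (T : measurableType d) (R : realType) (P : probability T R)
    (A B : set T) : measurable A -> measurable B ->
  {ae P, forall x, A x <-> B x} -> fine (P A) = fine (P B).
Proof.
move=> mA mB AB; apply: complexI; rewrite -!cexpectation_ind//.
apply: ae_eq_cintegral; [exact: cmeas_ind|exact: cmeas_ind|].
move: AB; apply: filterS => x ABx; rewrite /ind; congr (nat_of_bool _)%:R.
by apply/idP/idP; rewrite !inE => /ABx.
Qed.

Definition cum (c : nat -> nat) i := (\sum_(j < i) c j)%N.

Lemma cumS c i : cum c i.+1 = (cum c i + c i)%N.
Proof. by rewrite /cum big_ord_recr. Qed.

Lemma cum_leq c i j : (i <= j)%N -> (cum c i <= cum c j)%N.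
Proof.
move=> ij; rewrite -(subnK ij); elim: (j - i)%N => [//|n IH].
by rewrite addSn cumS (leq_trans IH)// leq_addr.
Qed.

(* [hits u c s n]: the points u_k fall c_0 times in [0, s_0] and c_i times in
   ]s_(i-1), s_i] for 0 < i <= n. *)
Definition hits (R : realType) (u : nat -> R) (c : nat -> nat) (s : nat -> R) n :=
  forall i, (i <= n)%N -> forall k, (u k <= s i)%R = (k < cum c i.+1)%N.

(** The formula also covers rate 0, where it is the unit mass at 0: consecutive observation times
    may coincide. *)
Definition poisson_weight (R : realType) (r : R) (k : nat) :=
  r ^+ k / k`!%:R * expR (- r).

Definition gap (R : realType) (s : nat -> R) i :=
  if i is j.+1 then s j.+1 - s j else s 0%N.

Section poisson_grid.
Context d (T : measurableType d) {R : realType} (P : probability T R).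
Variables (lambda : R) (t_ : nat -> {RV P >-> R}).
Hypotheses (lambda_gt0 : 0 < lambda) (t_poisson : poisson_process P lambda t_).

Let t_incr x k : t_ k x < t_ k.+1 x. Proof. by case: t_poisson. Qed.

Let mt_le a b k : measurable [set x | (t_ k x <= a)%R = b].
Proof.
by apply: measurable_bool_eq; apply: measurable_fun_ler => //; exact: measurable_cst.
Qed.

Lemma measurable_hits c s n : measurable [set x | hits (t_ ^~ x) c s n].
Proof.
rewrite (_ : [set x | _] = \bigcap_i [set x | (i <= n)%N -> forall k,
    (t_ k x <= s i)%R = (k < cum c i.+1)%N]); last first.
  by apply/seteqP; split => x /= h i; [move=> _; exact: h|exact: (h i I)].
apply: bigcapT_measurable => i; case: (leqP i n) => ni.
  rewrite (_ : mkset _ = [set x | forall k, (t_ k x <= s i)%R = (k < cum c i.+1)%N]).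
    by apply: measurable_forall_nat => k; exact: mt_le.
  by apply/seteqP; split => x /= h //; exact: h.
by rewrite (_ : mkset _ = setT)//; apply/seteqP; split.
Qed.

Let mcount a b c : a <= b ->
  measurable [set x | point_count t_ `]a, b]%classic x = c%:R%:E].
Proof.
move=> ab; rewrite (_ : [set x | _] =
  [set x | exists l, (forall k, (t_ k x <= a)%R = (k < l)%N /\
             (t_ k x <= b)%R = (k < l + c)%N)] `|`
  [set x | c = 0%N /\ forall k, (t_ k x <= a)%R = true]).
  apply: measurableU.
    apply: measurable_exists_nat => l; apply: measurable_forall_nat => k.
    exact: (measurableI _ _ (mt_le a (k < l)%N k) (mt_le b (k < l + c)%N k)).
  apply: (@measurableI _ _ [set x | c = 0%N] [set x | forall k, (t_ k x <= a)%R = true]);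
    last by apply: measurable_forall_nat => k; exact: mt_le.
  have [c0|c0] := pselect (c = 0%N).
    by rewrite (_ : mkset _ = setT)//; apply/seteqP; split.
  by rewrite (_ : mkset _ = set0)//; apply/seteqP; split.
apply/seteqP; split => x /=.
  move/(counting_intervalP (t_incr x) c ab) => [[l [ha hb]]|[c0 ha]]; [left|right] => //.
  by exists l.
move=> h; apply/(counting_intervalP (t_incr x) c ab); case: h => [[l h]|[c0 ha]].
  by left; exists l; split => k; have [] := h k.
by right.
Qed.

Let count_prob a b c : 0 <= a -> a <= b ->
  P [set x | point_count t_ `]a, b]%classic x = c%:R%:E] =
  (poisson_weight (lambda * (b - a)) c)%:E.
Proof.
move=> a0; rewrite le_eqVlt => /orP[/eqP <-|ab]; last first.
  have [_ _ _ _ ->//] := t_poisson.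
  by rewrite /poisson_pmf mulr_gt0// subr_gt0.
have E x : point_count t_ `]a, a]%classic x = 0%:R%:E.
  rewrite /point_count (_ : [set k | _] = set0) ?counting_set0//.
  by rewrite -subset0 => k /=; rewrite in_itv/= => /andP[/lt_le_trans h /h]; rewrite ltxx.
rewrite subrr mulr0 /poisson_weight oppr0 expR0 mulr1.
case: c => [|c]; rewrite ?expr0 ?divr1 ?expr0n/= ?mul0r.
  rewrite (_ : [set x | _] = setT); first exact: probability_setT.
  by apply/seteqP; split => // x _ /=; rewrite E.
rewrite (_ : [set x | _] = set0) ?measure0//.
rewrite -subset0 => x /=; rewrite E => -[] /eqP; by rewrite eqr_nat.
Qed.

Lemma probability_hits c s n : 0 <= s 0%N -> nondecreasing_seq s ->
  fine (P [set x | hits (t_ ^~ x) c s n]) =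
  \prod_(i < n.+1) poisson_weight (lambda * gap s i) (c i).
Proof.
(* The grid is preceded by 0, so that the first interval is also half-open; it differs from [0, s_0]
   by the point 0, which almost surely carries no attack. *)
move=> s0 snd; pose s' i := if i is j.+1 then s j else 0.
have s'nd : nondecreasing_seq s'.
  apply/nondecreasing_seqP => -[|i] //=; exact: snd.
have s'0 i : 0 <= s' i by case: i => //= i; apply: (le_trans s0); exact: snd.
have s'le i : s' i <= s' i.+1 by apply: s'nd.
pose K i := [set x | point_count t_ `]s' i, s' i.+1]%classic x = (c i)%:R%:E].
have mK i : measurable (K i) by exact: mcount.
have PK : fine (P (\bigcap_(i in [set` iota 0 n.+1]) K i)) =
    \prod_(i < n.+1) poisson_weight (lambda * gap s i) (c i).
  have [_ _ _ ind _] := t_poisson.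
  rewrite (mutually_independent_seq (ind s' (lexx _) s'nd) (iota_uniq 0 n.+1)); last first.
    move=> i _; exists [set (c i)%:R%:E]; first exact: emeasurable_set1.
    by rewrite setTI.
  rewrite fine_prod_probability// -(big_mkord xpredT (fun i => poisson_weight (lambda * gap s i) (c i))).
  apply: eq_bigr => i _; rewrite (count_prob (c i) (s'0 i) (s'le i))/=; congr poisson_weight.
  by case: i => [|i] //=; rewrite subr0.
rewrite -PK; apply: ae_eq_probability; first exact: measurable_hits.
  by apply: measurable_bigcap_seq => i _.
have [t0 _ pc0 _ _] := t_poisson.
move: pc0; apply: filterS => x /counting_eq0 pc0.
have tpos k : 0 < t_ k x.
  have : 0 <= t_ k x by apply: (le_trans (t0 x)); exact: (u_leq (t_incr x)).
  rewrite le_eqVlt => /orP[/eqP tk0|//].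
  by have : set0 k by rewrite -pc0 /= -tk0.
have s'hit i : hits (t_ ^~ x) c s n -> (i <= n.+1)%N ->
    forall k, (t_ k x <= s' i) = (k < cum c i)%N.
  move=> h; case: i => [_ k|i ni]; last exact: h.
  by rewrite /= leNgt tpos /cum big_ord0.
split=> [h i|h].
  rewrite /mkset mem_iota add0n => /andP[_ ni]; apply/(counting_intervalP (t_incr x) (c i) (s'le i)).
  left; exists (cum c i); rewrite -cumS; split; apply: s'hit => //.
  exact: ltnW.
have hK i : (i <= n)%N -> K i x by move=> ni; apply: h; rewrite /mkset mem_iota.
have s'hit' i : (i <= n.+1)%N -> forall k, (t_ k x <= s' i) = (k < cum c i)%N.
  elim: i => [_ k|i IH ni]; first by rewrite /= leNgt tpos /cum big_ord0.
  have /(counting_intervalP (t_incr x) (c i) (s'le i)) [[l [ha hb]]|[_ ha]] := hK i ni.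
    have li : l = cum c i.
      by apply: segment_inj => k; rewrite -ha IH// ltnW.
    by move=> k; rewrite hb li cumS.
  (* All points at or below [s' i] is impossible: by induction the point of index [cum c i] lies
     beyond it. *)
  by have := ha (cum c i); rewrite IH ?ltnn// ltnW.
by move=> i ni k; exact: (s'hit' i.+1).
Qed.

End poisson_grid.

(** * Marks *)

Section sigma_families.
Context d (T : measurableType d).

Lemma sigma_rv_measurable d' (T' : measurableType d') (X : T -> T') :
  measurable_fun setT X -> sigma_rv X `<=` measurable.
Proof. by move=> mX A [B mB <-]; exact: mX. Qed.

Lemma g_sigma_measurable (G : set_system T) : G `<=` measurable -> <<s G >> `<=` measurable.
Proof. by move=> Gm; apply: smallest_sub => //; exact: sigma_algebra_measurable. Qed.

Lemma sigma_family_measurable (I : Type) d' (T' : measurableType d') (X : I -> T -> T') :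
  (forall i, measurable_fun setT (X i)) -> sigma_family X `<=` measurable.
Proof.
move=> mX; apply: g_sigma_measurable => A [i _]; exact: sigma_rv_measurable.
Qed.

Lemma sigma_rv_family (I : Type) d' (T' : measurableType d') (X : I -> T -> T') i :
  sigma_rv (X i) `<=` sigma_family X.
Proof. by move=> A XA; apply: sub_sigma_algebra; exists i. Qed.

Lemma g_sigma_bigcap_seq (G : set_system T) (I : choiceType) (s : seq I) (A : I -> set T) :
  (forall i, i \in s -> <<s G >> (A i)) -> <<s G >> (\bigcap_(i in [set` s]) A i).
Proof.
move=> GA; exact: (@measurable_bigcap_seq _ (g_sigma_algebraType G) _ s A GA).
Qed.

Lemma g_sigma_setT (G : set_system T) : <<s G >> setT.
Proof. exact: (@measurableT _ (g_sigma_algebraType G)). Qed.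

Lemma sigma_rv_preimage d' (T' : measurableType d') (X : T -> T') B :
  measurable B -> sigma_rv X (X @^-1` B).
Proof. by move=> mB; exists B => //; rewrite setTI. Qed.

Lemma measurable_wrt_comp d' (T' : measurableType d') {R : realType} (X : T -> T')
    (f : T' -> R[i]) : cmeas f -> measurable_wrt (sigma_rv X) (fun x => f (X x)).
Proof.
move=> [f1 f2] B mB; split.
  exists ((fun y => complex.Re (f y)) @^-1` B); last by rewrite setTI.
  by have := f1 measurableT B mB; rewrite setTI.
exists ((fun y => complex.Im (f y)) @^-1` B); last by rewrite setTI.
by have := f2 measurableT B mB; rewrite setTI.
Qed.

End sigma_families.

Section marks.
Context d (T : measurableType d) {R : realType} (P : probability T R).
Variables (Ft : set_system T) (n_ : nat -> {RV P >-> nat}) (w_ : nat -> nat -> {RV P >-> R}).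
Hypotheses (n_iid : iid P n_) (w_ge0 : forall j k x, 0 <= w_ j k x).
Hypothesis w_iid : iid P (fun jk : nat * nat => w_ jk.1 jk.2).
Hypothesis Ftm : Ft `<=` measurable.
Hypothesis tnw_indep : forall A B C, Ft A -> sigma_family n_ B ->
  sigma_family (fun jk : nat * nat => w_ jk.1 jk.2) C ->
  P (A `&` B `&` C) = (P A * P B * P C)%E.

(** The product over single nodes is the form in which independence of the [w_ j k] applies; [markE]
    gives the closed form z^(n_k) exp(-v w_k). *)
Definition mark (z v : R[i]) k x := \prod_(j < n_ k x) (z * cexp (- (v * (w_ j k x)%:C))).

Definition mark_transform (z v : R[i]) :=
  pgf P (n_ 0%N) (z * laplace_stieltjes P (w_ 0%N 0%N) v).

Let wmark (z v : R[i]) j k x := z * cexp (- (v * (w_ j k x)%:C)).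

Let cabs_wmark z v j k x : cabs z <= 1 -> 0 <= complex.Re v -> cabs (wmark z v j k x) <= 1.
Proof.
move=> z1 v0; rewrite cabsM mulr_ile1 ?cabs_ge0// cabs_cexp_lin -expR0 ler_expR.
by rewrite oppr_le0 mulr_ge0.
Qed.

Let cmeas_wexp v : cmeas (fun y : R => cexp (- (v * y%:C))).
Proof.
apply: cmeas_cexp; apply: cmeasN; apply: cmeasM; first exact: cmeas_cst.
by apply: cmeas_real.
Qed.

Let cabs_laplace v : 0 <= complex.Re v ->
  cabs (laplace_stieltjes P (w_ 0%N 0%N) v) <= 1.
Proof.
move=> v0; apply: cexpectation_le => [|x].
  exact: (cmeas_comp (cmeas_wexp v) (measurable_funPT _)).
by rewrite -[cexp _]mul1r; apply: (cabs_wmark (z := 1)) => //; rewrite cabs1.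
Qed.

Let cexpectation_wmark z v j k : 0 <= complex.Re v ->
  cexpectation P (wmark z v j k) = z * laplace_stieltjes P (w_ 0%N 0%N) v.
Proof.
move=> v0; rewrite /cexpectation cintegralZ; last first.
  apply: (bounded_cintegrable _ (C := 1)) => [|x].
    exact: (cmeas_comp (cmeas_wexp v) (measurable_funPT _)).
  by rewrite -[cexp _]mul1r; apply: (cabs_wmark (z := 1)) => //; rewrite cabs1.
congr (_ * _).
(* The absolute value bounds the test function on the whole line and changes nothing on nonnegative
   weights. *)
pose f (y : R) := cexp (- (v * `|y|%:C)).
have fE i m x : cexp (- (v * (w_ i m x)%:C)) = f (w_ i m x) by rewrite /f ger0_norm.
rewrite /laplace_stieltjes -/(cexpectation _ _).
under eq_fun do rewrite fE; under [in RHS]eq_fun do rewrite fE.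
apply: (identically_distributed_cexpectation (C := 1)).
- exact: measurable_funPT.
- exact: measurable_funPT.
- exact: (w_iid.2 (j, k) (0%N, 0%N)).
- exact: (cmeas_comp (cmeas_wexp v) (@normr_measurable R setT)).
- move=> y; rewrite cabs_cexp_lin -expR0 ler_expR oppr_le0 mulr_ge0//.
Qed.

Let hit_n k m : set T := n_ k @^-1` [set m].

Let hit_nF k m : sigma_rv (n_ k) (hit_n k m).
Proof. exact: sigma_rv_preimage. Qed.

Let mhit_n k m : measurable (hit_n k m).
Proof. by apply: (sigma_rv_measurable _ (hit_nF k m)); exact: measurable_funPT. Qed.

Section fixed_marks.
Variables (A : set T) (K : nat) (e : nat -> nat) (zz vv : nat -> R[i]).
Hypotheses (FA : Ft A) (zz1 : forall k, cabs (zz k) <= 1) (vv0 : forall k, 0 <= complex.Re (vv k)).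

Let wfam (jk : nat * nat) : T -> R := w_ jk.1 jk.2.

(** Once every [n_ k] has a prescribed value [e k], the product runs over a deterministic set of
    pairs [(j, k)], and independence of the weights applies to it. *)
Lemma cexpectation_fixed_marks :
  cexpectation P (fun x => \prod_(k < K) (ind (hit_n k (e k)) x *
    \prod_(j < e k) wmark (zz k) (vv k) j k x) * ind A x) =
  \prod_(k < K) ((fine (P (hit_n k (e k))))%:C *
    (zz k * laplace_stieltjes P (w_ 0%N 0%N) (vv k)) ^+ e k) * (fine (P A))%:C.
Proof.
pose B := \bigcap_(k in [set` iota 0 K]) hit_n k (e k).
have FB : sigma_family n_ B.
  by apply: g_sigma_bigcap_seq => k _; exact: sigma_rv_family.
have mB : measurable B by apply: measurable_bigcap_seq.
have mA := Ftm FA.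
have mwf jk : measurable_fun setT (wfam jk) by exact: measurable_funPT.
(* The condition on attack times and node numbers is one indicator, independent of the weights,
   which stays outside the product. *)
pose Y x : R[i] := ind (A `&` B) x.
have mY : cmeas Y by apply: cmeas_ind; exact: measurableI.
have PB : fine (P B) = \prod_(k < K) fine (P (hit_n k (e k))).
  rewrite (mutually_independent_seq n_iid.1 (iota_uniq 0 K)) => [|k _]; last exact: hit_nF.
  rewrite fine_prod_probability//.
  by rewrite -(big_mkord xpredT (fun k => fine (P (hit_n k (e k))))) /index_iota subn0.
have EY : cexpectation P Y = (fine (P A) * fine (P B))%:C.
  rewrite cexpectation_ind; last exact: measurableI.
  have := tnw_indep FA FB (@g_sigma_setT _ _ _); rewrite setIT => ->.
  rewrite [X in (_ * X)%E](_ : _ = 1%E) ?mule1; last exact: probability_setT.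
  by rewrite fineM// fin_num_measure.
pose s := [seq (j, k) | k <- iota 0 K, j <- iota 0 (e k)].
have us : uniq s.
  apply: allpairs_uniq_dep => [|k _|]; rewrite ?iota_uniq//.
  by move=> [k1 j1] [k2 j2] _ _ /= [-> ->].
pose Z (jk : nat * nat) := wmark (zz jk.2) (vv jk.2) jk.1 jk.2.
have prodZ (f : nat -> nat -> R[i]) :
    \prod_(i <- s) f i.1 i.2 = \prod_(k < K) \prod_(j < e k) f j k.
  rewrite big_allpairs_dep -(big_mkord xpredT (fun k => \prod_(j < e k) f j k)).
  rewrite /index_iota subn0; apply: eq_bigr => k _.
  by rewrite -(big_mkord xpredT (fun j => f j k)) /index_iota subn0.
have := @cexpectation_factor_prod _ _ _ P _ (fun jk => sigma_rv (wfam jk)) Y 1 _ mY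
  (cabs_ind _) _ s Z us _ _.
rewrite EY => H.
have -> : (fun x => \prod_(k < K) (ind (hit_n k (e k)) x *
    \prod_(j < e k) wmark (zz k) (vv k) j k x) * ind A x) =
    fun x => \prod_(i <- s) Z i x * Y x.
  apply/funext => x; have EZ := prodZ (fun j k => wmark (zz k) (vv k) j k x).
  rewrite big_split/= -EZ /Y indI -prod_ind.
  have -> : \prod_(k <- iota 0 K) ind (hit_n k (e k)) x =
      \prod_(k < K) ind (hit_n k (e k)) x :> R[i].
    by rewrite -(big_mkord xpredT (fun k => ind (hit_n k (e k)) x)) /index_iota subn0.
  by rewrite /Z; ring.
rewrite {}H.
- rewrite (prodZ (fun j k => cexpectation P (wmark (zz k) (vv k) j k))).
  rewrite (eq_bigr (fun k : 'I_K =>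
      (zz k * laplace_stieltjes P (w_ 0%N 0%N) (vv k)) ^+ e k)); last first.
    move=> k _; rewrite (eq_bigr (fun=> zz k * laplace_stieltjes P (w_ 0%N 0%N) (vv k))).
      by rewrite prodr_const card_ord.
    by move=> j _; exact: cexpectation_wmark.
  by rewrite PB rmorphM rmorph_prod big_split/=; ring.
- by move=> jk; apply: sigma_rv_measurable.
- move=> r C ur FC; have FCf i : i \in r -> sigma_family (fun jk => wfam jk) (C i).
    by move=> /FC; exact: (sigma_rv_family (X := wfam)).
  have FCC : sigma_family wfam (\bigcap_(i in [set` r]) C i) by exact: g_sigma_bigcap_seq.
  have mC : measurable (\bigcap_(i in [set` r]) C i).
    by apply: (sigma_family_measurable mwf).
  have -> : (fun x => \prod_(i <- r) ind (C i) x * Y x) =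
      ind ((A `&` B) `&` \bigcap_(i in [set` r]) C i).
    by apply/funext => x; rewrite prod_ind mulrC -indI.
  rewrite cexpectation_ind; last by apply: measurableI => //; exact: measurableI.
  have PC : (fine (P (\bigcap_(i in [set` r]) C i)))%:C =
      \prod_(i <- r) (fine (P (C i)))%:C.
    rewrite -(cexpectation_prod_ind w_iid.1 _ ur FC); last first.
      by move=> jk; exact: sigma_rv_measurable.
    rewrite -cexpectation_ind//; congr cexpectation; apply/funext => x.
    by rewrite prod_ind.
  rewrite (tnw_indep FA FB FCC) -PC -rmorphM; congr (_%:C).
  by rewrite fineM ?fin_numM ?fin_num_measure// fineM ?fin_num_measure// mulrC.
- by move=> jk; apply: (measurable_wrt_comp (wfam jk) (f := fun y => zz jk.2 * cexp (- (vv jk.2 * y%:C))));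
    apply: cmeasM; [exact: cmeas_cst|exact: cmeas_wexp].
- by move=> jk x; exact: cabs_wmark.
Qed.

End fixed_marks.

Let ind_hit_n k m x : ind (hit_n k m) x = (n_ k x == m)%:R :> R[i].
Proof.
rewrite /ind; congr (nat_of_bool _)%:R.
by apply/idP/eqP; rewrite inE.
Qed.

Let trunc_sum Q k (f : nat -> R[i]) x :
  \sum_(m < Q) ind (hit_n k m) x * f m = if (n_ k x < Q)%N then f (n_ k x) else 0.
Proof.
case: ltnP => nQ.
  rewrite (bigD1 (Ordinal nQ))//= ind_hit_n eqxx mul1r big1 ?addr0// => m mn.
  rewrite ind_hit_n; case: eqP => [E|]; last by rewrite mul0r.
  by case/eqP : mn; apply: val_inj.
rewrite big1// => m _; rewrite ind_hit_n; case: eqP => [E|]; last by rewrite mul0r.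
by move: nQ; rewrite E leqNgt ltn_ord.
Qed.

Let trunc_cvg k (f : nat -> R[i]) x :
  ccvg (fun Q => \sum_(m < Q) ind (hit_n k m) x * f m) (f (n_ k x)).
Proof.
apply: near_ccvg (ccvg_cst _); near=> Q; rewrite trunc_sum ifT//.
by near: Q; exact: nbhs_infty_gt.
Unshelve. all: by end_near. Qed.

Let trunc_le Q k (f : nat -> R[i]) x : (forall m, cabs (f m) <= 1) ->
  cabs (\sum_(m < Q) ind (hit_n k m) x * f m) <= 1.
Proof. by move=> f1; rewrite trunc_sum; case: ifP; rewrite ?cabs0. Qed.

Lemma cabs_mark z v k x : cabs z <= 1 -> 0 <= complex.Re v -> cabs (mark z v k x) <= 1.
Proof. by move=> z1 v0; apply: cabs_prod_le1 => j; exact: cabs_wmark. Qed.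

Let cmeas_wmark z v j k : cmeas (wmark z v j k).
Proof.
apply: cmeasM; first exact: cmeas_cst.
exact: (cmeas_comp (cmeas_wexp v) (measurable_funPT _)).
Qed.

Lemma pgf_n k (z : R[i]) : cabs z <= 1 ->
  ccvg (fun Q => \sum_(m < Q) (fine (P (hit_n k m)))%:C * z ^+ m) (pgf P (n_ 0%N) z).
Proof.
move=> z1; have zX m : cabs (z ^+ m) <= 1 by rewrite cabsX exprn_ile1 ?cabs_ge0.
have -> : pgf P (n_ 0%N) z = cexpectation P (fun x => z ^+ n_ k x).
  apply: (identically_distributed_cexpectation (f := fun m : nat => z ^+ m) (C := 1)) => //.
  exact: (n_iid.2 0%N k).
have mi m : cmeas (fun x => ind (hit_n k m) x * z ^+ m).
  by apply: cmeasM; [exact: cmeas_ind|exact: cmeas_cst].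
have E Q : \sum_(m < Q) (fine (P (hit_n k m)))%:C * z ^+ m =
    cexpectation P (fun x => \sum_(m < Q) ind (hit_n k m) x * z ^+ m).
  rewrite /cexpectation cintegral_sum => [|m]; last first.
    apply: (bounded_cintegrable _ (C := 1)) => // x.
    by rewrite cabsM mulr_ile1 ?cabs_ge0// cabs_ind.
  apply: eq_bigr => m _; rewrite -(cexpectation_ind P (mhit_n k m)) mulrC.
  rewrite /cexpectation -cintegralZ.
    by congr cintegral; apply/funext => x; rewrite mulrC.
  by apply: (bounded_cintegrable _ (C := 1)); [exact: cmeas_ind|move=> x; exact: cabs_ind].
under eq_fun do rewrite E.
apply: (cexpectation_cvg P (C := 1)) => [Q|Q x|x].
- exact: cmeas_sum.
- exact: trunc_le.
- exact: trunc_cvg.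
Qed.

(** With the node numbers truncated below [Q], the product of sums expands into a sum over functions
    from ['I_K] to ['I_Q]. Each term has fixed marks; the terms recombine into a product, and [Q]
    tends to infinity. *)
Lemma cexpectation_marks (A : set T) (K : nat) (zz vv : nat -> R[i]) : Ft A ->
  (forall k, cabs (zz k) <= 1) -> (forall k, 0 <= complex.Re (vv k)) ->
  cexpectation P (fun x => \prod_(k < K) mark (zz k) (vv k) k x * ind A x) =
  \prod_(k < K) mark_transform (zz k) (vv k) * (fine (P A))%:C.
Proof.
move=> FA zz1 vv0; have mA := Ftm FA.
pose W k m x := \prod_(j < m) wmark (zz k) (vv k) j k x.
have W1 k m x : cabs (W k m x) <= 1 by apply: cabs_prod_le1 => j; exact: cabs_wmark.
have mW k m : cmeas (W k m) by apply: cmeas_prod => j; exact: cmeas_wmark.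
have mi k m : cmeas (fun x => ind (hit_n k m) x * W k m x).
  by apply: cmeasM => //; exact: cmeas_ind.
have mIA : cmeas (ind A : T -> R[i]) by exact: cmeas_ind.
pose zl k := zz k * laplace_stieltjes P (w_ 0%N 0%N) (vv k).
have zl1 k : cabs (zl k) <= 1 by rewrite cabsM mulr_ile1 ?cabs_ge0 ?cabs_laplace.
have h1 : ccvg (fun Q => cexpectation P (fun x =>
      \prod_(k < K) (\sum_(m < Q) ind (hit_n k m) x * W k m x) * ind A x))
    (cexpectation P (fun x => \prod_(k < K) mark (zz k) (vv k) k x * ind A x)).
  apply: (cexpectation_cvg P (C := 1)) => [Q|Q x|x].
  - by apply: cmeasM => //; apply: cmeas_prod => k; exact: cmeas_sum.
  - rewrite cabsM mulr_ile1 ?cabs_ge0 ?cabs_ind//.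
    by apply: cabs_prod_le1 => k; exact: (trunc_le _ _ _ (W1 k ^~ x)).
  - apply: ccvgM; last exact: ccvg_cst.
    by apply: ccvg_prod => k; exact: (trunc_cvg k (W k ^~ x)).
apply: ccvg_unique h1 _.
have E Q : cexpectation P (fun x =>
      \prod_(k < K) (\sum_(m < Q) ind (hit_n k m) x * W k m x) * ind A x) =
    \prod_(k < K) (\sum_(m < Q) (fine (P (hit_n k m)))%:C * zl k ^+ m) * (fine (P A))%:C.
  rewrite bigA_distr_bigA mulr_suml.
  have -> : (fun x => \prod_(k < K) (\sum_(m < Q) ind (hit_n k m) x * W k m x) * ind A x) =
      fun x => \sum_(f : {ffun 'I_K -> 'I_Q}) \prod_(k < K)
        (ind (hit_n k (f k)) x * W k (f k) x) * ind A x.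
    by apply/funext => x; rewrite bigA_distr_bigA mulr_suml.
  rewrite /cexpectation cintegral_sum => [|f]; last first.
    apply: (bounded_cintegrable _ (C := 1)) => [|x].
      by apply: cmeasM => //; exact: cmeas_prod.
    rewrite cabsM mulr_ile1 ?cabs_ge0 ?cabs_ind// cabs_prod_le1// => k.
    by rewrite cabsM mulr_ile1 ?cabs_ge0 ?cabs_ind.
  apply: eq_bigr => f _.
  pose e k := oapp (fun i : 'I_K => f i : nat) 0%N (insub k).
  have eE (k : 'I_K) : e k = f k by rewrite /e valK.
  transitivity (\prod_(k < K) ((fine (P (hit_n k (e k))))%:C * zl k ^+ e k) * (fine (P A))%:C);
    last by congr (_ * _); apply: eq_bigr => k _; rewrite eE.
  rewrite -(cexpectation_fixed_marks K e FA zz1 vv0); congr cintegral.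
  by apply/funext => x; congr (_ * _); apply: eq_bigr => k _; rewrite eE.
under eq_fun do rewrite E.
apply: ccvgM; last exact: ccvg_cst.
by apply: ccvg_prod => k; exact: pgf_n.
Qed.

End marks.

(** * Measurability of the observed totals *)

Section finitely_supported_sums.
Context {U : nmodType}.
Implicit Types (A : set nat) (m : nat -> U).

Lemma fsum_bounded A m K : (forall k, (K <= k)%N -> A k -> m k = 0) ->
  \sum_(k \in A) m k = \sum_(k < K | `[< A k >]) m k.
Proof.
move=> h; rewrite -(fsbig_widen [set k | A k /\ (k < K)%N] A m).
- rewrite (_ : [set k | _] = [set` [seq k <- index_iota 0 K | `[< A k >]]]); last first.
    apply/seteqP; split => k /=; rewrite mem_filter mem_index_iota /=.
      by move=> [Ak ->]; rewrite andbT; apply/asboolP.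
    by move=> /andP[/asboolP].
  rewrite -fsbig_seq; last by rewrite filter_uniq// iota_uniq.
  by rewrite big_filter big_mkord.
- by move=> k [].
- move=> k [Ak nk]; apply: h => //.
  by rewrite leqNgt; apply/negP => kK; apply: nk.
Qed.

(* Sums with infinite support are 0 by convention. *)
Lemma fsum_unbounded A m : ~ (exists K, forall k, (K <= k)%N -> A k -> m k = 0) ->
  \sum_(k \in A) m k = 0.
Proof.
move=> h; apply: fsbig_dflt => /finite_seqP[s ss]; apply: h.
exists (\max_(k <- s) k).+1 => k sk Ak; apply: contrapT => mk.
have : [set` s] k by rewrite -ss /=; split => //=; apply/eqP.
move=> /= ks; move: sk; rewrite ltnNge => /negP; apply.
by rewrite (big_rem k ks)/= leq_maxl.
Qed.
End finitely_supported_sums.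

(** The default value of [\sum_(k \in A)] matters: either some [K] bounds the support and the sum is
    an ordinary finite one, or no [K] does and the sum is 0. This splits the preimage into countably
    many measurable pieces. *)
Lemma measurable_fsum d (T : measurableType d) (U : nmodType) (A : nat -> T -> Prop)
    (m : nat -> T -> U) (B : set U) :
  (forall k, measurable [set x | A k x]) ->
  (forall k, measurable [set x | m k x = 0]) ->
  (forall K, measurable [set x | B (\sum_(k < K | `[< A k x >]) m k x)]) ->
  measurable [set x | B (\sum_(k \in [set k | A k x]) m k x)].
Proof.
move=> mA m0 mB.
pose D K := [set x | forall k, (K <= k)%N -> A k x -> m k x = 0].
have mD K : measurable (D K).
  apply: measurable_forall_nat => k; case: (leqP K k) => Kk; last first.
    by rewrite (_ : mkset _ = setT)//; apply/seteqP; split.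
  rewrite (_ : mkset _ = ~` [set x | A k x] `|` [set x | m k x = 0]).
    by apply: measurableU => //; exact: measurableC.
  apply/seteqP; split => x /=; last by case=> [nA _ /nA|].
  by move=> /(_ isT); case: (pselect (A k x)) => Ak h; [right; exact: h|left].
rewrite (_ : [set x | _] =
  (\bigcup_K (D K `&` [set x | B (\sum_(k < K | `[< A k x >]) m k x)])) `|`
  (~` (\bigcup_K D K) `&` [set x | B 0])).
  apply: measurableU; first by apply: bigcupT_measurable => K; exact: measurableI.
  apply: measurableI; first by apply: measurableC; exact: bigcupT_measurable.
  have [B0|B0] := pselect (B 0).
    by rewrite (_ : mkset _ = setT)//; apply/seteqP; split.
  by rewrite (_ : mkset _ = set0)//; apply/seteqP; split.
apply/seteqP; split => x /=.
  have [[K DK]|nD] := pselect (exists K, D K x).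
    by rewrite (fsum_bounded (K := K))// => BS; left; exists K.
  rewrite fsum_unbounded// => B0; right; split => // -[K _ DK]; apply: nD; by exists K.
move=> [[K _ [DK]]|[nD B0]]; first by rewrite (fsum_bounded (K := K)).
by rewrite fsum_unbounded// => -[K DK]; apply: nD; exists K.
Qed.

Lemma measurable_fsum_real d (T : measurableType d) (R : realType) (A : nat -> T -> Prop)
    (m : nat -> T -> R) :
  (forall k, measurable [set x | A k x]) -> (forall k, measurable_fun setT (m k)) ->
  measurable_fun setT (fun x => \sum_(k \in [set k | A k x]) m k x).
Proof.
move=> mA mm _ B mB; rewrite setTI; apply: measurable_fsum => // [k|K].
  by rewrite -[X in measurable X]setTI; exact: (mm k measurableT [set 0]).
under eq_set do rewrite big_mkcond.
have mf k : measurable_fun setT (fun x => if `[< A k x >] then m k x else 0).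
  apply: measurable_fun_ifT => //.
  apply: (measurable_fun_bool true); rewrite setTI.
  by rewrite (_ : _ @^-1` _ = [set x | A k x])//; apply/seteqP; split => x /= /asboolP.
have := @measurable_sum _ T R setT _ (index_enum 'I_K) (fun k x => if `[< A k x >] then m k x else 0) (fun k : 'I_K => mf k).
by move=> /(_ measurableT B mB); rewrite setTI.
Qed.

Lemma measurable_fun_natr d (T : measurableType d) (R : realType) (f : T -> nat) :
  measurable_fun setT (fun x => (f x)%:R : R) -> measurable_fun setT f.
Proof.
move=> mf _ B _; rewrite setTI (_ : f @^-1` B = \bigcup_(n in B) [set x | (f x)%:R = n%:R :> R]).
  apply: bigcup_measurable => n _; rewrite -[X in measurable X]setTI.
  exact: (mf measurableT [set n%:R]).
apply/seteqP; split => x /=; first by exists (f x).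
by move=> [n Bn /=] /eqP; rewrite eqr_nat => /eqP ->.
Qed.

Lemma measurable_fsum_nat (R : realType) d (T : measurableType d) (A : nat -> T -> Prop)
    (m : nat -> T -> nat) :
  (forall k, measurable [set x | A k x]) -> (forall k, measurable_fun setT (m k)) ->
  measurable_fun setT (fun x => \sum_(k \in [set k | A k x]) m k x).
Proof.
move=> mA mm _ B mB; rewrite setTI; apply: measurable_fsum => // [k|K].
  by rewrite -[X in measurable X]setTI; exact: (mm k measurableT [set 0%N]).
have mf k : measurable_fun setT (fun x => if `[< A k x >] then m k x else 0%N).
  apply: measurable_fun_ifT => //.
  apply: (measurable_fun_bool true); rewrite setTI.
  by rewrite (_ : _ @^-1` _ = [set x | A k x])//; apply/seteqP; split => x /= /asboolP.
suff mS : measurable_fun setT (fun x => \sum_(k < K | `[< A k x >]) m k x)%N.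
  by have := mS measurableT B mB; rewrite setTI.
apply: (measurable_fun_natr (R := R)).
under eq_fun do rewrite big_mkcond natr_sum.
apply: measurable_sum => k.
have mnat : measurable_fun setT (fun i : nat => i%:R : R) by [].
exact: (measurableT_comp mnat (mf k)).
Qed.

Lemma measurable_index d d' (T : measurableType d) (T' : measurableType d')
    (n : T -> nat) (f : nat -> T -> T') :
  measurable_fun setT n -> (forall m, measurable_fun setT (f m)) ->
  measurable_fun setT (fun x => f (n x) x).
Proof.
move=> mn mf _ B mB; rewrite setTI.
rewrite (_ : _ @^-1` B = \bigcup_m (n @^-1` [set m] `&` f m @^-1` B)).
  apply: bigcupT_measurable => m; apply: measurableI.
    by rewrite -[X in measurable X]setTI; exact: mn.
  by rewrite -[X in measurable X]setTI; exact: mf.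
by apply/seteqP; split => x /= => [Bx|[m _ [<-]]]; first by exists (n x).
Qed.

Section observed_measurability.
Context d (T : measurableType d) {R : realType}.
Variables t_ tau : nat -> T -> R.
Hypotheses (mt : forall k, measurable_fun setT (t_ k)) (mtau : forall i, measurable_fun setT (tau i)).

Lemma measurable_observation_interval i k :
  measurable [set x | observation_interval tau i x (t_ k x)].
Proof.
have mb (f : T -> bool) : measurable_fun setT f -> measurable [set x | f x].
  exact: measurable_bool_eq.
case: i => [|i] /=; under eq_set do rewrite in_itv/=; apply: mb; apply: measurable_and.
- by apply: measurable_fun_ler => //; exact: measurable_cst.
- exact: measurable_fun_ler.
- exact: measurable_fun_ltr.
- exact: measurable_fun_ler.
Qed.

Lemma measurable_mark_sum_real (m : nat -> T -> R) i :
  (forall k, measurable_fun setT (m k)) ->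
  measurable_fun setT (fun x => mark_sum t_ m (observation_interval tau i x) x).
Proof.
by move=> mm; apply: measurable_fsum_real mm => k; exact: measurable_observation_interval.
Qed.

Lemma measurable_mark_sum_nat (m : nat -> T -> nat) i :
  (forall k, measurable_fun setT (m k)) ->
  measurable_fun setT (fun x => mark_sum t_ m (observation_interval tau i x) x).
Proof.
move=> mm; apply: (measurable_fsum_nat R) mm => k.
exact: measurable_observation_interval.
Qed.

Lemma measurable_attack_weight (n_ : nat -> T -> nat) (w_ : nat -> nat -> T -> R) k :
  measurable_fun setT (n_ k) -> (forall j, measurable_fun setT (w_ j k)) ->
  measurable_fun setT (fun x => \sum_(j < n_ k x) w_ j k x).
Proof.
move=> mn mw; apply: (measurable_index (f := fun m x => \sum_(j < m) w_ j k x)) => // m.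
exact: measurable_sum.
Qed.

Lemma mark_sum_ge0 (m : nat -> T -> R) I x : (forall k, 0 <= m k x) ->
  0 <= mark_sum t_ m I x.
Proof. by move=> m0; apply: fsumr_ge0 => k _. Qed.

End observed_measurability.

(** * Joint transform of the increments *)

(** It counts the observation intervals whose last attack precedes attack [k], which is the number
    of the interval containing [k]. *)
Definition block c N k := (\sum_(i < N.+1) (cum c i.+1 <= k))%N.

Lemma blockE c N k i : (i <= N)%N -> (cum c i <= k < cum c i.+1)%N -> block c N k = i.
Proof.
move=> iN /andP[ik ki]; rewrite /block.
rewrite (eq_bigr (fun j : 'I_N.+1 => if (j < i)%N then 1%N else 0%N)) => [|j _].
  rewrite -big_mkcond -(big_ord_widen _ (fun=> 1%N) (leqW iN)).
  by rewrite sum_nat_const card_ord muln1.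
case: ltnP => ji.
  by rewrite (leq_trans _ ik)// cum_leq.
by rewrite leqNgt (leq_trans ki)// cum_leq.
Qed.

Lemma prod_blocks (V : comPzRingType) (F : nat -> nat -> V) c N n : (n <= N.+1)%N ->
  \prod_(k < cum c n) F (block c N k) k =
  \prod_(i < n) \prod_(cum c i <= k < cum c i.+1) F i k.
Proof.
elim: n => [_|n IH nN]; first by rewrite /cum big_ord0 !big_ord0.
rewrite big_ord_recr/= -IH; last exact: ltnW.
rewrite -!(big_mkord xpredT (fun k => F (block c N k) k)).
rewrite (big_cat_nat _ (n := cum c n))//=; last exact: cum_leq.
congr (_ * _); apply: congr_big_nat => // k kn; rewrite (@blockE _ _ _ n)//.
Qed.

Section hits_random.
Context d (T : measurableType d) {R : realType}.

Lemma measurable_hits_random (u s : nat -> T -> R) c n :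
  (forall k, measurable_fun setT (u k)) -> (forall i, measurable_fun setT (s i)) ->
  measurable [set x | hits (u ^~ x) c (s ^~ x) n].
Proof.
move=> mu ms; apply: measurable_forall_nat => i.
case: (leqP i n) => ni; last first.
  by rewrite (_ : mkset _ = setT)//; apply/seteqP; split.
rewrite (_ : mkset _ = [set x | forall k, (u k x <= s i x)%R = (k < cum c i.+1)%N]).
  by apply: measurable_forall_nat => k; apply: measurable_bool_eq; exact: measurable_fun_ler.
by apply/seteqP; split => x /= h //; exact: h.
Qed.

Lemma hits_uniq (u : nat -> R) c c' (s : nat -> R) n i :
  hits u c s n -> hits u c' s n -> (i <= n)%N -> c i = c' i.
Proof.
move=> h h' ni; have e j : (j <= n)%N -> cum c j.+1 = cum c' j.+1.
  by move=> jn; apply: segment_inj => k; rewrite -(h _ jn) -(h' _ jn).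
have := e _ ni; rewrite !cumS; suff -> : cum c i = cum c' i by move/addnI.
case: i ni => [_|i ni]; first by rewrite /cum !big_ord0.
by apply: e; exact: ltnW.
Qed.

(** On a hitting event the attacks in interval [i] are those with indices from [cum c i] up to
    [cum c i.+1], so the finitely supported sum is the actual one. *)
Lemma mark_sum_hits (U : nmodType) (t_ tau : nat -> T -> R) (m : nat -> T -> U) c N i x :
  (forall k, 0 <= t_ k x) -> hits (t_ ^~ x) c (tau ^~ x) N -> (i <= N)%N ->
  mark_sum t_ m (observation_interval tau i x) x =
  \sum_(cum c i <= k < cum c i.+1) m k x.
Proof.
move=> t0 h iN; rewrite /mark_sum.
rewrite (_ : [set k | _] = [set` index_iota (cum c i) (cum c i.+1)]).
  by rewrite -fsbig_seq// iota_uniq.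
apply/seteqP; rewrite -eqEsubset; apply/funext => k; apply/propext => /=.
rewrite mem_index_iota; case: i iN => [_|i iN] /=.
  by rewrite in_itv/= t0 (h 0%N)// /cum big_ord0.
by rewrite in_itv/= ltNge (h i) ?(ltnW iN)// (h i.+1)// -leqNgt.
Qed.

End hits_random.

Section mark_facts.
Context d (T : measurableType d) {R : realType} (P : probability T R).

Lemma markE (n_ : nat -> {RV P >-> nat}) (w_ : nat -> nat -> {RV P >-> R}) (z v : R[i]) k x :
  mark n_ w_ z v k x =
  z ^+ n_ k x * cexp (- (v * (\sum_(j < n_ k x) w_ j k x)%:C)).
Proof.
rewrite /mark big_split/= prodr_const card_ord -cexp_sum; congr (_ * cexp _).
by rewrite sumrN rmorph_sum mulr_sumr.
Qed.

End mark_facts.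

Lemma cmeas_index d (T : measurableType d) {R : realType} (n : T -> nat) (f : nat -> T -> R[i]) :
  measurable_fun setT n -> (forall m, cmeas (f m)) -> cmeas (fun x => f (n x) x).
Proof.
move=> mn mf; split.
  by apply: (measurable_index (f := fun m x => complex.Re (f m x))) => // m; case: (mf m).
by apply: (measurable_index (f := fun m x => complex.Im (f m x))) => // m; case: (mf m).
Qed.

Section tuple_independence.
Context d (T : measurableType d) {R : realType} (P : probability T R).

Lemma mutually_independent_tuple n (F : n.-tuple (set_system T)) (A : n.-tuple (set T)) :
  mutually_independent P (tnth F) -> (forall i, tnth F i (tnth A i)) ->
  P (\big[setI/setT]_(i < n) tnth A i) = (\prod_(i < n) P (tnth A i))%E.
Proof.
move=> indF FA; rewrite -bigcap_seq.
by apply: (mutually_independent_seq indF (index_enum_uniq _)) => i _; exact: FA.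
Qed.

Lemma mutually_independent_pair (F1 F2 : set_system T) A1 A2 :
  mutually_independent P (tnth [tuple F1; F2]) -> F1 A1 -> F2 A2 ->
  P (A1 `&` A2) = (P A1 * P A2)%E.
Proof.
move=> indF FA1 FA2; have := @mutually_independent_tuple _ _ [tuple A1; A2] indF.
rewrite !big_ord_recl !big_ord0 !(tnth_nth setT)/= setIT mule1; apply=> // i.
rewrite !(tnth_nth setT).
by case: i => -[|[|[]]].
Qed.

Lemma mutually_independent_triple (F1 F2 F3 : set_system T) A1 A2 A3 :
  mutually_independent P (tnth [tuple F1; F2; F3]) -> F1 A1 -> F2 A2 -> F3 A3 ->
  P (A1 `&` A2 `&` A3) = (P A1 * P A2 * P A3)%E.
Proof.
move=> indF FA1 FA2 FA3; have := @mutually_independent_tuple _ _ [tuple A1; A2; A3] indF.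
rewrite !big_ord_recl !big_ord0 !(tnth_nth setT)/= setIT mule1 setIA muleA; apply=> // i.
rewrite !(tnth_nth setT).
by case: i => -[|[|[|[]]]].
Qed.

End tuple_independence.

Section poisson_weights.
Context {R : realType}.

Lemma poisson_weight_ge0 (r : R) m : 0 <= r -> 0 <= poisson_weight r m.
Proof. by move=> r0; rewrite mulr_ge0 ?expR_ge0// mulr_ge0 ?exprn_ge0 ?invr_ge0. Qed.

Lemma sum_poisson_weight_le1 (r : R) Q : 0 <= r -> \sum_(m < Q) poisson_weight r m <= 1.
Proof.
move=> r0; rewrite /poisson_weight -mulr_suml expRN ler_pdivrMr ?expR_gt0// mul1r.
have nd : nondecreasing_seq (exp_sum r).
  apply/nondecreasing_seqP => n; rewrite /exp_sum big_ord_recr/= lerDl.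
  by rewrite mulr_ge0 ?exprn_ge0 ?invr_ge0.
have cv := exp_sum_cvg (x := r).
rewrite -(cvg_lim _ cv)//; apply: (nondecreasing_cvgn_le nd).
by apply/cvg_ex; exists (expR r).
Qed.

Lemma cabs_sum_poisson_weight_le1 (r : R) (z : R[i]) Q : 0 <= r -> cabs z <= 1 ->
  cabs (\sum_(m < Q) (poisson_weight r m)%:C * z ^+ m) <= 1.
Proof.
move=> r0 z1; apply: (le_trans _ (sum_poisson_weight_le1 Q r0)).
apply: (le_trans (cabs_sum _ _ _)); apply: ler_sum => m _.
rewrite cabsM cabs_real ger0_norm ?poisson_weight_ge0//.
by rewrite ler_piMr ?poisson_weight_ge0// cabsX exprn_ile1 ?cabs_ge0.
Qed.

Lemma poisson_weight_le1 (r : R) m : 0 <= r -> poisson_weight r m <= 1.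
Proof.
move=> r0; apply: (le_trans _ (sum_poisson_weight_le1 m.+1 r0)).
by rewrite big_ord_recr/= lerDr sumr_ge0// => i _; exact: poisson_weight_ge0.
Qed.

Lemma sum_poisson_weight_ccvg (r : R) (z : R[i]) :
  ccvg (fun Q => \sum_(m < Q) (poisson_weight r m)%:C * z ^+ m)
    (cexp (- (r%:C - r%:C * z))).
Proof.
have -> : - (r%:C - r%:C * z) = r%:C * z + (- r)%:C by rewrite rmorphN; ring.
rewrite cexpD cexp_real; apply: eq_ccvg (ccvgM (exp_sum_ccvg (r%:C * z)) (ccvg_cst _)) => Q.
rewrite /exp_sum mulr_suml; apply: eq_bigr => m _.
rewrite /poisson_weight !rmorphM rmorphXn fmorphV rmorph_nat exprMn; ring.
Qed.

Lemma measurable_poisson_weight m : measurable_fun setT (fun r : R => poisson_weight r m).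
Proof.
apply: measurable_funM; last by apply: measurableT_comp => //; exact: measurable_expR.
by apply: measurable_funM => //; exact: exprn_measurable.
Qed.

End poisson_weights.

Definition extend_ffun n Q (f : {ffun 'I_n -> 'I_Q}) i :=
  oapp (fun j : 'I_n => f j : nat) 0%N (insub i).

Lemma extend_ffunE n Q (f : {ffun 'I_n -> 'I_Q}) (i : 'I_n) : extend_ffun f i = f i.
Proof. by rewrite /extend_ffun valK. Qed.

(** * Increments observed at random times *)

Section joint_transform.
Context d (T : measurableType d) {R : realType} (P : probability T R).
Variables (lambda : R) (t_ : nat -> {RV P >-> R}) (n_ : nat -> {RV P >-> nat}).
Variables (w_ : nat -> nat -> {RV P >-> R}) (tau : nat -> {RV P >-> R}).
Hypotheses (lambda_gt0 : 0 < lambda) (t_poisson : poisson_process P lambda t_).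
Hypotheses (n_iid : iid P n_) (w_ge0 : forall j k x, 0 <= w_ j k x).
Hypothesis w_iid : iid P (fun jk : nat * nat => w_ jk.1 jk.2).
Hypothesis tnw_indep : mutually_independent P (tnth [tuple
       sigma_family t_; sigma_family n_;
       sigma_family (fun jk : nat * nat => w_ jk.1 jk.2)]).
Hypotheses (tau0_ge0 : forall x, 0 <= tau 0%N x)
  (tau_ndecr : forall n x, tau n x <= tau n.+1 x).
Hypothesis Delta_iid : iid P (fun n => renewal_increment tau n.+1).
Hypothesis Delta0_indep : mutually_independent P (tnth [tuple
       sigma_rv (renewal_increment tau 0);
       sigma_family (fun n => renewal_increment tau n.+1)]).
Hypothesis tau_indep : mutually_independent P (tnth [tuple
       sigma_family tau;
       <<s sigma_family t_ `|` sigma_family n_ `|`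
           sigma_family (fun jk : nat * nat => w_ jk.1 jk.2) >>]).

(** [T1] and [T2] are [Omega] with the sigma-algebras of the observation times and of the attacks.
    The hypothesis [tau_indep] is then the rectangle formula required by [independent_fubini] for
    the identity maps. *)
Let T1 := g_sigma_algebraType (\bigcup_i sigma_rv (tau i)).
Let T2 := g_sigma_algebraType (sigma_family t_ `|` sigma_family n_ `|`
           sigma_family (fun jk : nat * nat => w_ jk.1 jk.2)).

Let mtau i : measurable_fun [set: T1] (tau i : T1 -> R).
Proof.
move=> _ B mB; rewrite setTI; apply: sub_sigma_algebra; exists i => //.
exact: sigma_rv_preimage.
Qed.

Let mt k : measurable_fun [set: T2] (t_ k : T2 -> R).
Proof.
move=> _ B mB; rewrite setTI; apply: sub_sigma_algebra; left; left.
by apply: (@sigma_rv_family _ _ _ _ _ (fun k => t_ k : T -> R) k); exact: sigma_rv_preimage.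
Qed.

Let mn k : measurable_fun [set: T2] (n_ k : T2 -> nat).
Proof.
move=> _ B mB; rewrite setTI; apply: sub_sigma_algebra; left; right.
by apply: (@sigma_rv_family _ _ _ _ _ (fun k => n_ k : T -> nat) k); exact: sigma_rv_preimage.
Qed.

Let mw j k : measurable_fun [set: T2] (w_ j k : T2 -> R).
Proof.
move=> _ B mB; rewrite setTI; apply: sub_sigma_algebra; right.
apply: (@sigma_rv_family _ _ _ _ _ (fun jk : nat * nat => w_ jk.1 jk.2 : T -> R) (j, k)).
exact: sigma_rv_preimage.
Qed.

Let mid1 : measurable_fun [set: T] (id : T -> T1).
Proof.
move=> _ B mB; rewrite setTI preimage_id.
by apply: (sigma_family_measurable _ mB) => i; exact: measurable_funPT.
Qed.

Let mid2 : measurable_fun [set: T] (id : T -> T2).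
Proof.
move=> _ B mB; rewrite setTI preimage_id; apply: g_sigma_measurable mB => A [[|]|];
  by apply: sigma_family_measurable => i; exact: measurable_funPT.
Qed.

Lemma renewal_increment_ge0 i x : 0 <= renewal_increment tau i x.
Proof. by case: i => [|i] //=; rewrite subr_ge0. Qed.

Lemma measurable_renewal_increment d' (T' : measurableType d') (s : nat -> T' -> R) i :
  (forall i, measurable_fun setT (s i)) -> measurable_fun setT (renewal_increment s i).
Proof.
move=> ms; case: i => [|i]; first exact: ms.
exact: (measurable_funB (ms i.+1) (ms i)).
Qed.

Definition node_increment i x : nat :=
  mark_sum t_ n_ (observation_interval tau i x) x.

Definition weight_increment i x : R :=
  mark_sum t_ (fun k x => \sum_(j < n_ k x) w_ j k x) (observation_interval tau i x) x.

Lemma measurable_node_increment i : measurable_fun setT (node_increment i).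
Proof.
exact: (measurable_mark_sum_nat (fun k => measurable_funPT (t_ k))
  (fun k => measurable_funPT (tau k)) i (fun k => measurable_funPT (n_ k))).
Qed.

Lemma measurable_weight_increment i : measurable_fun setT (weight_increment i).
Proof.
exact: (measurable_mark_sum_real (fun k => measurable_funPT (t_ k))
  (fun k => measurable_funPT (tau k)) i (fun k =>
    @measurable_attack_weight _ T R n_ w_ k (measurable_funPT (n_ k))
      (fun j => measurable_funPT (w_ j k)))).
Qed.

Lemma weight_increment_ge0 i x : 0 <= weight_increment i x.
Proof. by apply: mark_sum_ge0 => k; exact: sumr_ge0. Qed.

Lemma cabs_laplace_stieltjes (X : T -> R) v : measurable_fun setT X ->
  (forall x, 0 <= X x) -> 0 <= complex.Re v -> cabs (laplace_stieltjes P X v) <= 1.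
Proof.
move=> mX X0 v0; apply: cexpectation_le => [|x].
  apply: cmeas_cexp; apply: cmeasN; apply: cmeasM; first exact: cmeas_cst.
  exact: cmeas_real.
by rewrite cabs_cexp_lin -expR0 ler_expR oppr_le0 mulr_ge0.
Qed.

Lemma cabs_mark_transform z v : cabs z <= 1 -> 0 <= complex.Re v ->
  cabs (mark_transform n_ w_ z v) <= 1.
Proof.
move=> z1 v0; apply: cexpectation_le => [|x].
  by apply: (cmeas_nat_fun (fun m => _ ^+ m)); exact: measurable_funPT.
rewrite cabsX exprn_ile1 ?cabs_ge0// cabsM mulr_ile1 ?cabs_ge0//.
by apply: cabs_laplace_stieltjes => //; exact: measurable_funPT.
Qed.

Section fixed_exponents.
Variables (N : nat) (z v theta : nat -> R[i]).
Hypotheses (z1 : forall i, cabs (z i) <= 1) (v0 : forall i, 0 <= complex.Re (v i)).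
Hypothesis theta0 : forall i, 0 <= complex.Re (theta i).

Let damping x := \prod_(i < N.+1) cexp (- (theta i * (renewal_increment tau i x)%:C)).

Let cabs_damping x : cabs (damping x) <= 1.
Proof.
apply: cabs_prod_le1 => i; rewrite cabs_cexp_lin -expR0 ler_expR oppr_le0.
by rewrite mulr_ge0// renewal_increment_ge0.
Qed.

Let cmeas_damping d' (T' : measurableType d') (s : nat -> T' -> R) :
  (forall i, measurable_fun setT (s i)) ->
  cmeas (fun x => \prod_(i < N.+1) cexp (- (theta i * (renewal_increment s i x)%:C))).
Proof.
move=> ms; apply: cmeas_prod => i; apply: cmeas_cexp; apply: cmeasN.
apply: cmeasM; first exact: cmeas_cst.
by apply: cmeas_real; exact: measurable_renewal_increment.
Qed.

Let H c := [set x | hits (t_ ^~ x) c (tau ^~ x) N].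

Let G i := mark_transform n_ w_ (z i) (v i).

(** With the observation times frozen, the hitting event concerns the attack times alone on a
    deterministic grid: [cexpectation_marks] splits off the marks and [probability_hits] evaluates
    the rest. *)
Lemma cexpectation_hits c :
  cexpectation P (fun x => damping x *
    (\prod_(k < cum c N.+1) mark n_ w_ (z (block c N k)) (v (block c N k)) k x * ind (H c) x)) =
  cexpectation P (fun x => damping x *
    \prod_(i < N.+1) ((poisson_weight (lambda * renewal_increment tau i x) (c i))%:C * G i ^+ c i)).
Proof.
pose K := cum c N.+1; pose b := block c N.
pose D : set (T1 * T2) := [set p | hits (t_ ^~ p.2) c (tau ^~ p.1) N].
pose F (p : T1 * T2) := damping p.1 *
  (\prod_(k < K) mark n_ w_ (z (b k)) (v (b k)) k p.2 * ind D p).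
have mm k : cmeas (fun x : T2 => mark n_ w_ (z (b k)) (v (b k)) k x).
  apply: (@cmeas_index _ T2 R (n_ k) (fun m x => \prod_(j < m) (z (b k) * cexp (- (v (b k) * (w_ j k x)%:C)))) (@mn k)) => m.
  apply: cmeas_prod => j; apply: cmeasM; first exact: cmeas_cst.
  apply: cmeas_cexp; apply: cmeasN; apply: cmeasM; first exact: cmeas_cst.
  exact: cmeas_real.
have mF : cmeas F.
  apply: cmeasM; first exact: (cmeas_comp (cmeas_damping mtau) measurable_fst).
  apply: cmeasM.
    by apply: cmeas_prod => k; exact: (cmeas_comp (mm k) measurable_snd).
  apply: cmeas_ind; apply: measurable_hits_random => [k|i].
    exact: (measurableT_comp (mt k) measurable_snd).
  exact: (measurableT_comp (mtau i) measurable_fst).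
have F1 p : cabs (F p) <= 1.
  rewrite /F !cabsM mulr_ile1 ?mulr_ge0 ?cabs_ge0 ?cabs_damping// mulr_ile1 ?cabs_ge0 ?cabs_ind//.
  by apply: cabs_prod_le1 => k; exact: cabs_mark.
have -> := independent_fubini mid1 mid2 _ mF F1; last first.
  by move=> A B mA mB; exact: (mutually_independent_pair tau_indep).
congr cexpectation; apply/funext => x; rewrite /F/=.
pose A := [set y | hits (t_ ^~ y) c (tau ^~ x) N].
have FA : sigma_family t_ A.
  apply: (@measurable_hits_random _ (g_sigma_algebraType (\bigcup_k sigma_rv (t_ k))) R
    (fun k => t_ k) (fun i _ => tau i x)) => [k _ B mB|i].
    rewrite setTI; apply: (sigma_rv_family (X := fun k => t_ k : T -> R) (i := k)).
    exact: sigma_rv_preimage.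
  exact: measurable_cst.
have Ftm : sigma_family t_ `<=` measurable.
  by apply: sigma_family_measurable => k; exact: measurable_funPT.
rewrite /cexpectation cintegralZ; last first.
  apply: (bounded_cintegrable _ (C := 1)) => [|y].
    apply: (@cmeasM _ _ _ _ (ind A)); last by apply: cmeas_ind; exact: Ftm.
    by apply: cmeas_prod => k; exact: (cmeas_comp (mm k) mid2).
  rewrite cabsM mulr_ile1 ?cabs_ge0 ?cabs_ind// cabs_prod_le1// => k.
  exact: cabs_mark.
congr (_ * _).
transitivity (cexpectation P (fun y =>
  \prod_(k < K) mark n_ w_ (z (b k)) (v (b k)) k y * ind A y)).
  by [].
rewrite (cexpectation_marks n_iid w_ge0 w_iid Ftm _ K FA (fun k => z1 (b k)) (fun k => v0 (b k))); last first.
  by move=> B1 B2 B3 *; exact: (mutually_independent_triple tnw_indep).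
rewrite (probability_hits lambda_gt0 t_poisson)//; last exact/nondecreasing_seqP.
rewrite (prod_blocks (fun i k => mark_transform n_ w_ (z i) (v i)) c (leqnn N.+1)).
rewrite rmorph_prod -big_split; apply: eq_bigr => i _ /=.
rewrite mulrC; congr (_ * _).
by rewrite prodr_const_nat cumS addKn.
Qed.

Definition weighted_marks x := \prod_(i < N.+1) (z i ^+ node_increment i x *
  cexp (- (v i * (weight_increment i x)%:C)) *
  cexp (- (theta i * (renewal_increment tau i x)%:C))).

Let weighted_marks_hits c x : H c x -> weighted_marks x = damping x *
  \prod_(k < cum c N.+1) mark n_ w_ (z (block c N k)) (v (block c N k)) k x.
Proof.
move=> Hx; rewrite /weighted_marks big_split/= mulrC; congr (_ * _).
rewrite (prod_blocks (fun i k => mark n_ w_ (z i) (v i) k x) c (leqnn N.+1)).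
have t0 k : 0 <= t_ k x.
  have [t0 tS _ _ _] := t_poisson.
  by apply: (le_trans (t0 x)); exact: (@u_leq _ (t_ ^~ x)).
apply: eq_bigr => i _; have iN : (i <= N)%N by rewrite -ltnS.
rewrite /node_increment /weight_increment !(mark_sum_hits _ t0 Hx iN).
under [RHS]eq_bigr do rewrite markE.
rewrite big_split/= -expr_sum -cexp_sum; congr (_ * cexp _).
by rewrite rmorph_sum mulr_sumr sumrN.
Qed.

Lemma cabs_weighted_marks x : cabs (weighted_marks x) <= 1.
Proof.
apply: cabs_prod_le1 => i; rewrite cabsM mulr_ile1 ?cabs_ge0//; last first.
  by apply: cabs_cexp_le1; rewrite ReN ReM/= mulr0 subr0 oppr_le0 mulr_ge0// renewal_increment_ge0.
rewrite cabsM mulr_ile1 ?cabs_ge0//.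
  by rewrite cabsX exprn_ile1 ?cabs_ge0.
by apply: cabs_cexp_le1; rewrite ReN ReM/= mulr0 subr0 oppr_le0 mulr_ge0// weight_increment_ge0.
Qed.

Lemma cmeas_weighted_marks : cmeas weighted_marks.
Proof.
apply: cmeas_prod => i; apply: cmeasM; first apply: cmeasM.
- by apply: (cmeas_nat_fun (fun m => z i ^+ m)); exact: measurable_node_increment.
- apply: cmeas_cexp; apply: cmeasN; apply: cmeasM; first exact: cmeas_cst.
  by apply: cmeas_real; exact: measurable_weight_increment.
- apply: cmeas_cexp; apply: cmeasN; apply: cmeasM; first exact: cmeas_cst.
  apply: cmeas_real; apply: (@measurable_renewal_increment _ T tau) => j.
  exact: measurable_funPT.
Qed.

(* Different count vectors give disjoint events, so this is the indicator that
   all counts are less than Q. *)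
Definition bounded_hits Q x : R[i] := \sum_(f : {ffun 'I_N.+1 -> 'I_Q})
  ind [set x | hits (t_ ^~ x) (extend_ffun f) (tau ^~ x) N] x.

Lemma bounded_hits01 Q x : bounded_hits Q x = 0 \/ bounded_hits Q x = 1.
Proof.
have [[f Hf]|nf] := pselect (exists f : {ffun 'I_N.+1 -> 'I_Q}, H (extend_ffun f) x); [right|left].
  rewrite /bounded_hits (bigD1 f)//= /ind mem_set// big1 ?addr0// => f' ff'.
  rewrite memNset// => Hf'; move/eqP : ff'; apply; apply/ffunP => i; apply: val_inj.
  by rewrite /= -!extend_ffunE; apply: (hits_uniq Hf' Hf); rewrite -ltnS.
by rewrite /bounded_hits big1// => f _; rewrite /ind memNset// => Hf; apply: nf; exists f.
Qed.

Let mH c : measurable (H c).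
Proof.
by apply: (@measurable_hits_random _ T R t_ tau) => k; exact: measurable_funPT.
Qed.

Lemma cmeas_bounded_hits Q : cmeas (bounded_hits Q).
Proof. by apply: cmeas_sum => f; apply: cmeas_ind; exact: (mH (extend_ffun f)). Qed.

Let lambda_gap_ge0 i x : 0 <= lambda * renewal_increment tau i x.
Proof. by rewrite mulr_ge0 ?renewal_increment_ge0// ltW. Qed.

Let cabs_G i : cabs (G i) <= 1.
Proof. exact: cabs_mark_transform. Qed.

Let cmeas_term i m : cmeas (fun x : T =>
  (poisson_weight (lambda * renewal_increment tau i x) m)%:C * G i ^+ m).
Proof.
apply: cmeasM; last exact: cmeas_cst.
apply: cmeas_real; apply: (measurableT_comp (measurable_poisson_weight m)).
apply: measurable_funM; first exact: measurable_cst.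
by apply: (@measurable_renewal_increment _ T tau) => j; exact: measurable_funPT.
Qed.

Let cexpectation_bounded_hits Q :
  cexpectation P (fun x => weighted_marks x * bounded_hits Q x) =
  cexpectation P (fun x => damping x * \prod_(i < N.+1) \sum_(m < Q)
    ((poisson_weight (lambda * renewal_increment tau i x) m)%:C * G i ^+ m)).
Proof.
under eq_fun do rewrite mulr_sumr.
under [in RHS]eq_fun do rewrite bigA_distr_bigA mulr_sumr.
rewrite /cexpectation !cintegral_sum; first last.
- move=> f; apply: (bounded_cintegrable _ (C := 1)) => [|x].
    apply: cmeasM; first exact: cmeas_weighted_marks.
    by apply: cmeas_ind; exact: (mH (extend_ffun f)).
  by rewrite cabsM mulr_ile1 ?cabs_ge0 ?cabs_ind ?cabs_weighted_marks.
- move=> f; apply: (bounded_cintegrable _ (C := 1)) => [|x].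
    apply: cmeasM; first exact: (cmeas_damping (s := tau)).
    by apply: cmeas_prod => i; apply: cmeas_term.
  rewrite cabsM mulr_ile1 ?cabs_ge0// cabs_prod_le1// => i.
  rewrite cabsM cabs_real cabsX ger0_norm ?poisson_weight_ge0//.
  by rewrite mulr_ile1 ?exprn_ge0 ?cabs_ge0 ?poisson_weight_ge0 ?poisson_weight_le1 ?exprn_ile1 ?cabs_ge0.
apply: eq_bigr => f _.
transitivity (cexpectation P (fun x => damping x *
    (\prod_(k < cum (extend_ffun f) N.+1) mark n_ w_ (z (block (extend_ffun f) N k)) (v (block (extend_ffun f) N k)) k x * ind (H (extend_ffun f)) x))).
  congr cintegral; apply/funext => x; rewrite /ind mulrA.
  have [/set_mem Hx|_] := boolP (x \in H (extend_ffun f)); last by rewrite !mulr0.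
  by rewrite (weighted_marks_hits Hx).
rewrite cexpectation_hits; congr cintegral; apply/funext => x; congr (_ * _).
by apply: eq_bigr => i _; rewrite extend_ffunE.
Qed.

(** Counts below [Q] can be summed separately in each interval, and each sum tends to a Poisson
    generating function. The limit involves only the observation increments. *)
Lemma weighted_marks_ccvg :
  ccvg (fun Q => cexpectation P (fun x => weighted_marks x * bounded_hits Q x))
    (cexpectation P (fun x => \prod_(i < N.+1)
      cexp (- ((theta i + lambda%:C - lambda%:C * G i) * (renewal_increment tau i x)%:C)))).
Proof.
under eq_fun do rewrite cexpectation_bounded_hits.
apply: (cexpectation_cvg _ (C := 1)) => [Q|Q x|x].
- apply: cmeasM; first exact: (cmeas_damping (s := tau)).
  by apply: cmeas_prod => i; apply: cmeas_sum => m; exact: cmeas_term.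
- rewrite cabsM mulr_ile1 ?cabs_ge0// cabs_prod_le1// => i.
  exact: cabs_sum_poisson_weight_le1.
- apply: (@eq_ccvg _ (fun Q => \prod_(i < N.+1) (cexp (- (theta i * (renewal_increment tau i x)%:C)) *
    \sum_(m < Q) ((poisson_weight (lambda * renewal_increment tau i x) m)%:C * G i ^+ m)))) => [Q|].
    by rewrite big_split.
  apply: ccvg_prod => i.
  have -> : - ((theta i + lambda%:C - lambda%:C * G i) * (renewal_increment tau i x)%:C) =
    - (theta i * (renewal_increment tau i x)%:C) +
    - ((lambda * renewal_increment tau i x)%:C - (lambda * renewal_increment tau i x)%:C * G i).
    by rewrite rmorphM; ring.
  by rewrite cexpD; apply: ccvgM; [exact: ccvg_cst|exact: sum_poisson_weight_ccvg].
Qed.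


End fixed_exponents.

(** With z = 1 and v = theta = 0 the weighted marks are 1 and so is the limit just computed. This
    proves that almost surely some vector of finite counts occurs. *)
Lemma bounded_hits_ccvg N : ccvg (fun Q => cexpectation P (bounded_hits N Q)) 1.
Proof.
have c1 (i : nat) : cabs (1 : R[i]) <= 1 by rewrite cabs1 lexx.
have r0 (i : nat) : 0 <= complex.Re (0 : R[i]) by rewrite lexx.
have G1 : mark_transform n_ w_ 1 0 = 1 :> R[i].
  have l0 : laplace_stieltjes P (w_ 0%N 0%N) 0 = 1 :> R[i].
    rewrite -(cexpectation_cst P 1); congr cexpectation; apply/funext => x.
    by rewrite mul0r oppr0 cexp0.
  rewrite /mark_transform l0 mulr1 -(cexpectation_cst P 1); congr cexpectation.
  by apply/funext => x; rewrite cexpectation_cst expr1n.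
have := weighted_marks_ccvg N c1 r0 r0.
have -> : (fun x => \prod_(i < N.+1) cexp (- ((0 + lambda%:C - lambda%:C * mark_transform n_ w_ 1 0) *
    (renewal_increment tau i x)%:C))) = fun=> 1.
  by apply/funext => x; apply: big1 => i _; rewrite G1 add0r mulr1 subrr mul0r oppr0 cexp0.
rewrite cexpectation_cst; apply: eq_ccvg => Q; congr cexpectation; apply/funext => x.
rewrite /weighted_marks big1 ?mul1r// => i _.
by rewrite expr1n !mul0r oppr0 cexp0 !mulr1.
Qed.

(** Dropping the restriction to bounded counts costs at most the probability of its failure, as the
    weighted marks have modulus at most 1. *)
Lemma cexpectation_weighted_marks N z v theta :
  (forall i, cabs (z i) <= 1) -> (forall i, 0 <= complex.Re (v i)) ->
  (forall i, 0 <= complex.Re (theta i)) ->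
  cexpectation P (weighted_marks N z v theta) =
  cexpectation P (fun x => \prod_(i < N.+1)
      cexp (- ((theta i + lambda%:C - lambda%:C * mark_transform n_ w_ (z i) (v i)) *
        (renewal_increment tau i x)%:C))).
Proof.
move=> z1 v0 theta0; apply: ccvg_unique (weighted_marks_ccvg N z1 v0 theta0).
set J := weighted_marks _ _ _ _.
have iV Q : cintegrable P setT (bounded_hits N Q).
  apply: (bounded_cintegrable _ (C := 1)) => [|x]; first exact: cmeas_bounded_hits.
  by have [->|->] := bounded_hits01 N Q x; rewrite ?cabs0 ?cabs1.
have J1 x : cabs (J x) <= 1 by exact: cabs_weighted_marks.
have mJ : cmeas J by exact: cmeas_weighted_marks.
apply: (ccvg_squeeze (e := fun Q => 1 - complex.Re (cexpectation P (bounded_hits N Q)))).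
  apply: nearW => Q.
  have -> : cexpectation P (fun x => J x * bounded_hits N Q x) - cexpectation P J =
    cexpectation P (fun x => J x * (bounded_hits N Q x - 1)).
    rewrite /cexpectation -cintegralB//; last by apply: (bounded_cintegrable _ (C := 1)).
      by congr cintegral; apply/funext => x; rewrite mulrBr mulr1.
    apply: (bounded_cintegrable _ (C := 1)) => [|x].
      by apply: cmeasM => //; exact: cmeas_bounded_hits.
    have [->|->] := bounded_hits01 N Q x; first by rewrite mulr0 cabs0 ler01.
    by rewrite mulr1.
  have mV : measurable_fun setT (fun x => complex.Re (bounded_hits N Q x)).
    by have [] := cmeas_bounded_hits N Q.
  have V1 x : cabs (J x * (bounded_hits N Q x - 1)) <= complex.Re (1 - bounded_hits N Q x).
    rewrite cabsM; have [->|->] := bounded_hits01 N Q x.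
      by rewrite sub0r cabsN cabs1 mulr1 subr0.
    by rewrite subrr cabs0 mulr0 lexx.
  have i1 : cintegrable P setT (fun=> 1 : R[i]).
    by apply: (bounded_cintegrable _ (C := 1)) => [|x]; [exact: cmeas_cst|rewrite cabs1 lexx].
  have [iV1 _] := cintegrableB i1 (iV Q).
  have -> : 1 - complex.Re (cexpectation P (bounded_hits N Q)) =
      complex.Re (cexpectation P (fun x => 1 - bounded_hits N Q x)).
    rewrite /cexpectation cintegralB// ReB; congr (_ - _).
    by rewrite -/(cexpectation P (fun=> 1)) cexpectation_cst.
  apply: (cabs_cintegral_le _ iV1 V1).
  apply: (bounded_cintegrable _ (C := 1)) => [|x].
    by apply: cmeasM => //; apply: cmeasB; [exact: cmeas_bounded_hits|exact: cmeas_cst].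
  apply: (le_trans (V1 x)); have [->|->] := bounded_hits01 N Q x; first by rewrite subr0.
  by rewrite subrr ler01.
have [h _] := bounded_hits_ccvg N.
by rewrite -(subrr (1 : R)); apply: cvgB; [exact: cvg_cst|].
Qed.

Let mDelta i : measurable_fun [set: T] (renewal_increment tau i).
Proof.
by apply: (@measurable_renewal_increment _ T tau) => j; exact: measurable_funPT.
Qed.

Let cmeas_exp_real eta : cmeas (fun y : R => cexp (- (eta * y%:C))).
Proof.
apply: cmeas_cexp; apply: cmeasN; apply: cmeasM; first exact: cmeas_cst.
exact: cmeas_real.
Qed.

Lemma cexpectation_renewal_increments N (eta : nat -> R[i]) : (forall i, 0 <= complex.Re (eta i)) ->
  cexpectation P (fun x => \prod_(i < N.+1) cexp (- (eta i * (renewal_increment tau i x)%:C))) =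
  laplace_stieltjes P (renewal_increment tau 0) (eta 0%N) *
  \prod_(i < N) laplace_stieltjes P (renewal_increment tau 1) (eta i.+1).
Proof.
move=> eta0; pose Z i x := cexp (- (eta i * (renewal_increment tau i x)%:C)).
have Z1 i x : cabs (Z i x) <= 1.
  by rewrite cabs_cexp_lin -expR0 ler_expR oppr_le0 mulr_ge0// renewal_increment_ge0.
have mZ i : cmeas (Z i) by exact: (cmeas_comp (cmeas_exp_real (eta i)) (mDelta i)).
have FZ i : measurable_wrt (sigma_rv (renewal_increment tau i)) (Z i).
  exact: (measurable_wrt_comp _ (cmeas_exp_real (eta i))).
have Fm i : sigma_rv (renewal_increment tau i) `<=` measurable.
  exact: sigma_rv_measurable.
pose F i := sigma_rv (renewal_increment tau i.+1).
(* Independence among the later increments and independence of [Delta_0] from their whole family are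
   two hypotheses; they are combined here, with [Z 0%N] as the variable kept outside. *)
have factor (s : seq nat) (A : nat -> set T) : uniq s -> (forall i, i \in s -> F i (A i)) ->
    cexpectation P (fun x => \prod_(i <- s) ind (A i) x * Z 0%N x) =
    \prod_(i <- s) (fine (P (A i)))%:C * cexpectation P (Z 0%N).
  move=> us FA; pose B := \bigcap_(i in [set` s]) A i.
  have FB : sigma_family (fun n => renewal_increment tau n.+1) B.
    apply: g_sigma_bigcap_seq => i /FA.
    exact: (sigma_rv_family (X := fun n => renewal_increment tau n.+1)).
  have mB : measurable B.
    by apply: (sigma_family_measurable _ FB) => i; exact: mDelta.
  rewrite -(cexpectation_prod_ind Delta_iid.1 _ us FA); last by move=> i; exact: Fm.
  have E : (fun x => \prod_(i <- s) ind (A i) x) = ind B :> (T -> R[i]).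
    by apply/funext => x; rewrite prod_ind.
  rewrite E mulrC -(@cexpectation_factor _ _ _ _ _ (ind B) 1 (Fm 0%N) _ _ _ (Z 0%N) 1 (FZ 0%N) (Z1 0%N)).
  - by congr cexpectation; apply/funext => x; rewrite -E mulrC.
  - exact: cmeas_ind.
  - by move=> x; exact: cabs_ind.
  - move=> A0 FA0; have mA0 := Fm _ _ FA0.
    have -> : (fun x => ind A0 x * ind B x) = ind (A0 `&` B) :> (T -> R[i]).
      by apply/funext => x; rewrite indI.
    rewrite !cexpectation_ind//; last exact: measurableI.
    rewrite (mutually_independent_pair Delta0_indep FA0 FB) -rmorphM; congr (_%:C).
    by rewrite fineM ?fin_num_measure.
have := cexpectation_factor_prod (fun i => Fm i.+1) (mZ 0%N) (Z1 0%N) factor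
  (iota_uniq 0 N) (fun i => FZ i.+1) (fun i => Z1 i.+1).
have E (f : nat -> R[i]) : \prod_(i <- iota 0 N) f i = \prod_(i < N) f i.
  by rewrite -(big_mkord xpredT f) /index_iota subn0.
rewrite E => H; transitivity (cexpectation P (fun x => \prod_(i <- iota 0 N) Z i.+1 x * Z 0%N x)).
  congr cexpectation; apply/funext => x; rewrite big_ord_recl mulrC E; congr (_ * _).
rewrite {}H mulrC; congr (_ * _); apply: eq_bigr => i _.
(* The absolute value makes the test function bounded on the whole line. *)
pose f (y : R) := cexp (- (eta i.+1 * `|y|%:C)).
have fE k x : cexp (- (eta i.+1 * (renewal_increment tau k x)%:C)) = f (renewal_increment tau k x).
  by rewrite /f ger0_norm// renewal_increment_ge0.
rewrite /laplace_stieltjes /Z; under eq_fun do rewrite fE; under [in RHS]eq_fun do rewrite fE.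
apply: (identically_distributed_cexpectation (C := 1)) => //.
- exact: (Delta_iid.2 i 0%N).
- exact: (cmeas_comp (cmeas_exp_real _) (@normr_measurable R setT)).
- by move=> y; rewrite cabs_cexp_lin -expR0 ler_expR oppr_le0 mulr_ge0.
Qed.

Definition increment_transform i z v theta :=
  laplace_stieltjes P (renewal_increment tau i)
    (theta + lambda%:C - lambda%:C * mark_transform n_ w_ z v).

Lemma Re_exponent_ge0 z v theta : cabs z <= 1 -> 0 <= complex.Re v ->
  0 <= complex.Re theta ->
  0 <= complex.Re (theta + lambda%:C - lambda%:C * mark_transform n_ w_ z v).
Proof.
move=> z1 v0 theta0; rewrite ReB ReD ReM/= mul0r subr0 -addrA addr_ge0//.
rewrite subr_ge0 ler_piMr ?(ltW lambda_gt0)//.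
exact: (le_trans (le_trans (ler_norm _) (Re_le_cabs _)) (cabs_mark_transform z1 v0)).
Qed.

Lemma joint_transform N z v theta :
  (forall i, cabs (z i) <= 1) -> (forall i, 0 <= complex.Re (v i)) ->
  (forall i, 0 <= complex.Re (theta i)) ->
  cexpectation P (weighted_marks N z v theta) =
  increment_transform 0 (z 0%N) (v 0%N) (theta 0%N) *
  \prod_(i < N) increment_transform 1 (z i.+1) (v i.+1) (theta i.+1).
Proof.
move=> z1 v0 theta0; rewrite cexpectation_weighted_marks//.
rewrite (cexpectation_renewal_increments N
  (eta := fun i => theta i + lambda%:C - lambda%:C * mark_transform n_ w_ (z i) (v i)))// => i.
exact: Re_exponent_ge0.
Qed.

End joint_transform.

(** * The exit functional *)

Lemma ccvg_unshift (R : realType) (u : nat -> R[i]) l :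
  ccvg (fun n => u n.+1) l -> ccvg u l.
Proof.
move=> [l1 l2]; split.
  by rewrite -(cvg_shiftS (fun n => complex.Re (u n))).
by rewrite -(cvg_shiftS (fun n => complex.Im (u n))).
Qed.

Section threshold_sums.
Context {R : realType}.

Lemma admissible0 : @admissible R 0 (fun p q s => 0).
Proof. by move=> p q; split; [exact: cmeas_cst|move=> s; rewrite cabs0]. Qed.

Lemma admissible_sum (I : Type) (r : seq I) (C : I -> R)
    (Phi : I -> nat -> nat -> measurableTypeR R -> R[i]) :
  (forall i, admissible (C i) (Phi i)) ->
  admissible (\sum_(i <- r) C i) (fun p q s => \sum_(i <- r) Phi i p q s).
Proof.
move=> aPhi p q; split => [|s].
  by apply: (@cmeas_sum _ (measurableTypeR R) R I r (fun i => Phi i p q)) => i; exact: (aPhi i p q).1.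
by apply: (le_trans (cabs_sum _ _ _)); apply: ler_sum => i _; exact: (aPhi i p q).2.
Qed.

Lemma threshold_transform_sum (I : Type) (r : seq I) (C : I -> R)
    (Phi : I -> nat -> nat -> measurableTypeR R -> R[i]) x y w :
  cabs x < 1 -> cabs y < 1 -> 0 < complex.Re w ->
  (forall i, admissible (C i) (Phi i)) ->
  threshold_transform (fun p q s => \sum_(i <- r) Phi i p q s) x y w =
  \sum_(i <- r) threshold_transform (Phi i) x y w.
Proof.
move=> x1 y1 w0 aPhi; elim: r => [|i r IH].
  rewrite big_nil -[RHS](mul0r (threshold_transform (fun _ _ _ => 0) x y w)).
  rewrite -(threshold_transformZ x1 y1 w0 0 admissible0).
  by apply: eq_threshold_transform => p q s; rewrite big_nil mul0r.
rewrite big_cons -IH -(threshold_transformD x1 y1 w0 (aPhi i) (admissible_sum r aPhi)).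
by apply: eq_threshold_transform => p q s; rewrite big_cons.
Qed.

End threshold_sums.

Section index_comparisons.
Variables (i j m : nat) (e1 e2 : bool).
Let k := (j.+1 + m)%N.

(** This lemma and the next four decide to which partial sums increment [i] contributes, when mu_1 =
    j and rho = k: there are the cases i < j, i = j, j < i < k and i = k. The booleans tell whether
    a threshold index is advanced by one. *)
Lemma index_bounds : [/\ (j < k)%N, (j + e1 <= k.+1)%N & (k + e2 <= k.+1)%N].
Proof. by rewrite /k; case: e1; case: e2; split; lia. Qed.

Lemma index_before : (i < j)%N -> [/\ (i < j.+1)%N, (i < k)%N, (i < k.+1)%N,
  (i < j + e1)%N & (i < k + e2)%N].
Proof. by rewrite /k => ij; split; lia. Qed.

Lemma index_passage : [/\ (j < j)%N = false, (j < j.+1)%N, (j < k)%N, (j < k.+1)%N &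
  (j < j + e1)%N = e1] /\ (j < k + e2)%N.
Proof. by rewrite /k; case: e1; do ?split; lia. Qed.

Lemma index_between : (i < m)%N -> [/\ (j.+1 + i < j)%N = false,
  (j.+1 + i < j.+1)%N = false, (j.+1 + i < k)%N, (j.+1 + i < k.+1)%N &
  (j.+1 + i < j + e1)%N = false] /\ (j.+1 + i < k + e2)%N.
Proof. by rewrite /k => im; case: e1; do ?split; lia. Qed.

Lemma index_exit : [/\ (k < j)%N = false, (k < j.+1)%N = false, (k < k)%N = false,
  (k < k.+1)%N & (k < j + e1)%N = false] /\ (k < k + e2)%N = e2.
Proof. by rewrite /k; case: e1; case: e2; do ?split; lia. Qed.

End index_comparisons.

(** * First passage and exit for abstract nonnegative increments *)

Section exit_time.
Context d (T : measurableType d) {R : realType} (P : probability T R).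
Variables (a : nat -> T -> nat) (b c : nat -> T -> R).
Hypotheses (ma : forall i, measurable_fun setT (a i)).
Hypotheses (mb : forall i, measurable_fun setT (b i)) (b0 : forall i x, 0 <= b i x).
Hypotheses (mc : forall i, measurable_fun setT (c i)) (c0 : forall i x, 0 <= c i x).
Variables gamma0 gamma : R[i] -> R[i] -> R[i] -> R[i].
Variables u0 u alpha0 alpha v0 v beta0 beta theta0 theta h0 h : R[i].
Hypotheses (u0_le1 : cabs u0 <= 1) (u_le1 : cabs u <= 1).
Hypotheses (alpha0_le1 : cabs alpha0 <= 1) (alpha_le1 : cabs alpha <= 1).
Hypotheses (v0_ge0 : 0 <= complex.Re v0) (v_ge0 : 0 <= complex.Re v).
Hypotheses (beta0_ge0 : 0 <= complex.Re beta0) (beta_ge0 : 0 <= complex.Re beta).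
Hypotheses (theta0_ge0 : 0 <= complex.Re theta0) (theta_ge0 : 0 <= complex.Re theta).
Hypotheses (h0_ge0 : 0 <= complex.Re h0) (h_ge0 : 0 <= complex.Re h).

(* With a, b, c the increments of N, W and tau, [partial_sum a k] is N_(k-1). *)
Definition partial_sum (U : nmodType) (f : nat -> T -> U) k x := \sum_(i < k) f i x.

Local Notation SN := (partial_sum a).
Local Notation SW := (partial_sum b).
Local Notation ST := (partial_sum c).

Lemma partial_sumS (U : nmodType) (f : nat -> T -> U) k x :
  partial_sum f k.+1 x = partial_sum f k x + f k x.
Proof. exact: big_ord_recr. Qed.

Lemma partial_sum0 (U : nmodType) (f : nat -> T -> U) x : partial_sum f 0 x = 0.
Proof. exact: big_ord0. Qed.

Lemma partial_sum_leq k k' x : (k <= k')%N -> (SN k x <= SN k' x)%N.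
Proof.
move=> kk'; rewrite -(subnK kk'); elim: (k' - k)%N => [//|n IH].
by rewrite addSn partial_sumS (leq_trans IH)// leq_addr.
Qed.

Lemma partial_sum_le k k' x : (k <= k')%N -> SW k x <= SW k' x.
Proof.
move=> kk'; rewrite -(subnK kk'); elim: (k' - k)%N => [//|n IH].
by rewrite addSn partial_sumS (le_trans IH)// lerDl.
Qed.

Lemma partial_sum_ge0 (f : nat -> T -> R) k x : (forall i x, 0 <= f i x) -> 0 <= partial_sum f k x.
Proof. by move=> f0; apply: sumr_ge0. Qed.

Lemma measurable_partial_sum (f : nat -> T -> R) k :
  (forall i, measurable_fun setT (f i)) -> measurable_fun setT (partial_sum f k).
Proof. by move=> mf; exact: measurable_sum. Qed.

Lemma measurable_partial_sum_nat k : measurable_fun setT (SN k).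
Proof.
apply: (measurable_fun_natr (R := R)); rewrite /partial_sum.
under eq_fun do rewrite natr_sum.
apply: measurable_sum => i.
have mnat : measurable_fun setT (fun m : nat => m%:R : R) by [].
exact: (measurableT_comp mnat (ma i)).
Qed.

Definition stay q s k x := (SN k x <= q)%N && (SW k x <= s)%R.

Lemma stay_leq q s k k' x : (k <= k')%N -> stay q s k' x -> stay q s k x.
Proof.
move=> kk' /andP[h1 h2]; apply/andP; split.
  exact: leq_trans (partial_sum_leq _ kk') h1.
exact: le_trans (partial_sum_le _ kk') h2.
Qed.

(* The events mu_1 = j (for the threshold p) and rho = k (for q and s). *)
Definition first_passage p j x := (SN j x <= p)%N && (p < SN j.+1 x)%N.
Definition first_exit q s k x := stay q s k x && ~~ stay q s k.+1 x.

Lemma first_passage_uniq p j j' x : first_passage p j x -> first_passage p j' x -> j = j'.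
Proof.
move=> /andP[h1 h2] /andP[h1' h2']; apply/eqP; rewrite eqn_leq; apply/andP; split.
  rewrite leqNgt; apply/negP => /(partial_sum_leq x) /leq_trans/(_ h1).
  by rewrite leqNgt h2'.
rewrite leqNgt; apply/negP => /(partial_sum_leq x) /leq_trans/(_ h1').
by rewrite leqNgt h2.
Qed.

Lemma first_exit_uniq q s k k' x : first_exit q s k x -> first_exit q s k' x -> k = k'.
Proof.
move=> /andP[h1 /negP h2] /andP[h1' /negP h2']; apply/eqP; rewrite eqn_leq; apply/andP; split.
  by rewrite leqNgt; apply/negP => kk'; apply: h2'; exact: stay_leq h1.
by rewrite leqNgt; apply/negP => kk'; apply: h2; exact: stay_leq h1'.
Qed.

Definition weight j k x : R[i] :=
  u0 ^+ SN j x * u ^+ SN j.+1 x * alpha0 ^+ SN k x * alpha ^+ SN k.+1 x *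
  cexp (- (v0 * (SW j x)%:C) - v * (SW j.+1 x)%:C
        - beta0 * (SW k x)%:C - beta * (SW k.+1 x)%:C) *
  cexp (- (theta0 * (ST j x)%:C) - theta * (ST j.+1 x)%:C
        - h0 * (ST k x)%:C - h * (ST k.+1 x)%:C).

Lemma expr_partial_sum (z : R[i]) n N x : (n <= N)%N ->
  z ^+ SN n x = \prod_(i < N) (z ^+ (i < n)%N) ^+ a i x.
Proof.
move=> nN; rewrite /partial_sum expr_sum (big_ord_widen _ (fun i => z ^+ a i x) nN) big_mkcond.
by apply: eq_bigr => i _; case: (i < n)%N; rewrite ?expr1 ?expr0 ?expr1n.
Qed.

Lemma cexp_partial_sum (f : nat -> T -> R) (z : R[i]) n N x : (n <= N)%N ->
  cexp (- (z * (partial_sum f n x)%:C)) =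
  \prod_(i < N) cexp (- (z * (i < n)%N%:R * (f i x)%:C)).
Proof.
move=> nN; rewrite /partial_sum rmorph_sum mulr_sumr -sumrN cexp_sum.
rewrite (big_ord_widen _ (fun i => cexp (- (z * (f i x)%:C))) nN) big_mkcond.
apply: eq_bigr => i _; case: (i < n)%N; rewrite ?mulr1// mulr0 mul0r oppr0 cexp0//.
Qed.

(* The exponents carried by the i-th increment in
   weight j k * x ^ N_(j'-1) * y ^ N_(k'-1) * exp (- w W_(k'-1)). *)
Definition zfactor j k j' k' (x y : R[i]) i : R[i] :=
  u0 ^+ (i < j)%N * u ^+ (i < j.+1)%N * alpha0 ^+ (i < k)%N * alpha ^+ (i < k.+1)%N *
  x ^+ (i < j')%N * y ^+ (i < k')%N.

Definition vfactor j k k' (w : R[i]) i : R[i] :=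
  v0 * (i < j)%N%:R + v * (i < j.+1)%N%:R + beta0 * (i < k)%N%:R +
  beta * (i < k.+1)%N%:R + w * (i < k')%N%:R.

Definition tfactor j k i : R[i] :=
  theta0 * (i < j)%N%:R + theta * (i < j.+1)%N%:R + h0 * (i < k)%N%:R +
  h * (i < k.+1)%N%:R.

(** Each partial sum is spread over all increments up to [k] with exponents 0 or 1; this product
    over increments is the shape that [joint_transform] evaluates. *)
Lemma weight_prod j k j' k' (x y w : R[i]) o :
  (j < k)%N -> (j' <= k.+1)%N -> (k' <= k.+1)%N ->
  weight j k o * x ^+ SN j' o * y ^+ SN k' o * cexp (- (w * (SW k' o)%:C)) =
  \prod_(i < k.+1) (zfactor j k j' k' x y i ^+ a i o *
    cexp (- (vfactor j k k' w i * (b i o)%:C)) *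
    cexp (- (tfactor j k i * (c i o)%:C))).
Proof.
move=> jk j'k k'k; have jk' : (j <= k.+1)%N by rewrite leqW// ltnW.
have k'' : (j.+1 <= k.+1)%N by rewrite leqW.
have kk := leqnSn k.
have E (f : nat -> T -> R) (z1 z2 z3 z4 : R[i]) :
    cexp (- (z1 * (partial_sum f j o)%:C) - z2 * (partial_sum f j.+1 o)%:C
      - z3 * (partial_sum f k o)%:C - z4 * (partial_sum f k.+1 o)%:C) =
    \prod_(i < k.+1) cexp (- ((z1 * (i < j)%N%:R + z2 * (i < j.+1)%N%:R +
      z3 * (i < k)%N%:R + z4 * (i < k.+1)%N%:R) * (f i o)%:C)).
  rewrite !cexpD (cexp_partial_sum _ _ _ jk') (cexp_partial_sum _ _ _ k'').
  rewrite (cexp_partial_sum _ _ _ kk) (cexp_partial_sum _ _ _ (leqnn k.+1)) -!big_split.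
  by apply: eq_bigr => i _ /=; rewrite -!cexpD !mulrDl !opprD.
rewrite /weight !E (expr_partial_sum u0 _ jk') (expr_partial_sum u _ k'').
rewrite (expr_partial_sum alpha0 _ kk) (expr_partial_sum alpha _ (leqnn k.+1)).
rewrite (expr_partial_sum x _ j'k) (expr_partial_sum y _ k'k) (cexp_partial_sum b w _ k'k).
rewrite -!big_split; apply: eq_bigr => i _ /=.
rewrite /zfactor /tfactor /vfactor [in RHS]mulrDl [in RHS]opprD [in RHS]cexpD !exprMn.
ring.
Qed.

Lemma cmeas_weight j k : cmeas (weight j k).
Proof.
have mX (z : R[i]) n : cmeas (fun x => z ^+ SN n x).
  by apply: (cmeas_nat_fun (fun m => z ^+ m)); exact: measurable_partial_sum_nat.
have mE (f : nat -> T -> R) (z : R[i]) n : (forall i, measurable_fun setT (f i)) ->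
    cmeas (fun x => z * (partial_sum f n x)%:C).
  move=> mf; apply: cmeasM; first exact: cmeas_cst.
  by apply: cmeas_real; exact: measurable_partial_sum.
apply: cmeasM; first apply: cmeasM.
- by apply: cmeasM => //; apply: cmeasM => //; exact: cmeasM.
- apply: cmeas_cexp; apply: cmeasB; last exact: mE.
  by apply: cmeasB; [apply: cmeasB; [apply: cmeasN|]|]; exact: mE.
- apply: cmeas_cexp; apply: cmeasB; last exact: mE.
  by apply: cmeasB; [apply: cmeasB; [apply: cmeasN|]|]; exact: mE.
Qed.

Lemma cabs_weight j k x : cabs (weight j k x) <= 1.
Proof.
have M1 (z1 z2 : R[i]) : cabs z1 <= 1 -> cabs z2 <= 1 -> cabs (z1 * z2) <= 1.
  by move=> h1 h2; rewrite cabsM mulr_ile1 ?cabs_ge0.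
have X1 (z : R[i]) n : cabs z <= 1 -> cabs (z ^+ n) <= 1.
  by move=> z1; rewrite cabsX exprn_ile1 ?cabs_ge0.
have R0 (f : nat -> T -> R) (z : R[i]) n : (forall i x, 0 <= f i x) -> 0 <= complex.Re z ->
    complex.Re (z * (partial_sum f n x)%:C) >= 0.
  by move=> f0 z0; rewrite ReM/= mulr0 subr0 mulr_ge0// partial_sum_ge0.
have E1 (z1 z2 z3 z4 : R[i]) : 0 <= complex.Re z1 -> 0 <= complex.Re z2 ->
    0 <= complex.Re z3 -> 0 <= complex.Re z4 -> cabs (cexp (- z1 - z2 - z3 - z4)) <= 1.
  by move=> *; apply: cabs_cexp_le1; rewrite !ReB ReN; lra.
apply: (M1 _ _); last by apply: (E1 _ _ _ _); exact: (R0 _ _ _).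
apply: (M1 _ _); last by apply: (E1 _ _ _ _); exact: (R0 _ _ _).
by do 3 (apply: (M1 _ _); last exact: X1); exact: X1.
Qed.

(** Beyond measurability and nonnegativity of the increments, this formula and [gamma_lt1] are all
    that the section uses of the two processes. *)
Hypothesis joint_transform : forall N (z v theta : nat -> R[i]),
  (forall i, cabs (z i) <= 1) -> (forall i, 0 <= complex.Re (v i)) ->
  (forall i, 0 <= complex.Re (theta i)) ->
  cexpectation P (fun x => \prod_(i < N.+1) (z i ^+ a i x *
    cexp (- (v i * (b i x)%:C)) * cexp (- (theta i * (c i x)%:C)))) =
  gamma0 (z 0%N) (v 0%N) (theta 0%N) * \prod_(i < N) gamma (z i.+1) (v i.+1) (theta i.+1).
Hypothesis gamma_lt1 : forall z v theta, cabs z < 1 -> 0 <= complex.Re v ->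
  0 <= complex.Re theta -> cabs (gamma z v theta) < 1.

Definition exit_mass j k p q (s : measurableTypeR R) : R[i] :=
  cexpectation P (fun x => weight j k x * (first_passage p j x && first_exit q s k x)%:R).

Let g i := if i is 0%N then gamma0 else gamma.

Let block_term j k (e1 e2 : bool) := threshold_indicator P (weight j k)
  (SN (j + e1)%N) (SN (k + e2)%N) (SW (k + e2)%N).

Let admissible_block_term j k e1 e2 : admissible 1 (block_term j k e1 e2).
Proof.
apply: admissible_threshold_indicator.
- exact: cmeas_weight.
- exact: cabs_weight.
- exact: measurable_partial_sum_nat.
- exact: measurable_partial_sum_nat.
- exact: measurable_partial_sum.
- by move=> x; exact: partial_sum_ge0.
Qed.

Let bool_cint j k (e1 e2 : bool) p q (s : R) : cintegrable P setT (fun x =>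
  weight j k x * (SN (j + e1)%N x <= p)%N%:R * (SN (k + e2)%N x <= q)%N%:R * (SW (k + e2)%N x <= s)%R%:R).
Proof.
have b1 (e : bool) : cabs (e%:R : R[i]) <= 1 by case: e; rewrite ?cabs1 ?cabs0.
apply: (bounded_cintegrable _ (C := 1)) => [|x].
  apply: cmeasM; first apply: cmeasM; first apply: cmeasM; first exact: cmeas_weight.
  - apply: cmeas_bool; apply: measurable_fun_leq; last exact: measurable_cst.
    exact: measurable_partial_sum_nat.
  - apply: cmeas_bool; apply: measurable_fun_leq; last exact: measurable_cst.
    exact: measurable_partial_sum_nat.
  - apply: cmeas_bool; apply: measurable_fun_ler; last exact: measurable_cst.
    exact: measurable_partial_sum.
by rewrite !(cabsM _ (_%:R)) !mulr_ile1 ?mulr_ge0 ?cabs_ge0 ?b1 ?cabs_weight.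
Qed.

(** As the partial sums increase, each event is a difference of two nested ones: [SN j <= p] minus
    [SN j.+1 <= p], and staying up to [k] minus staying up to [k.+1]. The product of the differences
    has four terms. *)
Let exit_massE j k p q s : exit_mass j k p q s =
  (block_term j k false false p q s + -1 * block_term j k true false p q s) +
  -1 * (block_term j k false true p q s + -1 * block_term j k true true p q s).
Proof.
rewrite /block_term /threshold_indicator !mulN1r /cexpectation -!cintegralB.
- congr cintegral; apply/funext => x; rewrite !addn0 !addn1 /first_passage /first_exit /stay.
  have : (SN j.+1 x <= p)%N -> (SN j x <= p)%N by apply: leq_trans; exact: partial_sum_leq.
  have : (SN k.+1 x <= q)%N -> (SN k x <= q)%N by apply: leq_trans; exact: partial_sum_leq.
  have : SW k.+1 x <= s -> SW k x <= s by apply: le_trans; exact: partial_sum_le.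
  rewrite (ltnNge p).
  case: (SN j x <= p)%N; case: (SN j.+1 x <= p)%N; case: (SN k x <= q)%N;
    case: (SN k.+1 x <= q)%N; case: (SW k x <= s)%R; case: (SW k.+1 x <= s)%R => //= h1 h2 h3;
  try (by have := h1 isT); try (by have := h2 isT); try (by have := h3 isT);
  rewrite ?(mulr1n, mulr0n); ring.
all: do ?apply: cintegrableB.
all: solve [exact: (bool_cint j k false false p q s)|exact: (bool_cint j k true false p q s)
  |exact: (bool_cint j k false true p q s)|exact: (bool_cint j k true true p q s)].
Qed.

Lemma measurable_first_passage p j : measurable_fun setT (first_passage p j).
Proof.
apply: measurable_and.
  by apply: measurable_fun_leq; [exact: measurable_partial_sum_nat|exact: measurable_cst].
by apply: measurable_fun_ltn; [exact: measurable_cst|exact: measurable_partial_sum_nat].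
Qed.

Lemma measurable_stay q s k : measurable_fun setT (stay q s k).
Proof.
apply: measurable_and.
  by apply: measurable_fun_leq; [exact: measurable_partial_sum_nat|exact: measurable_cst].
by apply: measurable_fun_ler; [exact: measurable_partial_sum|exact: measurable_cst].
Qed.

Lemma measurable_first_exit q s k : measurable_fun setT (first_exit q s k).
Proof.
apply: measurable_and; first exact: measurable_stay.
by apply: measurable_neg; exact: measurable_stay.
Qed.

Lemma admissible_exit_mass j k : admissible 1 (exit_mass j k).
Proof.
have Z C Psi := @admissibleZ R C (-1) Psi.
move=> p q; split => [|s].
  pose H e := admissibleD (@admissible_block_term j k false e)
    (Z _ _ (@admissible_block_term j k true e)).
  have [mE _] := admissibleD (H false) (Z _ _ (H true)) p q.
  by apply: eq_cmeas mE => s; rewrite exit_massE.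
apply: cexpectation_le => [|x].
  apply: cmeasM; first exact: cmeas_weight.
  apply: cmeas_bool; apply: measurable_and; first exact: measurable_first_passage.
  exact: measurable_first_exit.
by rewrite cabsM mulr_ile1 ?cabs_ge0 ?cabs_weight//; case: (_ && _); rewrite ?cabs1 ?cabs0.
Qed.

Section transform_values.
Variables x y w : R[i].
Hypotheses (x1 : cabs x < 1) (y1 : cabs y < 1) (w0 : 0 < complex.Re w).

Let varphi := gamma (u0 * u * alpha0 * alpha * x * y)
    (v0 + v + beta0 + beta + w) (theta0 + theta + h0 + h).
Let varphi0 := gamma0 (u0 * u * alpha0 * alpha * x * y)
    (v0 + v + beta0 + beta + w) (theta0 + theta + h0 + h).
Let phi (e : bool) := gamma (u * alpha0 * alpha * x ^+ e * y)
    (v + beta0 + beta + w) (theta + h0 + h).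
Let phi0 (e : bool) := gamma0 (u * alpha0 * alpha * x ^+ e * y)
    (v + beta0 + beta + w) (theta + h0 + h).
Let psi := gamma (alpha0 * alpha * y) (beta0 + beta + w) (h0 + h).
Let chi (e : bool) := gamma (alpha * y ^+ e) (beta + w * e%:R) h.

(** The contribution of the increments 0 to j. The increment 0 has its own transform, so first
    passage at index 0 is a separate case. With [e = false] the passing increment carries no [x],
    which yields the functions with exponent 1. *)
Let head (j : nat) (e : bool) := if j is j'.+1 then varphi0 * varphi ^+ j' * phi e else phi0 e.

Let re_bool (z : R[i]) (e : bool) : 0 <= complex.Re z -> 0 <= complex.Re (z * e%:R).
Proof. by case: e => z0; rewrite ?mulr1// mulr0. Qed.

Let zfactor_le1 j k j' k' i : cabs (zfactor j k j' k' x y i) <= 1.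
Proof.
have M1 (z1 z2 : R[i]) : cabs z1 <= 1 -> cabs z2 <= 1 -> cabs (z1 * z2) <= 1.
  by move=> h1 h2; rewrite cabsM mulr_ile1 ?cabs_ge0.
have X1 (z : R[i]) n : cabs z <= 1 -> cabs (z ^+ n) <= 1.
  by move=> z1; rewrite cabsX exprn_ile1 ?cabs_ge0.
apply: (M1 _ _); last by apply: (X1 _ _); exact: ltW.
apply: (M1 _ _); last by apply: (X1 _ _); exact: ltW.
by do 3 (apply: (M1 _ _); last exact: X1); exact: X1.
Qed.

Let vfactor_ge0 j k k' i : 0 <= complex.Re (vfactor j k k' w i).
Proof. by rewrite !ReD !addr_ge0// re_bool// ltW. Qed.

Let tfactor_ge0 j k i : 0 <= complex.Re (tfactor j k i).
Proof. by rewrite !ReD !addr_ge0// re_bool. Qed.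

(** Increments before [j] carry all variables; at [j] those of N_(j-1) drop out; the [m] increments
    strictly between [j] and [k] give [psi]; the one at [k] gives [chi]. *)
Lemma threshold_transform_block j m (e1 e2 : bool) :
  threshold_transform (block_term j (j.+1 + m) e1 e2) x y w = head j e1 * psi ^+ m * chi e2.
Proof.
set k := (j.+1 + m)%N.
rewrite threshold_transform_indicator//; first last.
- by move=> o; exact: partial_sum_ge0.
- exact: measurable_partial_sum.
- exact: measurable_partial_sum_nat.
- exact: measurable_partial_sum_nat.
- exact: cabs_weight.
- exact: cmeas_weight.
have [jk j'k k'k] := index_bounds j m e1 e2.
under eq_fun do rewrite (weight_prod _ _ _ _ jk j'k k'k).
rewrite joint_transform//.
pose f i := g i (zfactor j k (j + e1) (k + e2) x y i) (vfactor j k (k + e2) w i) (tfactor j k i).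
transitivity (\prod_(i < k.+1) f i); first by rewrite big_ord_recl.
have fE i (b1 b2 b3 b4 b5 b6 : bool) : (i < j)%N = b1 -> (i < j.+1)%N = b2 ->
    (i < k)%N = b3 -> (i < k.+1)%N = b4 -> (i < j + e1)%N = b5 -> (i < k + e2)%N = b6 ->
    f i = g i (u0 ^+ b1 * u ^+ b2 * alpha0 ^+ b3 * alpha ^+ b4 * x ^+ b5 * y ^+ b6)
      (v0 * b1%:R + v * b2%:R + beta0 * b3%:R + beta * b4%:R + w * b6%:R)
      (theta0 * b1%:R + theta * b2%:R + h0 * b3%:R + h * b4%:R).
  by rewrite /f /zfactor /vfactor /tfactor => -> -> -> -> -> ->.
have lt_head i : (i < j)%N -> f i = if i is 0%N then varphi0 else varphi.
  move=> ij; have [q2 q3 q4 q5 q6] := index_before m e1 e2 ij.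
  rewrite (@fE i true true true true true true)//.
  by rewrite !expr1 !mulr1; case: i {ij q2 q3 q4 q5 q6}.
have eq_head : f j = if j is 0%N then phi0 e1 else phi e1.
  have [[q1 q2 q3 q4 q5] q6] := index_passage j m e1 e2.
  rewrite (@fE j false true true true e1 true)//.
  by rewrite expr0 mul1r !expr1 mulr0 !mulr1 mulr0 !add0r; case: (j).
have mid i : (i < m)%N -> f (j.+1 + i)%N = psi.
  move=> /(@index_between _ j _ e1 e2)[[q1 q2 q3 q4 q5] q6].
  rewrite (@fE _ false false true true false true)//.
  by rewrite /= expr0 !mul1r !expr1 !mulr0 !mulr1 !add0r.
have last : f k = chi e2.
  have [[q1 q2 q3 q4 q5] q6] := index_exit j m e1 e2.
  rewrite (@fE _ false false false true false e2)//.
  by rewrite /= expr0 !mul1r !expr1 !mulr0 !mulr1 !add0r.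
clearbody f; rewrite big_ord_recr last; congr (_ * _); rewrite /k big_split_ord big_ord_recr.
congr (_ * _); last first.
  rewrite (eq_bigr (fun=> psi)) => [|i _]; first by rewrite prodr_const card_ord.
  by apply: mid.
rewrite /= eq_head /head.
case: (j) lt_head => [|j0] lt_head; first by rewrite big_ord0 mul1r.
congr (_ * _); rewrite big_ord_recl/= lt_head//; congr (_ * _).
rewrite (eq_bigr (fun=> varphi)) => [|i _]; first by rewrite prodr_const card_ord.
exact: (lt_head i.+1 (ltn_ord i)).
Qed.

Lemma threshold_transform_exit_mass j m :
  threshold_transform (exit_mass j (j.+1 + m)) x y w =
  (head j false - head j true) * psi ^+ m * (chi false - chi true).
Proof.
have A := @admissible_block_term j (j.+1 + m)%N.
have Z C Psi := @admissibleZ R C (-1) Psi.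
rewrite (eq_threshold_transform x y w (@exit_massE j (j.+1 + m)%N)).
have H e := admissibleD (A false e) (Z _ _ (A true e)).
rewrite (threshold_transformD x1 y1 w0 (H false) (Z _ _ (H true))).
rewrite (threshold_transformZ x1 y1 w0 (-1) (H true)).
rewrite !(threshold_transformD x1 y1 w0 (A false _) (Z _ _ (A true _))).
rewrite !(threshold_transformZ x1 y1 w0 (-1) (A true _)) !threshold_transform_block; ring.
Qed.

(** Writing [k] as [j.+1 + m] makes the two indices run independently, so that the transform of the
    double sum is a product of two partial geometric sums. *)
Definition partial_exit_mass K p q s :=
  \sum_(j < K) \sum_(m < K) exit_mass j (j.+1 + m) p q s.

Lemma threshold_transform_partial_exit_mass :
  ccvg (fun K => threshold_transform (partial_exit_mass K) x y w)
    (exit_transform gamma0 gamma u0 u alpha0 alpha v0 v beta0 beta theta0 theta h0 h x y w).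
Proof.
have E K : threshold_transform (partial_exit_mass K) x y w =
    (\sum_(j < K) (head j false - head j true)) *
    ((\sum_(m < K) psi ^+ m) * (chi false - chi true)).
  rewrite (threshold_transform_sum _ x1 y1 w0 (C := fun=> \sum_(m < K) 1)); last first.
    by move=> j; apply: admissible_sum => m; exact: admissible_exit_mass.
  rewrite mulr_suml; apply: eq_bigr => j _.
  rewrite (threshold_transform_sum _ x1 y1 w0 (C := fun=> 1)); last first.
    by move=> m; exact: admissible_exit_mass.
  rewrite mulr_suml mulr_sumr; apply: eq_bigr => m _.
  by rewrite threshold_transform_exit_mass mulrA.
under eq_fun do rewrite E.
have z1 (z : R[i]) : cabs z <= 1 -> cabs (z * y) < 1.
  by move=> z1; rewrite cabsM (le_lt_trans _ y1)// ler_piMl ?cabs_ge0.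
(* The coefficients may have modulus 1; it is the factor [y] that brings the argument strictly
   inside the unit disc. *)
have psi1 : cabs psi < 1.
  by apply: gamma_lt1; rewrite ?ReD ?addr_ge0 ?(ltW w0)// z1// cabsM mulr_ile1 ?cabs_ge0.
have varphi1 : cabs varphi < 1.
  apply: gamma_lt1; rewrite ?ReD ?addr_ge0 ?(ltW w0)// z1//.
  have M1 (q1 q2 : R[i]) : cabs q1 <= 1 -> cabs q2 <= 1 -> cabs (q1 * q2) <= 1.
    by move=> *; rewrite cabsM mulr_ile1 ?cabs_ge0.
  by apply: (M1 _ _); last (exact: ltW); do 3 (apply: (M1 _ _) => //).
rewrite /exit_transform; apply: ccvgM; last first.
  rewrite /psi /chi /= !expr0 !expr1 mulr1 mulr0 addr0 mulr1 [X in ccvg _ X]mulrC.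
  by apply: ccvgM; [exact: ccvg_geometric_series|exact: ccvg_cst].
(* The term [j = 0] is split off, so the geometric series in [varphi] starts one step later. *)
apply: ccvg_unshift.
apply: (@eq_ccvg _ (fun K => phi0 false - phi0 true +
    (varphi0 * (\sum_(j < K) varphi ^+ j) * (phi false - phi true)))).
  move=> K; rewrite big_ord_recl/=; congr (_ + _).
  rewrite mulr_sumr mulr_suml; apply: eq_bigr => j _; rewrite /= -mulrBr //.
rewrite /phi0 /phi /= !expr0 !expr1 !mulr1.
apply: ccvgD; first exact: ccvg_cst.
apply: ccvgM; last exact: ccvg_cst.
by apply: ccvgM; [exact: ccvg_cst|exact: ccvg_geometric_series].
Qed.

End transform_values.

Definition exit_hit p q s (jm : nat * nat) x :=
  first_passage p jm.1 x && first_exit q s (jm.1.+1 + jm.2) x.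

(* At most one pair (j, m), standing for mu_1 = j and rho = j + 1 + m, occurs. *)
Definition exit_value p q (s : R) x : R[i] :=
  \sum_(jm \in [set jm | exit_hit p q s jm x]) weight jm.1 (jm.1.+1 + jm.2) x.

Definition partial_exit_value K p q (s : R) x : R[i] :=
  \sum_(j < K) \sum_(m < K) weight j (j.+1 + m) x *
    (first_passage p j x && first_exit q s (j.+1 + m) x)%:R.

Lemma exit_hit_uniq p q s jm jm' x :
  exit_hit p q s jm x -> exit_hit p q s jm' x -> jm = jm'.
Proof.
case: jm jm' => [j m] [j' m'] /andP[/= p1 e1] /andP[/= p2 e2].
rewrite -(first_passage_uniq p1 p2) in e2 *.
by have /addnI -> := first_exit_uniq e1 e2.
Qed.

Lemma exit_value_hit p q s jm x : exit_hit p q s jm x ->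
  exit_value p q s x = weight jm.1 (jm.1.+1 + jm.2) x.
Proof.
move=> hit; rewrite /exit_value (_ : [set jm' | _] = [set jm]) ?fsbig_set1//.
apply/seteqP; split => [jm' /= hit'|jm' /= -> //].
exact: exit_hit_uniq hit' hit.
Qed.

Lemma exit_value_nohit p q s x : (forall jm, ~ exit_hit p q s jm x) ->
  exit_value p q s x = 0.
Proof.
move=> nh; rewrite /exit_value (_ : [set jm | _] = set0) ?fsbig_set0//.
by apply/seteqP; split => // jm /= /nh.
Qed.

Lemma partial_exit_value_nohit K p q s x : (forall jm, ~ exit_hit p q s jm x) ->
  partial_exit_value K p q s x = 0.
Proof.
move=> nh; rewrite /partial_exit_value big1// => j _; rewrite big1// => m _.
by have /negP/negbTE := nh (nat_of_ord j, nat_of_ord m); rewrite /exit_hit/= => ->; rewrite mulr0.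
Qed.

Lemma partial_exit_value_hit K p q s jm x : exit_hit p q s jm x ->
  partial_exit_value K p q s x =
  if (jm.1 < K)%N && (jm.2 < K)%N then exit_value p q s x else 0.
Proof.
move=> hit; rewrite (exit_value_hit hit) /partial_exit_value.
have E j m : first_passage p j x && first_exit q s (j.+1 + m) x = ((j, m) == jm).
  apply/idP/eqP => [hit'|E]; first exact: (exit_hit_uniq (jm := (j, m)) hit' hit).
  by move: hit; rewrite -E.
under eq_bigr do under eq_bigr do rewrite E.
case: jm hit {E} => j0 m0 hit /=; case: ifPn => [/andP[jK mK]|nK].
  rewrite (bigD1 (Ordinal jK))//= (bigD1 (Ordinal mK))//= eqxx mulr1.
  rewrite big1 ?addr0 => [|m mm0]; last first.
    by rewrite xpair_eqE eqxx/= -(inj_eq val_inj)/= in mm0 *; rewrite (negbTE mm0) mulr0.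
  rewrite big1 ?addr0// => j jj0; rewrite big1// => m _.
  by rewrite xpair_eqE -(inj_eq val_inj)/= in jj0 *; rewrite (negbTE jj0) mulr0.
rewrite big1// => j _; rewrite big1// => m _; rewrite xpair_eqE.
case: eqP => [jj0|]; case: eqP => [mm0|]; rewrite /= ?mulr0//.
by move: nK; rewrite -jj0 -mm0 !ltn_ord.
Qed.

Lemma cabs_exit_value p q s x : cabs (exit_value p q s x) <= 1.
Proof.
have [[jm hit]|nh] := pselect (exists jm, exit_hit p q s jm x).
  by rewrite (exit_value_hit hit); exact: cabs_weight.
by rewrite exit_value_nohit ?cabs0// => jm hit; apply: nh; exists jm.
Qed.

Lemma cabs_partial_exit_value K p q s x : cabs (partial_exit_value K p q s x) <= 1.
Proof.
have [[jm hit]|nh] := pselect (exists jm, exit_hit p q s jm x).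
  by rewrite (partial_exit_value_hit _ hit); case: ifP; rewrite ?cabs0// cabs_exit_value.
by rewrite partial_exit_value_nohit ?cabs0// => jm hit; apply: nh; exists jm.
Qed.

Lemma partial_exit_value_ccvg p q s x :
  ccvg (fun K => partial_exit_value K p q s x) (exit_value p q s x).
Proof.
have [[jm hit]|nh] := pselect (exists jm, exit_hit p q s jm x).
  apply: near_ccvg (ccvg_cst _); near=> K; rewrite (partial_exit_value_hit _ hit) ifT//.
  by apply/andP; split; near: K; exact: nbhs_infty_gt.
have nh' jm : ~ exit_hit p q s jm x by move=> hit; apply: nh; exists jm.
rewrite exit_value_nohit//.
by apply: eq_ccvg (ccvg_cst 0) => K; rewrite partial_exit_value_nohit.
Unshelve. all: by end_near. Qed.

Let cmeas_exit_term j k p q s : cmeas (fun x =>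
  weight j k x * (first_passage p j x && first_exit q s k x)%:R).
Proof.
apply: cmeasM; first exact: cmeas_weight.
apply: cmeas_bool; apply: measurable_and; first exact: measurable_first_passage.
exact: measurable_first_exit.
Qed.

Lemma cmeas_partial_exit_value K p q s : cmeas (partial_exit_value K p q s).
Proof. by apply: cmeas_sum => j; apply: cmeas_sum => m; exact: cmeas_exit_term. Qed.

Lemma cmeas_exit_value p q s : cmeas (exit_value p q s).
Proof.
apply: (cmeas_cvg (h := fun K => partial_exit_value K p q s)) => [K|x].
  exact: cmeas_partial_exit_value.
exact: partial_exit_value_ccvg.
Qed.

Definition exit_law p q (s : measurableTypeR R) : R[i] := cexpectation P (exit_value p q s).

Lemma partial_exit_massE K p q s :
  partial_exit_mass K p q s = cexpectation P (partial_exit_value K p q s).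
Proof.
have ti j k : cintegrable P setT (fun x =>
    weight j k x * (first_passage p j x && first_exit q s k x)%:R).
  apply: (bounded_cintegrable _ (C := 1)) => [|x]; first exact: cmeas_exit_term.
  by rewrite cabsM mulr_ile1 ?cabs_ge0 ?cabs_weight//; case: (_ && _); rewrite ?cabs1 ?cabs0.
rewrite /cexpectation cintegral_sum => [|j]; last exact: cintegrable_sum.
by apply: eq_bigr => j _; rewrite cintegral_sum.
Qed.

Lemma partial_exit_mass_ccvg p q s :
  ccvg (fun K => partial_exit_mass K p q s) (exit_law p q s).
Proof.
under eq_fun do rewrite partial_exit_massE.
apply: (cexpectation_cvg _ (C := 1)) => [K|K x|x].
- exact: cmeas_partial_exit_value.
- exact: cabs_partial_exit_value.
- exact: partial_exit_value_ccvg.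
Qed.

Lemma admissible_partial_exit_mass K : admissible 1 (partial_exit_mass K).
Proof.
move=> p q; split => [|s].
  have a1 j := admissible_sum (index_enum 'I_K) (fun m : 'I_K => admissible_exit_mass j (j.+1 + m)).
  exact: (admissible_sum (index_enum 'I_K) (fun j : 'I_K => a1 j) p q).1.
rewrite partial_exit_massE; apply: cexpectation_le; first exact: cmeas_partial_exit_value.
exact: cabs_partial_exit_value.
Qed.

Lemma admissible_exit_law : admissible 1 exit_law.
Proof.
move=> p q; split => [|s].
  apply: (@cmeas_cvg _ (measurableTypeR R) R (fun K => partial_exit_mass K p q)) => [K|s].
    exact: (admissible_partial_exit_mass K p q).1.
  exact: partial_exit_mass_ccvg.
apply: cexpectation_le; first exact: cmeas_exit_value.
exact: cabs_exit_value.
Qed.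

Lemma first_exit_or_stay q (s : R) x : 0 <= s ->
  (exists k, first_exit q s k x) \/ (forall k, stay q s k x).
Proof.
move=> s0; have [[k ek]|ne] := pselect (exists k, first_exit q s k x); [by left; exists k|right].
elim=> [|k IH]; first by rewrite /stay !partial_sum0 s0.
by apply: contrapT => /negP nk; apply: ne; exists k; rewrite /first_exit IH.
Qed.

Lemma stayW q (s s' : R) k x : s <= s' -> stay q s k x -> stay q s' k x.
Proof. by move=> ss' /andP[h1 h2]; rewrite /stay h1 (le_trans h2). Qed.

(** Thresholds are crossed strictly, so for a fixed outcome a slight increase of [s] changes no exit
    index. This is the source of right-continuity. *)
Lemma first_exit_right q (s : R) x : 0 <= s ->
  exists2 e, 0 < e & forall s', s < s' -> s' < s + e ->
    forall k, first_exit q s' k x = first_exit q s k x.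
Proof.
move=> s0; have [[k ek]|st] := first_exit_or_stay q x s0; last first.
  exists 1 => // s' ss' _ k; rewrite /first_exit !st/= (stayW (ltW ss') (st k)).
  by rewrite (stayW (ltW ss') (st k.+1)).
have [e e0 eh] : exists2 e, 0 < e & forall s', s < s' -> s' < s + e -> first_exit q s' k x.
  move: ek => /andP[sk]; rewrite /stay negb_and => /orP[nk|nk].
    by exists 1 => // s' ss' _; rewrite /first_exit (stayW (ltW ss') sk) /stay negb_and nk.
  (* The amount by which the weight exceeds the threshold at the exit. *)
  exists (SW k.+1 x - s); first by rewrite subr_gt0 ltNge.
  move=> s' ss'; rewrite addrC subrK => s'k.
  by rewrite /first_exit (stayW (ltW ss') sk) /stay negb_and -(ltNge s') s'k orbT.
exists e => // s' ss' s'e k'; have ek' := eh _ ss' s'e.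
apply/idP/idP => fk; first by rewrite (first_exit_uniq fk ek').
by rewrite (first_exit_uniq fk ek).
Qed.

(** Along any sequence tending to [s] from above, the exit value at each outcome is eventually
    constant; dominated convergence transfers this to expectations. *)
Lemma exit_law_right_continuous p q (s : R) : 0 <= s ->
  (exit_law p q : R -> R[i]^o) t @[t --> s^'+] --> (exit_law p q s : R[i]^o).
Proof.
move=> s0; have cv (r : R^nat) : (forall n, s < r n) /\ (r n @[n --> \oo] --> s) ->
    ccvg (fun n => exit_law p q (r n)) (exit_law p q s).
  move=> [sr rs]; apply: (cexpectation_cvg _ (C := 1)) => [n|n x|x].
  - exact: cmeas_exit_value.
  - exact: cabs_exit_value.
  - have [e e0 eh] := first_exit_right q x s0.
    apply: near_ccvg (ccvg_cst _); near=> n.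
    rewrite /exit_value; congr (\sum_(jm \in _) _); apply/funext => jm.
    rewrite /exit_hit /= eh//.
    near: n; apply: (cvgr_lt s) => //; by rewrite ltrDl.
apply/cvg_complexP; split; apply/cvg_at_rightP => r hr.
  by have [] := cv r hr.
by have [] := cv r hr.
Unshelve. all: by end_near. Qed.

Lemma Dxyw_inv_exit_transform p q (s : R) : 0 <= s ->
  Dxyw_inv (exit_transform gamma0 gamma u0 u alpha0 alpha v0 v beta0 beta
    theta0 theta h0 h) p q s = cexpectation P (exit_value p q s).
Proof.
apply: (Dxyw_inv_threshold_transform admissible_exit_law).
  by move=> p' q' s' s0; exact: exit_law_right_continuous.
move=> x y w x1 y1 w0; apply: ccvg_unique (threshold_transform_partial_exit_mass x1 y1 w0) _.
apply: (threshold_transform_cvg x1 y1 w0 (C := 1)) => [K|p' q' s' _].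
  exact: admissible_partial_exit_mass.
exact: partial_exit_mass_ccvg.
Qed.

Lemma measurable_stay_forever q (s : R) : measurable [set x | forall k, stay q s k x].
Proof.
apply: measurable_forall_nat => k; apply: (measurable_bool_eq true).
exact: measurable_stay.
Qed.

(* E[2^(-SN k)] decays geometrically in k, while 2^(-SN k) stays above 2^(-q)
   as long as SN k <= q. *)
Lemma stay_forever_null q (s : R) : fine (P [set x | forall k, stay q s k x]) = 0.
Proof.
set A := [set x | _]; have mA : measurable A by exact: measurable_stay_forever.
pose r : R := 2^-1; have r0 : 0 < r by rewrite invr_gt0.
have r1 : r < 1 by rewrite invf_lt1// ltr1n.
have rX0 n : 0 <= r ^+ n by rewrite exprn_ge0// ltW.
have rC : cabs r%:C < 1 by rewrite cabs_real gtr0_norm.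
pose G0 := gamma0 r%:C 0 0; pose G1 := gamma r%:C 0 0.
have E k : cexpectation P (fun x => r%:C ^+ SN k.+1 x) = G0 * G1 ^+ k.
  have := @joint_transform k (fun=> r%:C) (fun=> 0) (fun=> 0) (fun=> ltW rC)
    (fun=> lexx _) (fun=> lexx _).
  rewrite prodr_const card_ord => <-; congr cexpectation; apply/funext => x.
  rewrite /partial_sum expr_sum; apply: eq_bigr => i _.
  by rewrite !mul0r oppr0 cexp0 !mulr1.
have le k : r ^+ q * fine (P A) <= cabs G0 * cabs G1 ^+ k.
  have -> : r ^+ q * fine (P A) = cabs (cexpectation P (fun x => (r ^+ q)%:C * ind A x)).
    rewrite /cexpectation cintegralZ; last first.
      by apply: (bounded_cintegrable _ (C := 1)) => [|x]; [exact: cmeas_ind|exact: cabs_ind].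
    rewrite -/(cexpectation P (ind A)) cexpectation_ind// cabsM !cabs_real.
    by rewrite !ger0_norm ?fine_ge0.
  rewrite -cabsX -cabsM -E; apply: (le_trans _ (Re_le_cabs _)); apply: (le_trans _ (ler_norm _)).
  have iX : cintegrable P setT (fun x => r%:C ^+ SN k.+1 x).
    apply: (bounded_cintegrable _ (C := 1)) => [|x].
      by apply: (cmeas_nat_fun (fun m => r%:C ^+ m)); exact: measurable_partial_sum_nat.
    by rewrite cabsX exprn_ile1 ?cabs_ge0// ltW.
  apply: (cabs_cintegral_le _ iX.1) => [|x].
    apply: (bounded_cintegrable _ (C := 1)) => [|x].
      by apply: cmeasM; [exact: cmeas_cst|exact: cmeas_ind].
    rewrite cabsM mulr_ile1 ?cabs_ge0 ?cabs_ind// cabs_real ger0_norm//.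
    by rewrite exprn_ile1// ltW.
  rewrite -rmorphXn/= cabsM cabs_real ger0_norm// /ind.
  have [/set_mem Ax|_] := boolP (x \in A); last by rewrite cabs0 mulr0.
  rewrite cabs1 mulr1; have /andP[SNq _] := Ax k.+1.
  by rewrite ler_wiXn2l// ltW.
have G10 : cabs G1 < 1 by exact: gamma_lt1.
have lim0 : (cabs G0 * cabs G1 ^+ k) @[k --> \oo] --> (0 : R).
  rewrite -(mulr0 (cabs G0)); apply: cvgM; first exact: cvg_cst.
  by apply: cvg_expr; rewrite ger0_norm ?cabs_ge0.
apply/eqP; rewrite eq_le fine_ge0// andbT -(ler_pM2l (exprn_gt0 q r0)) mulr0.
by apply: (ler_cvg_to (cvg_cst _) lim0); apply: nearW => k; exact: le.
Qed.

(** * Passing to the functional of the theorem *)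

Section exit_functional.
Variables (p q : nat) (s : R) (G : T -> R[i]).
Hypothesis s0 : 0 <= s.
Hypothesis G_hit : forall j k x, (j < k)%N -> first_passage p j x -> first_exit q s k x ->
  G x = weight j k x.
Hypothesis G_nohit : forall j k x, (k <= j)%N -> first_passage p j x -> first_exit q s k x ->
  G x = 0.
Hypothesis G_nopassage : forall x, (forall j, ~ first_passage p j x) -> G x = 0.
(* Where rho = +oo, the index rho is read as 0. *)
Hypothesis G_stay : forall j x, first_passage p j x -> (forall k, stay q s k x) ->
  G x = weight j 0 x.

Let A := [set x | forall k, stay q s k x].

Let exit_index j k x : (j < k)%N -> first_passage p j x -> first_exit q s k x ->
  exit_hit p q s (j, (k - j.+1)%N) x.
Proof. by move=> jk pj ek; rewrite /exit_hit/= pj/= subnKC. Qed.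

Let exit_value_off_stay x : ~ A x -> exit_value p q s x = G x.
Proof.
move=> nA; have [[k ek]|//] := first_exit_or_stay q x s0.
have [[j pj]|np] := pselect (exists j, first_passage p j x); last first.
  rewrite G_nopassage => [|j pj]; last by apply: np; exists j.
  by apply: exit_value_nohit => jm /andP[pj _]; apply: np; exists jm.1.
case: (ltnP j k) => jk.
  have hit := exit_index jk pj ek.
  by rewrite (exit_value_hit hit)/= subnKC// (G_hit jk pj ek).
rewrite (G_nohit jk pj ek); apply: exit_value_nohit => -[j' m] /andP[/= pj' ek'].
move: jk; rewrite (first_passage_uniq pj pj') (first_exit_uniq ek ek').
by rewrite leqNgt ltnS leq_addr.
Qed.

Let exit_value_stay x : A x -> exit_value p q s x = 0.
Proof.
by move=> Ax; apply: exit_value_nohit => jm /andP[_ /andP[_]]; rewrite Ax.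
Qed.

(** On the null event [A] the functional reads rho as 0 and may be nonzero. This sum describes it
    there, which gives its measurability on all of [T]. *)
Let stay_part K x := \sum_(j < K) weight j 0 x * (first_passage p j x)%:R * ind A x.

Let stay_part_ccvg x : ccvg (fun K => stay_part K x) (G x * ind A x).
Proof.
rewrite /ind; have [/set_mem Ax|nA] := boolP (x \in A); last first.
  rewrite mulr0; apply: eq_ccvg (ccvg_cst 0) => K; rewrite /stay_part/ind (negbTE nA).
  by rewrite big1// => j _; rewrite mulr0.
rewrite mulr1; have indA : ind A x = 1 :> R[i] by rewrite /ind mem_set.
have [[j pj]|np] := pselect (exists j, first_passage p j x); last first.
  rewrite G_nopassage => [|j pj]; last by apply: np; exists j.
  apply: eq_ccvg (ccvg_cst 0) => K; rewrite /stay_part big1// => j _.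
  by case: (boolP (first_passage p j x)) => [pj|_]; [case: np; exists j|rewrite mulr0 mul0r].
rewrite (G_stay pj Ax); apply: near_ccvg (ccvg_cst _); near=> K.
have jK : (j < K)%N by near: K; exact: nbhs_infty_gt.
rewrite /stay_part (bigD1 (Ordinal jK))//= pj indA !mulr1 big1 ?addr0// => i ij.
case: (boolP (first_passage p i x)) => [pi|_]; last by rewrite mulr0 mul0r.
by case/eqP: ij; apply: val_inj; exact: first_passage_uniq pi pj.
Unshelve. all: by end_near. Qed.

Lemma cmeas_exit_functional : cmeas G.
Proof.
apply: (cmeas_cvg (h := fun K x => exit_value p q s x + stay_part K x)) => [K|x].
  apply: cmeasD; first exact: cmeas_exit_value.
  apply: cmeas_sum => j; apply: cmeasM; first apply: cmeasM.
  - exact: cmeas_weight.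
  - by apply: cmeas_bool; exact: measurable_first_passage.
  - by apply: cmeas_ind; exact: measurable_stay_forever.
have [Ax|nA] := pselect (A x).
  rewrite exit_value_stay//; under eq_fun do rewrite add0r.
  by have := stay_part_ccvg x; rewrite /ind mem_set// mulr1.
rewrite -[X in ccvg _ X](addr0 (G x)) -exit_value_off_stay//; apply: ccvgD; first exact: ccvg_cst.
by have := stay_part_ccvg x; rewrite /ind memNset// mulr0.
Qed.

Lemma exit_functional_transform :
  cexpectation P G = Dxyw_inv (exit_transform gamma0 gamma u0 u alpha0 alpha v0 v
    beta0 beta theta0 theta h0 h) p q s.
Proof.
rewrite Dxyw_inv_exit_transform//; apply: ae_eq_cintegral.
- exact: cmeas_exit_functional.
- exact: cmeas_exit_value.
- exists A; split.
  + exact: measurable_stay_forever.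
  + rewrite -[LHS]fineK ?fin_num_measure//; last exact: measurable_stay_forever.
    by rewrite stay_forever_null.
  + by move=> x /= nx; apply: contrapT => nA; apply: nx; rewrite exit_value_off_stay.
Qed.

End exit_functional.

End exit_time.

(** * First passage indices and the main theorem *)

Section first_indices.
Context d (T : measurableType d) {R : realType}.
Implicit Types Q : nat -> T -> Prop.

Lemma first_index_eq Q j x : Q j x -> (forall i, (i < j)%N -> ~ Q i x) ->
  first_index Q x = j%:R%:E :> \bar R.
Proof.
move=> Qj Qi; apply/eqP; rewrite eq_le; apply/andP; split.
  by apply: ereal_inf_lbound; exists j.
apply: le_ereal_inf_tmp => _ [n Qn <-]; rewrite lee_fin ler_nat leqNgt.
by apply/negP => /Qi; apply.
Qed.

Lemma first_index_pinfty Q x : (forall i, ~ Q i x) -> first_index Q x = +oo%E :> \bar R.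
Proof.
move=> nQ; rewrite /first_index (_ : [set n | Q n x] = set0) ?image_set0 ?ereal_inf0//.
by apply/seteqP; split => // n /nQ.
Qed.

(** It presents rho as the first index of a single disjunction, so that [first_index_eq] and
    [first_index_pinfty] serve for rho as they do for mu_1. *)
Lemma mine_first_index Q1 Q2 x :
  mine (first_index Q1 x) (first_index Q2 x) =
  first_index (fun n y => Q1 n y \/ Q2 n y) x :> \bar R.
Proof.
apply/eqP; rewrite eq_le; apply/andP; split.
  apply: le_ereal_inf_tmp => _ [n [Qn|Qn] <-]; rewrite ge_min.
    by rewrite ereal_inf_lbound//; exists n.
  by rewrite [X in _ || X]ereal_inf_lbound ?orbT//; exists n.
rewrite le_min; apply/andP; split; apply: le_ereal_inf_tmp => _ [n Qn <-];
  apply: ereal_inf_lbound; exists n => //; [by left|by right].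
Qed.

End first_indices.

Section strict_contraction.
Context d (T : measurableType d) {R : realType} (P : probability T R).

(** The modulus is at most the expectation of [expR (- (complex.Re eta * X x))]. If that reached 1,
    the nonnegative variable [f] would have integral 0, forcing [X] to vanish almost everywhere. *)
Lemma laplace_stieltjes_lt1 (X : T -> R) eta : measurable_fun setT X ->
  (forall x, 0 <= X x) -> ~ {ae P, forall x, X x = 0} -> 0 < complex.Re eta ->
  cabs (laplace_stieltjes P X eta) < 1.
Proof.
move=> mX X0 nX eta0; rewrite ltNge; apply/negP => L1; apply: nX.
pose f x := 1 - expR (- (complex.Re eta * X x)).
have f0 x : 0 <= f x by rewrite subr_ge0 -expR0 ler_expR oppr_le0 mulr_ge0// ltW.
have me : measurable_fun setT (fun x => expR (- (complex.Re eta * X x))).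
  apply: measurableT_comp; first exact: measurable_expR.
  by apply: measurableT_comp => //; apply: measurable_funM => //; exact: measurable_cst.
have mf : measurable_fun setT f by apply: measurable_funB => //; exact: measurable_cst.
have ie : P.-integrable setT (EFin \o (fun x => expR (- (complex.Re eta * X x)))).
  have [] := bounded_cintegrable P (f := fun x => (expR (- (complex.Re eta * X x)))%:C)
    (C := 1) (cmeas_real me) => // x.
  rewrite cabs_real ger0_norm ?expR_ge0// -expR0 ler_expR oppr_le0 mulr_ge0//; exact: ltW.
have LE : cabs (laplace_stieltjes P X eta) <= \int[P]_x expR (- (complex.Re eta * X x)).
  apply: cabs_cintegral_le ie _ => [|x]; last by rewrite cabs_cexp_lin.
  apply: (bounded_cintegrable _ (C := 1)) => [|x].
    apply: cmeas_cexp; apply: cmeasN; apply: cmeasM; first exact: cmeas_cst.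
    exact: cmeas_real.
  by rewrite cabs_cexp_lin -expR0 ler_expR oppr_le0 mulr_ge0// ltW.
have If : \int[P]_x f x <= 0.
  rewrite RintegralB//; last exact: (integrable_cst P 1).
  by rewrite Rintegral_probability_cst subr_le0; exact: le_trans L1 LE.
have if_ : P.-integrable setT (EFin \o f).
  by apply: eq_integrable (integrableB measurableT (integrable_cst P 1) ie).
have f00 : (\int[P]_x (f x)%:E = 0)%E.
  have fin : (\int[P]_x (f x)%:E)%E \is a fin_num by exact: integrable_fin_num.
  rewrite -(fineK fin); congr EFin; apply/eqP; rewrite eq_le; apply/andP; split => //.
  by apply: fine_ge0; apply: integral_ge0 => x _; rewrite lee_fin.
have ae0 : ae_eq P setT (EFin \o f) (cst 0%E).
  apply/ae_eq_integral_abs => //; first exact/measurable_EFinP.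
  by rewrite -f00; apply: eq_integral => x _; rewrite /= ger0_norm.
move: ae0; apply: filterS => x /(_ I) [] /eqP.
rewrite subr_eq0 => /eqP /esym; rewrite -expR0 => /expR_inj /eqP.
by rewrite oppr_eq0 mulf_eq0 => /orP[/eqP h|/eqP//]; rewrite h ltxx in eta0.
Qed.

End strict_contraction.

(** Every attack destroys at least one node, so the power in the generating function has exponent at
    least 1. For [cabs z < 1] the exponent of [gamma] then has positive real part. *)
Lemma cabs_mark_transform_le d (T : measurableType d) {R : realType} (P : probability T R)
    (n_ : nat -> {RV P >-> nat}) (w_ : nat -> nat -> {RV P >-> R}) z v :
  (forall k x, (0 < n_ k x)%N) -> (forall j k x, 0 <= w_ j k x) ->
  cabs z <= 1 -> 0 <= complex.Re v -> cabs (mark_transform n_ w_ z v) <= cabs z.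
Proof.
move=> n0 w0 z1 v0; have l1 : cabs (laplace_stieltjes P (w_ 0%N 0%N) v) <= 1.
  by apply: cabs_laplace_stieltjes => //; exact: measurable_funPT.
apply: cexpectation_le => [|x].
  by apply: (cmeas_nat_fun (fun m => _ ^+ m)); exact: measurable_funPT.
rewrite cabsX cabsM; apply: (@le_trans _ _ (cabs z * cabs (laplace_stieltjes P (w_ 0%N 0%N) v))).
  by rewrite -[leRHS]expr1 ler_wiXn2l ?mulr_ge0 ?mulr_ile1 ?cabs_ge0.
by rewrite ler_piMr ?cabs_ge0.
Qed.

Lemma partial_sum_renewal_increment d (T : measurableType d) {R : realType}
    (tau : nat -> T -> R) n x :
  partial_sum (renewal_increment tau) n.+1 x = tau n x.
Proof.
elim: n => [|n IH]; first by rewrite partial_sumS partial_sum0 add0r.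
by rewrite partial_sumS IH/= addrC subrK.
Qed.

Section indices.
Context d (T : measurableType d) {R : realType}.

Lemma at_index_fin (U : nmodType) (S : nat -> T -> U) (r : T -> \bar R) j x :
  r x = j%:R%:E -> at_index S r x = S j x.
Proof. by move=> rj; rewrite /at_index rj/= natrK. Qed.

Lemma before_index_fin (U : nmodType) (S : nat -> T -> U) (r : T -> \bar R) j x :
  r x = j%:R%:E -> before_index S r x = if j is m.+1 then S m x else 0.
Proof. by move=> rj; rewrite /before_index rj/= natrK. Qed.

Lemma at_index_pinfty (U : nmodType) (S : nat -> T -> U) (r : T -> \bar R) x :
  r x = +oo%E -> at_index S r x = S 0%N x.
Proof. by move=> rj; rewrite /at_index rj/= truncn0. Qed.

Lemma before_index_pinfty (U : nmodType) (S : nat -> T -> U) (r : T -> \bar R) x :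
  r x = +oo%E -> before_index S r x = 0.
Proof. by move=> rj; rewrite /before_index rj/= truncn0. Qed.

End indices.

Theorem theorem3p5 (d : measure_display) (Omega : measurableType d)
    (R : realType) (P : probability Omega R)
    (lambda : R) (lambda_gt0 : 0 < lambda)
    (t_ : nat -> {RV P >-> R}) (n_ : nat -> {RV P >-> nat})
    (w_ : nat -> nat -> {RV P >-> R}) (tau : nat -> {RV P >-> R})
    (* w_ j k is the weight of the j-th node lost at t_ k; indices start at 0 *)
    (t_poisson : poisson_process P lambda t_)
    (n_gt0 : forall k omega, (0 < n_ k omega)%N)
    (n_iid : iid P n_)
    (w_ge0 : forall j k omega, 0 <= w_ j k omega)
    (w_iid : iid P (fun jk : nat * nat => w_ jk.1 jk.2))
    (tnw_indep : mutually_independent P (tnth [tuple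
       sigma_family t_; sigma_family n_;
       sigma_family (fun jk : nat * nat => w_ jk.1 jk.2)]))
    (tau0_ge0 : forall omega, 0 <= tau 0%N omega)
    (tau_ndecr : forall n omega, tau n omega <= tau n.+1 omega)
    (Delta_iid : iid P (fun n => renewal_increment tau n.+1))
    (Delta_neq0 : ~ {ae P, forall omega, renewal_increment tau 1 omega = 0})
    (Delta0_indep : mutually_independent P (tnth [tuple
       sigma_rv (renewal_increment tau 0);
       sigma_family (fun n => renewal_increment tau n.+1)]))
    (tau_indep : mutually_independent P (tnth [tuple
       sigma_family tau;
       <<s sigma_family t_ `|` sigma_family n_ `|`
           sigma_family (fun jk : nat * nat => w_ jk.1 jk.2) >>]))
    (M1 M : nat) (M1_gt0 : (0 < M1)%N) (M1_lt_M : (M1 < M)%N)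
    (V : R) (V_gt0 : 0 < V)
    (u0 u alpha0 alpha v0 v beta0 beta theta0 theta h0 h : R[i])
    (u0_le1 : `|u0| <= 1) (u_le1 : `|u| <= 1)
    (alpha0_le1 : `|alpha0| <= 1) (alpha_le1 : `|alpha| <= 1)
    (v0_ge0 : 0 <= complex.Re v0) (v_ge0 : 0 <= complex.Re v)
    (beta0_ge0 : 0 <= complex.Re beta0) (beta_ge0 : 0 <= complex.Re beta)
    (theta0_ge0 : 0 <= complex.Re theta0) (theta_ge0 : 0 <= complex.Re theta)
    (h0_ge0 : 0 <= complex.Re h0) (h_ge0 : 0 <= complex.Re h) :
  let N : nat -> Omega -> nat := observed_total t_ n_ tau in
  let W : nat -> Omega -> R := observed_total t_
    (fun k omega => \sum_(j < n_ k omega) w_ j k omega) tau in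
  let mu1 : Omega -> \bar R := first_index (fun n omega => (M1 < N n omega)%N) in
  let mu : Omega -> \bar R := first_index (fun n omega => (M < N n omega)%N) in
  let nu : Omega -> \bar R := first_index (fun n omega => V < W n omega) in
  let rho : Omega -> \bar R := fun omega => mine (mu omega) (nu omega) in
  let g : R[i] -> R[i] := pgf P (n_ 0%N) in
  let l : R[i] -> R[i] := laplace_stieltjes P (w_ 0%N 0%N) in
  let L0 : R[i] -> R[i] := laplace_stieltjes P (renewal_increment tau 0) in
  let L : R[i] -> R[i] := laplace_stieltjes P (renewal_increment tau 1) in
  let gamma0 := fun z v theta : R[i] =>
    L0 (theta + lambda%:C - lambda%:C * g (z * l v)) in
  let gamma := fun z v theta : R[i] =>
    L (theta + lambda%:C - lambda%:C * g (z * l v)) in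
  let F := exit_transform gamma0 gamma u0 u alpha0 alpha
    v0 v beta0 beta theta0 theta h0 h in
  cexpectation P (fun omega =>
    u0 ^+ before_index N mu1 omega * u ^+ at_index N mu1 omega *
    alpha0 ^+ before_index N rho omega * alpha ^+ at_index N rho omega *
    cexp (- (v0 * (before_index W mu1 omega)%:C)
          - v * (at_index W mu1 omega)%:C
          - beta0 * (before_index W rho omega)%:C
          - beta * (at_index W rho omega)%:C) *
    cexp (- (theta0 * (before_index tau mu1 omega)%:C)
          - theta * (at_index tau mu1 omega)%:C
          - h0 * (before_index tau rho omega)%:C
          - h * (at_index tau rho omega)%:C) *
    (if (mu1 omega < rho omega)%E then 1 else 0))
  = Dxyw_inv F M1 M V.

Proof.
move=> N W mu1 mu nu rho g l L0 L gamma0 gamma F.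
pose a := node_increment t_ n_ tau.
pose b := weight_increment t_ n_ w_ tau.
pose c := renewal_increment tau.
have b0 i x : 0 <= b i x by exact: weight_increment_ge0.
have c0 i x : 0 <= c i x by exact: renewal_increment_ge0.
have mc i : measurable_fun setT (c i).
  by apply: (@measurable_renewal_increment R _ Omega tau) => j; exact: measurable_funPT.
have NE n x : N n x = partial_sum a n.+1 x by [].
have WE n x : W n x = partial_sum b n.+1 x by [].
have tauE n x : tau n x = partial_sum c n.+1 x by rewrite partial_sum_renewal_increment.
have bN j x : (if j is m.+1 then N m x else 0%N) = partial_sum a j x.
  by case: j => [|j] //; rewrite partial_sum0.
have bW j x : (if j is m.+1 then W m x else 0) = partial_sum b j x.
  by case: j => [|j] //; rewrite partial_sum0.
have btau j x : (if j is m.+1 then tau m x : R else 0) = partial_sum c j x.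
  by case: j => [|j]; rewrite ?partial_sum0// tauE.
have mu1E j x : first_passage a M1 j x -> mu1 x = j%:R%:E.
  move=> /andP[h1 h2]; apply: first_index_eq => // i ij; rewrite NE.
  apply/negP; rewrite -leqNgt; apply: leq_trans h1; exact: partial_sum_leq.
have mu1oo x : (forall j, ~ first_passage a M1 j x) -> mu1 x = +oo%E.
  move=> np; apply: first_index_pinfty => i.
  suff le k : (partial_sum a k x <= M1)%N by apply/negP; rewrite -leqNgt NE.
  elim: k => [|k IH]; first by rewrite partial_sum0.
  by rewrite leqNgt; apply/negP => gt; apply: (np k); rewrite /first_passage IH.
have nstay k x : ~ stay a b M V k.+1 x <-> ((M < N k x)%N \/ V < W k x).
  rewrite NE WE; split=> [ns|[gt|gt] /andP[leM leV]].
  - case: (ltnP M (partial_sum a k.+1 x)) => leM; [by left|right].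
    by rewrite ltNge; apply/negP => leV; apply: ns; rewrite /stay leM leV.
  - by move: leM; rewrite leqNgt gt.
  - by move: leV; rewrite leNgt gt.
have rhoE k x : first_exit a b M V k x -> rho x = k%:R%:E.
  move=> /andP[h1 /negP h2]; rewrite /rho mine_first_index; apply: first_index_eq.
    exact/nstay.
  by move=> i ik /nstay; apply; exact: (stay_leq b0 ik h1).
have rhooo x : (forall k, stay a b M V k x) -> rho x = +oo%E.
  move=> st; rewrite /rho mine_first_index; apply: first_index_pinfty => i /nstay; apply.
  exact: st.
have indicatorE j k x : mu1 x = j%:R%:E -> rho x = k%:R%:E ->
    (mu1 x < rho x)%E = (j < k)%N.
  by move=> -> ->; rewrite lte_fin ltr_nat.
apply: (@exit_functional_transform _ _ _ P a b c).
- exact: measurable_node_increment.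
- exact: measurable_weight_increment.
- exact: b0.
- exact: mc.
- exact: c0.
- by rewrite -le1_cabs.
- by rewrite -le1_cabs.
- by rewrite -le1_cabs.
- by rewrite -le1_cabs.
- exact: v0_ge0.
- exact: v_ge0.
- exact: beta0_ge0.
- exact: beta_ge0.
- exact: theta0_ge0.
- exact: theta_ge0.
- exact: h0_ge0.
- exact: h_ge0.
- exact: (joint_transform lambda_gt0 t_poisson n_iid w_ge0 w_iid tnw_indep tau0_ge0
    tau_ndecr Delta_iid Delta0_indep tau_indep).
(* The strict bound on [gamma] has two sources: the increments are not almost surely 0, and the real
   part of the exponent is at least lambda times 1 minus the modulus of the mark transform. *)
- move=> z y theta1 z1 y0 theta10; apply: laplace_stieltjes_lt1 => [|x||].
  + exact: (mc 1%N).
  + exact: (c0 1%N).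
  + exact: Delta_neq0.
  have m1 : cabs (mark_transform n_ w_ z y) < 1.
    exact: le_lt_trans (cabs_mark_transform_le n_gt0 w_ge0 (ltW z1) y0) z1.
  rewrite ReB ReD ReM/= mul0r subr0 -addrA ltr_wpDl// subr_gt0 gtr_pMr//.
  exact: (le_lt_trans (le_trans (ler_norm _) (Re_le_cabs _)) m1).
- exact: ltW.
- move=> j k x jk pj ek; have [mj rk] := (mu1E _ _ pj, rhoE _ _ ek).
  rewrite (indicatorE _ _ _ mj rk) jk mulr1.
  rewrite !(before_index_fin _ mj) !(before_index_fin _ rk) !(at_index_fin _ mj) !(at_index_fin _ rk).
  by rewrite !bN !bW !btau !NE !WE !tauE.
- move=> j k x kj pj ek; have [mj rk] := (mu1E _ _ pj, rhoE _ _ ek).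
  by rewrite (indicatorE _ _ _ mj rk) ltnNge kj mulr0.
- by move=> x np; rewrite (mu1oo _ np) ltNge leey mulr0.
(* Here rho = +oo, so mu_1 < rho holds and the indicator is 1; the indices at rho are read as 0. *)
- move=> j x pj st; have [mj rk] := (mu1E _ _ pj, rhooo _ st).
  rewrite mj rk ltry mulr1.
  rewrite !(before_index_fin _ mj) !(before_index_pinfty _ rk) !(at_index_fin _ mj) !(at_index_pinfty _ rk).
  rewrite !bN !bW !btau !NE !WE !tauE /weight.
  by rewrite !(partial_sum0 a) !(partial_sum0 b) !(partial_sum0 c).
Qed.
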